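(* Let $\gamma>0$. There is a constant $C_\gamma$ depending only on $\gamma$ such that the following holds. Let $f\in H^1(\mathbb{R})$ and let $u\in H^2(\mathbb{R})$ solve $-u_{xx}+\gamma u=f$ on $\mathbb{R}$ with $\lim_{|x|\to\infty}u(x)=0$. For an integer $N\ge1$ and $\beta>0$ let $u_N\in\widehat{P}_N^\beta$ be the solution of the Hermite–Galerkin problem \[ (\partial_xu_N,\partial_xv_N)+\gamma(u_N,v_N)=(\widehat{I}_N^\beta f,v_N)\quad\text{for all }v_N\in\widehat{P}_N^\beta. \] Then \[ \|u-u_N\|_1\le C_\gamma\Bigl(E_N^\beta(\partial_xu)+(1+\beta\sqrt N)E_N^\beta(u)+\beta^{-1}N^{-1/3}E_N^\beta(\partial_xf)+N^{1/6}E_N^\beta(f)\Bigr). \]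
   Context: $(\cdot,\cdot)$ and $\|\cdot\|$ are the $L^2(\mathbb{R})$ inner product and norm; $\|\cdot\|_1$ is the $H^1(\mathbb{R})$ norm. $\mathbb{I}_A$ is the indicator function of $A$ and $\mathcal{F}[w](k)=\frac{1}{\sqrt{2\pi}}\int w(x)e^{-ikx}dx$. Hermite functions: $\widehat{H}_n(x)=\frac{1}{\pi^{1/4}\sqrt{2^nn!}}e^{-x^2/2}H_n(x)$, with $H_n$ the Hermite polynomials. $\widehat{P}_N^\beta=\{e^{-\beta^2x^2/2}\psi(x):\ \psi\text{ a polynomial of degree}\le N\}$. If $x_0<\dots<x_N$ are the roots of $\widehat{H}_{N+1}$, then $\widehat{I}_N^\beta f$ is the unique element of $\widehat{P}_N^\beta$ agreeing with $f$ at the points $x_j/\beta$, $0\le j\le N$. For $w\in L^2(\mathbb{R})$, $E_N^\beta(w)=\|w\cdot\mathbb{I}_{\{|x|>\frac{1}{2\sqrt2}\sqrt N/\beta\}}\|+\|\mathcal{F}[w](k)\cdot\mathbb{I}_{\{|k|>\frac{1}{2\sqrt2}\sqrt N\beta\}}\|+\|w\|e^{-N/16}$. *)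

(* Defs.v *)
From HB Require Import structures.
From mathcomp Require Import all_boot all_order all_algebra.
From mathcomp Require Import all_classical all_reals all_analysis.
Set Implicit Arguments. Unset Strict Implicit. Unset Printing Implicit Defensive.
Import Order.TTheory GRing.Theory Num.Theory.
Import numFieldNormedType.Exports.
Local Open Scope classical_set_scope.
Local Open Scope ring_scope.

Section Defs.
Variable R : realType.
Local Notation mu := (@lebesgue_measure R).

Definition rint (A : set R) (w : R -> R) : R := fine (\int[mu]_(x in A) (w x)%:E).

Definition L2 (w : R -> R) : Prop :=
  measurable_fun setT w /\ (\int[mu]_x ((w x) ^+ 2)%:E < +oo)%E.

Definition L2inner (w v : R -> R) : R := rint setT (fun x => w x * v x).
Definition L2norm (w : R -> R) : R := Num.sqrt (rint setT (fun x => (w x) ^+ 2)).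

(* [H1 w w'] : w is (the continuous representative of) an element of H^1(R)
   and w' (in L^2) is its weak derivative: w is locally absolutely continuous
   with w(b) - w(a) = int_a^b w'. *)
Definition H1 (w w' : R -> R) : Prop :=
  L2 w /\ L2 w' /\ forall a b, a <= b -> w b - w a = rint `[a, b] w'.

Definition H1norm (w w' : R -> R) : R := Num.sqrt (L2norm w ^+ 2 + L2norm w' ^+ 2).

Definition indic (A : set R) (x : R) : R := if `[< A x >] then 1 else 0.

Fixpoint hermite (n : nat) : {poly R} :=
  match n with
  | 0 => 1
  | m.+1 => match m with
            | 0 => 2%:R *: 'X
            | k.+1 => 2%:R *: 'X * hermite m - (2 * m)%:R *: hermite k
            end
  end.

Definition hermite_fun (n : nat) (x : R) : R :=
  (pi `^ (4^-1) * Num.sqrt (2 ^+ n * n`!%:R))^-1 * expR (- x ^+ 2 / 2) * (hermite n).[x].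

Definition hatP (beta : R) (psi : {poly R}) (x : R) : R :=
  expR (- (beta ^+ 2 * x ^+ 2) / 2) * psi.[x].

Definition is_hermite_interp (N : nat) (beta : R) (f g : R -> R) : Prop :=
  (exists2 chi : {poly R}, (size chi <= N.+1)%N & g = hatP beta chi) /\
  forall x, hermite_fun N.+1 x = 0 -> g (x / beta) = f (x / beta).

(* |F[w](k)|^2 for the truncation w * 1_{[-r,r]} (a genuine Lebesgue integral),
   with F[w](k) = (2 pi)^{-1/2} int w(x) e^{-ikx} dx written in real/imaginary parts *)
Definition fourier_trunc_sq (w : R -> R) (r k : R) : R :=
  ((rint `[-r, r] (fun x => w x * cos (k * x))) ^+ 2
   + (rint `[-r, r] (fun x => w x * sin (k * x))) ^+ 2) / (2 * pi).

(* || F[w](k) 1_{|k| > K} || for w in L^2, the L^2 Fourier transform being the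
   L^2-limit of the transforms of the truncations w 1_{[-n,n]} (Plancherel) *)
Definition fourier_tail_norm (w : R -> R) (K : R) : R :=
  Num.sqrt (limn (fun n : nat =>
     rint [set k | K < `|k|] (fourier_trunc_sq w n%:R))).

Definition E_err (N : nat) (beta : R) (w : R -> R) : R :=
  let c := (2 * Num.sqrt 2)^-1 in
  L2norm (fun x => w x * indic [set y | c * Num.sqrt N%:R / beta < `|y|] x)
  + fourier_tail_norm w (c * Num.sqrt N%:R * beta)
  + L2norm w * expR (- (N%:R / 16)).

End Defs.

(* Main.v *)
(** Let [P] be the [L^2]-projection onto the span of the first Hermite functions of scale [b].

    Projection error. Truncate [w] to [|x| <= X], [X = sqrt (N / 8) / b], and let [r] be the residual
    of the truncation [w0]. By Plancherel, [2 pi |r|^2 = 2 pi <w0, r>] is the integral of the spectral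
    density of the pair [(w0, r)]. Averaging this density over Gaussian windows centred at
    frequencies [|k| <= 2 K], [K = sqrt (N / 8) * b], yields pairings of [r] with coherent states
    centred at [(x, k)]. The coefficients of a coherent state on the Hermite functions follow a
    Poisson law of mean at most [5 N / 16], so its part orthogonal to the first [N] modes, which is
    all that [r] sees, is exponentially small. The part of the density missed by the windows is
    controlled by the frequency tail of [w]. For [w] in [H^1], differentiation commutes with [P] up
    to two boundary modes, which costs a factor [b * sqrt N].

    Interpolation. Gauss-Hermite quadrature expresses the norm of an element of the approximation
    space through its values at the nodes. The weights are bounded by means of energies of the
    oscillator equation for the Hermite functions: a WKB energy up to the turning point and an Airy
    energy across it, which is where the power [N^(1/6)] comes from. The spacing of the nodes then
    bounds the sum of squares of the samples of an [H^1] function.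

    Both bounds enter Cea's argument, the interpolation error of [f] being a consistency error. *)

Require Import Defs.
From HB Require Import structures.
From mathcomp Require Import all_boot all_order all_algebra.
From mathcomp Require Import all_classical all_reals all_analysis measurable_realfun.
From mathcomp Require Import ring lra.
Import Order.TTheory GRing.Theory Num.Theory.
Import numFieldNormedType.Exports.
Set Implicit Arguments. Unset Strict Implicit. Unset Printing Implicit Defensive.
Local Open Scope classical_set_scope.
Local Open Scope ring_scope.

(** * Integrable and square-integrable functions *)

(** The cut-offs in [E_err] are sharp, while coherent states are localised only up to Gaussian
    tails; the numerical margins absorb the difference. With $|bx|^2\le N/8$ and $|k/b|^2\le N/2$
    the Poisson mean is at most half of $5N/8$, and $2^{-N}e^{5N/16}$ stays below $e^{-N/8}$ with
    room for the power $N^{3/2}$ produced by the integrations in $x$ and $k$. The window centres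
    extend to $2K$ and not only to $K$ so that every omitted window is at distance at least $K$ from
    the frequencies below $K$, where it leaks at most a multiple of $e^{-N/16}$. Interpolation
    reproduces the approximation space, so only its stability on $f-Pf$ matters. There $k=N^{1/6}$
    is the Airy scale: the turning zone has width at most $2/k$, so an energy of rate $k$ changes in
    it by a bounded factor. Numbers of modes are tracked because the derivative of a Hermite
    function involves both neighbouring modes: the basic bound is proved for $N-1$ modes and used
    for the $N+1$ modes of the Galerkin space. *)

Lemma ler_eqW (R : numDomainType) (x y : R) : x = y -> x <= y.
Proof. by move=> ->. Qed.

Section L2_basics.
Variable R : realType.
Local Notation mu := (@lebesgue_measure R).
Implicit Types (f g h w : R -> R).

Definition Lint f := mu.-integrable setT (EFin \o f).

Lemma Lint_meas f : Lint f -> measurable_fun setT f.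
Proof. by move=> /measurable_int /measurable_EFinP. Qed.

Lemma Lint_bound f g : measurable_fun setT f -> Lint g ->
  (forall x, `|f x| <= g x) -> Lint f.
Proof.
move=> mf ig fg; apply: le_integrable ig => //; first exact/measurable_EFinP.
by move=> x _ /=; rewrite lee_fin (le_trans (fg x))// ler_norm.
Qed.

Lemma Lint_eq f g : (forall x, f x = g x) -> Lint f -> Lint g.
Proof. by move=> /funext ->. Qed.

Lemma LintD f g : Lint f -> Lint g -> Lint (fun x => f x + g x).
Proof. by move=> If Ig; exact: integrableD If Ig. Qed.

Lemma LintZ c f : Lint f -> Lint (fun x => c * f x).
Proof. by move=> If; exact: integrableZl If. Qed.

Lemma LintB f g : Lint f -> Lint g -> Lint (fun x => f x - g x).
Proof. by move=> If Ig; exact: integrableB If Ig. Qed.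

Lemma Lint_abs f : Lint f -> Lint (fun x => `|f x|).
Proof. exact: integrable_norm. Qed.

Lemma Lint0 : Lint (fun=> 0).
Proof. exact: integrable0. Qed.

Lemma Lint_sum (I : Type) (s : seq I) (F : I -> R -> R) :
  (forall i, Lint (F i)) -> Lint (fun x => \sum_(i <- s) F i x).
Proof.
move=> HF; elim: s => [|i s IH].
  by apply: Lint_eq Lint0 => x; rewrite big_nil.
by apply: Lint_eq (LintD (HF i) IH) => x; rewrite big_cons.
Qed.

Lemma rintE A f : rint A f = Rintegral mu A f. Proof. by []. Qed.

Lemma eq_rint A f g : (forall x, A x -> f x = g x) -> rint A f = rint A g.
Proof. by move=> fg; apply: eq_Rintegral => x /set_mem; exact: fg. Qed.

Lemma rintD f g : Lint f -> Lint g ->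
  rint setT (fun x => f x + g x) = rint setT f + rint setT g.
Proof. by move=> ? ?; exact: RintegralD. Qed.

Lemma rintB f g : Lint f -> Lint g ->
  rint setT (fun x => f x - g x) = rint setT f - rint setT g.
Proof. by move=> ? ?; exact: RintegralB. Qed.

Lemma rintZ c f : Lint f -> rint setT (fun x => c * f x) = c * rint setT f.
Proof. by move=> ?; exact: RintegralZl. Qed.

Lemma rint0 : rint setT (fun=> 0 : R) = 0.
Proof. by rewrite /rint integral0. Qed.

Lemma rintN f : Lint f -> rint setT (fun x => - f x) = - rint setT f.
Proof.
move=> If; rewrite -mulN1r -rintZ//; apply: eq_rint => x _.
by rewrite mulN1r.
Qed.

Lemma rint_sum (I : Type) (s : seq I) (F : I -> R -> R) :
  (forall i, Lint (F i)) ->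
  rint setT (fun x => \sum_(i <- s) F i x) = \sum_(i <- s) rint setT (F i).
Proof.
move=> HF; elim: s => [|i s IH].
  by rewrite big_nil -[RHS]rint0; apply: eq_rint => x _; rewrite big_nil.
rewrite big_cons -IH -rintD//; last exact: Lint_sum.
by apply: eq_rint => x _; rewrite big_cons.
Qed.

Lemma rint_ge0 A f : (forall x, A x -> 0 <= f x) -> 0 <= rint A f.
Proof. exact: (@Rintegral_ge0 _ _ _ mu A f). Qed.

Lemma rint_le f g : Lint f -> Lint g -> (forall x, f x <= g x) ->
  rint setT f <= rint setT g.
Proof. by move=> ? ? fg; apply: (@le_Rintegral _ _ _ mu) => // x _; exact: fg. Qed.

Lemma rint_abs f : Lint f -> `|rint setT f| <= rint setT (fun x => `|f x|).
Proof. exact: le_normr_Rintegral. Qed.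

Lemma rint_abs_le f g : Lint f -> Lint g -> (forall x, `|f x| <= g x) ->
  `|rint setT f| <= rint setT g.
Proof.
by move=> If Ig fg; apply: le_trans (rint_abs If) (rint_le (Lint_abs If) Ig fg).
Qed.

Lemma rint_EFin f : Lint f -> (\int[mu]_x (f x)%:E = (rint setT f)%:E)%E.
Proof. by move=> If; rewrite /rint fineK// integrable_fin_num. Qed.

Lemma Lint_nonneg f : measurable_fun setT f -> (forall x, 0 <= f x) ->
  Lint f <-> (\int[mu]_x (f x)%:E < +oo)%E.
Proof.
move=> mf f0; split=> [/integrableP[_]|foo].
  by under eq_integral do rewrite gee0_abs ?lee_fin//.
apply/integrableP; split; first exact/measurable_EFinP.
by under eq_integral do rewrite gee0_abs ?lee_fin//.
Qed.

Lemma L2_meas f : L2 f -> measurable_fun setT f. Proof. by case. Qed.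

Lemma L2P f : measurable_fun setT f -> Lint (fun x => f x ^+ 2) -> L2 f.
Proof.
move=> mf If; split => //; apply/Lint_nonneg => //.
  exact: Lint_meas.
by move=> x; exact: sqr_ge0.
Qed.

Lemma L2_Lint f : L2 f -> Lint (fun x => f x ^+ 2).
Proof.
move=> [mf foo]; apply/Lint_nonneg => //; first exact: measurable_funX.
by move=> x; exact: sqr_ge0.
Qed.

Lemma L2_bound f g : measurable_fun setT f -> L2 g ->
  (forall x, `|f x| <= `|g x|) -> L2 f.
Proof.
move=> mf Lg fg; apply: L2P => //; apply: Lint_bound (L2_Lint Lg) _.
  exact: measurable_funX.
by move=> x; rewrite normrX -[leRHS]real_normK ?num_real// lerXn2r ?nnegrE.
Qed.

Lemma L2M_Lint f g : L2 f -> L2 g -> Lint (fun x => f x * g x).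
Proof.
move=> Lf Lg; apply: (Lint_bound _ (LintD (L2_Lint Lf) (L2_Lint Lg))).
  by apply: measurable_funM; exact: L2_meas.
move=> x; rewrite normrM -(real_normK (num_real (f x))).
rewrite -(real_normK (num_real (g x))).
have := sqr_ge0 (`|f x| - `|g x|); have := normr_ge0 (f x).
by have := normr_ge0 (g x); nra.
Qed.

Lemma L2D f g : L2 f -> L2 g -> L2 (fun x => f x + g x).
Proof.
move=> Lf Lg; apply: L2P; first by apply: measurable_funD; exact: L2_meas.
apply: Lint_eq (LintD (LintD (L2_Lint Lf) (LintZ 2 (L2M_Lint Lf Lg))) (L2_Lint Lg)).
by move=> x /=; ring.
Qed.

Lemma L2Z c f : L2 f -> L2 (fun x => c * f x).
Proof.
move=> Lf; apply: L2P; first by apply: measurable_funM => //; exact: L2_meas.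
by apply: Lint_eq (LintZ (c ^+ 2) (L2_Lint Lf)) => x /=; ring.
Qed.

Lemma L2_eq f g : (forall x, f x = g x) -> L2 f -> L2 g.
Proof. by move=> /funext ->. Qed.

Lemma L2B f g : L2 f -> L2 g -> L2 (fun x => f x - g x).
Proof.
by move=> Lf Lg; apply: L2_eq (L2D Lf (L2Z (-1) Lg)) => x; rewrite mulN1r.
Qed.

Lemma ipC f g : L2inner f g = L2inner g f.
Proof. by apply: eq_rint => x _; rewrite mulrC. Qed.

Lemma eq_ip f1 f2 g1 g2 : (forall x, f1 x = f2 x) -> (forall x, g1 x = g2 x) ->
  L2inner f1 g1 = L2inner f2 g2.
Proof. by move=> /funext -> /funext ->. Qed.

Lemma ipDl f g h : L2 f -> L2 g -> L2 h ->
  L2inner (fun x => f x + g x) h = L2inner f h + L2inner g h.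
Proof.
move=> Lf Lg Lh; rewrite /L2inner -rintD ?L2M_Lint//.
by apply: eq_rint => x _; rewrite mulrDl.
Qed.

Lemma ipBl f g h : L2 f -> L2 g -> L2 h ->
  L2inner (fun x => f x - g x) h = L2inner f h - L2inner g h.
Proof.
move=> Lf Lg Lh; rewrite /L2inner -rintB ?L2M_Lint//.
by apply: eq_rint => x _; rewrite mulrBl.
Qed.

Lemma ipZl c f h : L2 f -> L2 h ->
  L2inner (fun x => c * f x) h = c * L2inner f h.
Proof.
move=> Lf Lh; rewrite /L2inner -rintZ ?L2M_Lint//.
by apply: eq_rint => x _; rewrite mulrA.
Qed.

Lemma ip_suml (I : Type) (s : seq I) (F : I -> R -> R) h :
  (forall i, L2 (F i)) -> L2 h ->
  L2inner (fun x => \sum_(i <- s) F i x) h = \sum_(i <- s) L2inner (F i) h.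
Proof.
move=> HF Lh; rewrite /L2inner -rint_sum; last by move=> i; exact: L2M_Lint.
by apply: eq_rint => x _; rewrite big_distrl.
Qed.

Lemma ipDr f g h : L2 f -> L2 g -> L2 h ->
  L2inner h (fun x => f x + g x) = L2inner h f + L2inner h g.
Proof. by move=> *; rewrite ipC ipDl// !(ipC h). Qed.

Lemma ipBr f g h : L2 f -> L2 g -> L2 h ->
  L2inner h (fun x => f x - g x) = L2inner h f - L2inner h g.
Proof. by move=> *; rewrite ipC ipBl// !(ipC h). Qed.

Lemma ipZr c f h : L2 f -> L2 h ->
  L2inner h (fun x => c * f x) = c * L2inner h f.
Proof. by move=> *; rewrite ipC ipZl// (ipC h). Qed.

Lemma ip_ge0 f : 0 <= L2inner f f.
Proof. by apply: rint_ge0 => x _; rewrite -expr2 sqr_ge0. Qed.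

Lemma L2norm_ge0 f : 0 <= L2norm f. Proof. exact: sqrtr_ge0. Qed.

Lemma sqr_L2norm f : L2norm f ^+ 2 = L2inner f f.
Proof.
rewrite /L2norm sqr_sqrtr; first by apply: eq_rint => x _; rewrite expr2.
by apply: rint_ge0 => x _; exact: sqr_ge0.
Qed.

Lemma L2norm_sqrt f : L2norm f = Num.sqrt (L2inner f f).
Proof. by rewrite -sqr_L2norm sqrtr_sqr ger0_norm// L2norm_ge0. Qed.

Lemma eq_L2norm f g : (forall x, f x = g x) -> L2norm f = L2norm g.
Proof. by move=> /funext ->. Qed.

Lemma ip_CS_sqr f g : L2 f -> L2 g ->
  L2inner f g ^+ 2 <= L2inner f f * L2inner g g.
Proof.
move=> Lf Lg.
have H t : 0 <= L2inner f f - 2 * t * L2inner f g + t ^+ 2 * L2inner g g.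
  have := ip_ge0 (fun x => f x - t * g x).
  have Lt := L2Z t Lg.
  by rewrite ipBl ?ipBr ?ipZl ?ipZr//; [rewrite (ipC g f); nra|exact: L2B].
have [g0|g0] := eqVneq (L2inner g g) 0.
  move: H; rewrite g0 mulr0 => H.
  have [->|fg0] := eqVneq (L2inner f g) 0; first by rewrite expr0n.
  (* With $(g,g)=0$ the form is affine in [t], and this [t] gives it the value $-1$. *)
  have := H ((L2inner f f + 1) / (2 * L2inner f g)).
  have -> : 2 * ((L2inner f f + 1) / (2 * L2inner f g)) * L2inner f g
     = L2inner f f + 1 by field.
  by rewrite mulr0 => ?; lra.
have gp : 0 < L2inner g g by rewrite lt_neqAle eq_sym g0 ip_ge0.
have := H (L2inner f g / L2inner g g).
have -> : L2inner f f - 2 * (L2inner f g / L2inner g g) * L2inner f g +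
   (L2inner f g / L2inner g g) ^+ 2 * L2inner g g
   = L2inner f f - L2inner f g ^+ 2 / L2inner g g by field.
by rewrite subr_ge0 ler_pdivrMr.
Qed.

Lemma ip_CS f g : L2 f -> L2 g -> `|L2inner f g| <= L2norm f * L2norm g.
Proof.
move=> Lf Lg; rewrite -(@ler_pXn2r _ 2) ?nnegrE ?mulr_ge0 ?L2norm_ge0//.
by rewrite exprMn !sqr_L2norm real_normK ?num_real// ip_CS_sqr.
Qed.

Lemma L2normD f g : L2 f -> L2 g ->
  L2norm (fun x => f x + g x) <= L2norm f + L2norm g.
Proof.
move=> Lf Lg; rewrite -(@ler_pXn2r _ 2) ?nnegrE ?addr_ge0 ?L2norm_ge0//.
have Lfg := L2D Lf Lg.
rewrite sqr_L2norm ipDl// !ipDr// (ipC g f) -!sqr_L2norm.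
by have := ip_CS Lf Lg; rewrite ler_norml => /andP[_]; nra.
Qed.

Lemma L2norm_triangle f g h : L2 g -> L2 h -> (forall x, f x = g x + h x) ->
  L2norm f <= L2norm g + L2norm h.
Proof. by move=> Lg Lh /eq_L2norm ->; exact: L2normD. Qed.

Lemma L2normZ c f : L2 f -> L2norm (fun x => c * f x) = `|c| * L2norm f.
Proof.
move=> Lf; rewrite !L2norm_sqrt ipZl ?ipZr//; last exact: L2Z.
by rewrite mulrA -expr2 sqrtrM ?sqr_ge0// sqrtr_sqr.
Qed.

Lemma L2normB f g : L2 f -> L2 g ->
  L2norm (fun x => f x - g x) <= L2norm f + L2norm g.
Proof.
move=> Lf Lg; have := L2normD Lf (L2Z (-1) Lg).
rewrite (L2normZ _ Lg) normrN1 mul1r; apply: le_trans.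
by rewrite (@eq_L2norm _ (fun x => f x - g x))// => x; rewrite mulN1r.
Qed.

Lemma L2norm_le f g : L2 f -> L2 g -> (forall x, `|f x| <= `|g x|) ->
  L2norm f <= L2norm g.
Proof.
move=> Lf Lg fg; rewrite ler_wsqrtr// rint_le//; [exact: L2_Lint..|].
move=> x; rewrite -[leLHS]real_normK ?num_real// -[leRHS]real_normK ?num_real//.
by rewrite lerXn2r ?nnegrE.
Qed.

Lemma indicTE (A : set R) x : \1_A x = if `[< A x >] then 1 else 0 :> R.
Proof.
rewrite indicE; case: asboolP => H; [by rewrite mem_set|by rewrite memNset].
Qed.

Lemma Defs_indicE (A : set R) : Defs.indic A = \1_A :> (R -> R).
Proof. by apply/funext => x; rewrite indicTE. Qed.

Lemma indic01 (A : set R) x : 0 <= (\1_A x : R) <= 1.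
Proof. by rewrite indicTE; case: ifP; lra. Qed.

Lemma L2_indic f (A : set R) : measurable A -> L2 f ->
  L2 (fun x => f x * \1_A x).
Proof.
move=> mA Lf; apply: (L2_bound _ Lf).
  by apply: measurable_funM; [exact: L2_meas|exact: measurable_indic].
move=> x; rewrite normrM ler_piMr//; have /andP[? ?] := indic01 A x.
by rewrite ger0_norm.
Qed.

Lemma Lint_indic f (A : set R) : measurable A -> Lint f ->
  Lint (fun x => f x * \1_A x).
Proof.
move=> mA Lf; apply: (Lint_bound _ (Lint_abs Lf)).
  by apply: measurable_funM; [exact: Lint_meas|exact: measurable_indic].
move=> x; rewrite normrM ler_piMr//; have /andP[? ?] := indic01 A x.
by rewrite ger0_norm.
Qed.

Lemma rint_indic f (A : set R) :
  rint A f = rint setT (fun x => f x * \1_A x).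
Proof.
rewrite /rint integral_mkcond; congr fine; apply: eq_integral => x _.
rewrite /patch indicE.
by case: ifP; rewrite ?mulr1 ?mulr0.
Qed.

Lemma rint_indic_itv (a b : R) : a <= b ->
  rint setT (\1_(`[a, b]%classic) : R -> R) = b - a.
Proof.
move=> ab; rewrite /rint integral_indic//= setIT.
have := lebesgue_measure_itv `[a, b]; rewrite /= lte_fin => ->.
by move: ab; rewrite le_eqVlt => /predU1P[->|ab]; rewrite ?ltxx ?subrr// ab.
Qed.

End L2_basics.

(** * Calculus and Gaussian decay *)

Section calculus.
Variable R : realType.
Implicit Types (f g F : R -> R).

(** The differentiation rules are restated for functions written pointwise, the shape that [der_tac]
    matches. *)
Lemma der_cst (c x : R) : is_derive x 1 (fun=> c) 0.
Proof. exact: is_derive_cst. Qed.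

Lemma der_id (x : R) : is_derive x 1 (fun x : R => x) 1.
Proof. exact: is_derive_id. Qed.

Lemma der_D f g (x a b : R) : is_derive x 1 f a -> is_derive x 1 g b ->
  is_derive x 1 (fun x => f x + g x) (a + b).
Proof. exact: is_deriveD. Qed.

Lemma der_N f (x a : R) : is_derive x 1 f a -> is_derive x 1 (fun x => - f x) (- a).
Proof. exact: is_deriveN. Qed.

Lemma der_M f g (x a b : R) : is_derive x 1 f a -> is_derive x 1 g b ->
  is_derive x 1 (fun x => f x * g x) (f x * b + g x * a).
Proof. exact: is_deriveM. Qed.

Lemma der_X f (n : nat) (x a : R) : is_derive x 1 f a ->
  is_derive x 1 (fun x => f x ^+ n) (n%:R * f x ^+ n.-1 * a).
Proof.
move=> fa; have := is_deriveX n fa; congr is_derive.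
by apply/funext => y; elim: n => [|n IH]; rewrite ?expr0// !exprS -IH.
Qed.

Lemma der_comp f g (x a b : R) : is_derive x 1 g b -> is_derive (g x) 1 f a ->
  is_derive x 1 (fun x => f (g x)) (a * b).
Proof. by move=> ? ?; exact: is_derive1_comp. Qed.

Lemma der_expR f (x a : R) : is_derive x 1 f a ->
  is_derive x 1 (fun x => expR (f x)) (expR (f x) * a).
Proof. by move=> ?; exact: der_comp. Qed.

Lemma der_cos f (x a : R) : is_derive x 1 f a ->
  is_derive x 1 (fun x => cos (f x)) (- sin (f x) * a).
Proof. by move=> ?; exact: der_comp. Qed.

Lemma der_sin f (x a : R) : is_derive x 1 f a ->
  is_derive x 1 (fun x => sin (f x)) (cos (f x) * a).
Proof. by move=> ?; exact: der_comp. Qed.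

Lemma der_horner f (p : {poly R}) (x a : R) : is_derive x 1 f a ->
  is_derive x 1 (fun x => p.[f x]) (p^`().[f x] * a).
Proof. by move=> ?; exact: (@der_comp (horner p)). Qed.

Lemma der_sqrt f (x a : R) : 0 < f x -> is_derive x 1 f a ->
  is_derive x 1 (fun x => Num.sqrt (f x)) ((2 * Num.sqrt (f x))^-1 * a).
Proof. by move=> ? ?; apply: (@der_comp Num.sqrt) => //; exact: is_derive1_sqrt. Qed.

Lemma der_V f (x a : R) : f x != 0 -> is_derive x 1 f a ->
  is_derive x 1 (fun x => (f x)^-1) (- (f x)^-2 * a).
Proof. by move=> f0 fa; exact: (is_deriveV f0). Qed.

Lemma der_cont f (x a : R) : is_derive x 1 f a -> {for x, continuous f}.
Proof.
by move=> fa; apply/differentiable_continuous/derivable1_diffP; case: fa.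
Qed.

Lemma der_cont_all f f' : (forall x : R, is_derive x 1 f (f' x)) -> continuous f.
Proof. by move=> H x; exact: der_cont (H x). Qed.

Lemma MVT_closed f f' (a b : R) : a <= b ->
  (forall x : R, a <= x <= b -> is_derive x 1 f (f' x)) ->
  exists2 c : R, a <= c <= b & f b - f a = f' c * (b - a).
Proof.
move=> ab H; have [||c] := @MVT_segment _ f f' a b ab.
- by move=> x /[!in_itv]/= /andP[? ?]; apply: H; rewrite !ltW.
- apply: continuous_in_subspaceT => x; rewrite inE/= in_itv/= => axb.
  exact: der_cont (H x axb).
by rewrite in_itv/= => ? ?; exists c.
Qed.

Lemma der_mono f f' (a b : R) : a <= b ->
  (forall x : R, a <= x <= b -> is_derive x 1 f (f' x)) ->
  (forall x, a <= x <= b -> 0 <= f' x) -> f a <= f b.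
Proof.
move=> ab H H0; have [c cab E] := MVT_closed ab H.
by rewrite -subr_ge0 E mulr_ge0 ?H0// subr_ge0.
Qed.

Lemma cont_meas f : continuous f -> measurable_fun setT f.
Proof. exact: continuous_measurable_fun. Qed.

End calculus.

Lemma der_eq (R : realType) (f : R -> R) (x a b : R) :
  is_derive x 1 f a -> a = b -> is_derive x 1 f b.
Proof. by move=> H <-. Qed.

(** The rules build the derivative as an unknown; [der_solve] then compares it with the stated one
    by the tactic [t]. *)
Ltac der_tac := repeat first
  [ notypeclasses refine (der_cst _ _) | notypeclasses refine (der_id _)
  | notypeclasses refine (der_D _ _) | notypeclasses refine (der_N _)
  | notypeclasses refine (der_M _ _) | notypeclasses refine (der_X _ _)
  | notypeclasses refine (der_expR _) | notypeclasses refine (der_cos _)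
  | notypeclasses refine (der_sin _) | notypeclasses refine (der_horner _ _) ].
Ltac der_solve t := notypeclasses refine (der_eq _ _); [der_tac | rewrite /=; t].

(** * Limits and affine substitution under the integral sign *)

Section convergence.
Variable R : realType.
Local Notation mu := (@lebesgue_measure R).
Implicit Types (f g : R -> R).

Lemma ae_imply (P Q : R -> Prop) : {ae mu, forall x, P x} ->
  (forall x, P x -> Q x) -> {ae mu, forall x, Q x}.
Proof.
move=> [N [mN N0 H]] PQ; exists N; split => // x nQ; apply: H => Px.
exact/nQ/PQ.
Qed.

Lemma rint_dominated (F : nat -> R -> R) f g :
  (forall n, measurable_fun setT (F n)) -> measurable_fun setT f -> Lint g ->
  {ae mu, forall x, F n x @[n --> \oo] --> f x} ->
  (forall n x, `|F n x| <= g x) ->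
  Lint f /\ rint setT (F n) @[n --> \oo] --> rint setT f.
Proof.
move=> mF mf ig Ff Fg.
have [|||||H1 _ H2] := @dominated_convergence _ _ _ mu setT measurableT
  (fun n => EFin \o F n) (EFin \o f) (EFin \o g).
- by move=> n; apply: measurableT_comp; [|exact: mF].
- by apply: measurableT_comp; [|exact: mf].
- apply: (ae_imply Ff) => x H _; apply: cvg_EFin => //; exact: nearW.
- exact: ig.
- by apply: aeW => x n _; rewrite lee_fin.
split => //; apply: fine_cvg.
by move: H2; rewrite /rint fineK//; exact: integrable_fin_num.
Qed.

Lemma rint_itv_cvg f : Lint f ->
  rint `[- n%:R, n%:R] f @[n --> \oo] --> rint setT f.
Proof.
move=> If.
have := @rint_dominated (fun n x => f x * \1_(`[-n%:R, n%:R]%classic) x) f (fun x => `|f x|).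
have -> : (fun n => rint setT (fun x => f x * \1_(`[-n%:R, n%:R]%classic) x))
  = (fun n => rint `[- n%:R, n%:R] f) by apply/funext => n; rewrite -rint_indic.
case=> //.
- by move=> n; apply: measurable_funM; [exact: Lint_meas|exact: measurable_indic].
- exact: Lint_meas.
- exact: Lint_abs.
- apply: aeW => x; apply: cvg_near_cst.
  near=> n; rewrite indicTE asboolT ?mulr1//= in_itv/= -ler_norml.
  near: n; exact: nbhs_infty_ger.
- move=> n x; rewrite normrM ler_piMr//.
  by have /andP[? ?] := indic01 `[-n%:R, n%:R]%classic x; rewrite ger0_norm.
Unshelve. all: by end_near. Qed.

Lemma rint_deriv_itv F f (a b : R) : a <= b ->
  (forall x : R, is_derive x 1 F (f x)) -> continuous f ->
  rint `[a, b] f = F b - F a.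
Proof.
rewrite le_eqVlt => /predU1P[->|ab] dF cf.
  by rewrite set_itv1 rintE Rintegral_set1 subrr.
have cF : continuous F := der_cont_all dF.
rewrite /rint (@continuous_FTC2 _ f F)//.
- exact: continuous_subspaceT.
- split; [by move=> x _; case: (dF x)|exact/cvg_at_right_filter/cF|].
  exact/cvg_at_left_filter/cF.
- by move=> x _; rewrite derive1E; exact: derive_val.
Qed.

Lemma rint_deriv0 F f :
  (forall x : R, is_derive x 1 F (f x)) -> continuous f -> Lint f ->
  F n%:R @[n --> \oo] --> 0 -> F (- n%:R) @[n --> \oo] --> 0 ->
  rint setT f = 0.
Proof.
move=> dF cf If F1 F2.
have H := rint_itv_cvg If.
have E : (fun n => rint `[-n%:R, n%:R] f) = (fun n => F n%:R - F (- n%:R)).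
  apply/funext => n; apply: rint_deriv_itv => //.
  by rewrite (@le_trans _ _ 0)// oppr_le0.
rewrite E in H.
have H2 : (F n%:R - F (- n%:R)) @[n --> \oo] --> 0 by rewrite -(subr0 0); exact: cvgB.
exact: (cvg_unique (@Rhausdorff R) H H2).
Qed.

Lemma rint_affine_ge0 f (c d : R) : 0 < c -> continuous f -> (forall x, 0 <= f x) ->
  (\int[mu]_x (f x)%:E = c%:E * \int[mu]_x (f (c * x + d))%:E)%E.
Proof.
move=> c0 cf f0.
have dF (x : R) : is_derive x 1 (fun x => c * x + d) c.
  by der_solve ltac:(ring).
have eF : derive1 (fun x : R => c * x + d) = cst c.
  by apply/funext => x; rewrite derive1E; exact: derive_val.
rewrite (@increasing_ge0_integration_by_substitutionT _ (fun x => c * x + d) f)//.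
- rewrite eF -ge0_integralZl//.
  + by apply: eq_integral => x _; rewrite -EFinM mulrC.
  + apply: measurableT_comp => //; apply: cont_meas => x.
    by apply: continuous_comp; [exact: der_cont (dF x)|exact: cf].
  + by move=> x _; rewrite lee_fin.
  + by rewrite lee_fin ltW.
- by move=> x y xy; rewrite ltrD2r ltr_pM2l.
- by rewrite eF; exact: cst_continuous.
- by rewrite eF; exact: is_cvg_cst.
- by rewrite eF; exact: is_cvg_cst.
- apply/cvgrNyPle => A; near=> x.
  rewrite -lerBrDr -ler_pdivlMl//; near: x; exact: nbhs_ninfty_le.
- apply/cvgryPge => A; near=> x.
  rewrite -lerBlDr -ler_pdivrMl//; near: x; exact: nbhs_pinfty_ge.
Unshelve. all: by end_near. Qed.

Lemma Lint_affine f (c d : R) : 0 < c -> continuous f -> Lint f ->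
  Lint (fun x => f (c * x + d)).
Proof.
move=> c0 cf If.
have caf : continuous (fun x => `|f x|).
  by move=> x; apply: continuous_comp; [exact: cf|exact: norm_continuous].
have cg : continuous (fun x => c * x + d).
  by apply: (@der_cont_all _ _ (fun=> c)) => x; der_solve ltac:(ring).
have m : measurable_fun setT (fun x => f (c * x + d)).
  by apply: cont_meas => x; apply: continuous_comp; [exact: cg|exact: cf].
have ma : measurable_fun setT (fun x => `|f (c * x + d)|).
  exact: measurableT_comp.
suff : Lint (fun x => `|f (c * x + d)|) by move=> /Lint_bound; exact.
apply/Lint_nonneg => //; have /Lint_abs/Lint_nonneg := If.
rewrite (rint_affine_ge0 d c0 caf)// => H.
have : (c%:E * \int[mu]_x `|f (c * x + d)|%:E < +oo)%E.
  by apply: H => //; exact: cont_meas.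
rewrite !ltey; apply: contra => /eqP ->.
by rewrite gt0_muley// lte_fin.
Qed.

Lemma rint_affine f (c d : R) : 0 < c -> continuous f -> Lint f ->
  rint setT f = c * rint setT (fun x => f (c * x + d)).
Proof.
move=> c0 cf If.
have pos g : continuous g -> Lint g -> (forall x, 0 <= g x) ->
    rint setT g = c * rint setT (fun x => g (c * x + d)).
  move=> cg Ig g0; rewrite /rint (rint_affine_ge0 d c0 cg)// fineM//.
  exact: (integrable_fin_num measurableT (Lint_affine d c0 cg Ig)).
have caf : continuous (fun x => `|f x|).
  by move=> x; apply: continuous_comp; [exact: cf|exact: norm_continuous].
have Iaf := Lint_abs If.
(* Write $f=(f+|f|)-|f|$, a difference of continuous nonnegative functions, to which the
   substitution rule applies. *)
have csf : continuous (fun x => f x + `|f x|).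
  by move=> x; exact: (cvgD (cf x) (caf x)).
have sf0 x : 0 <= f x + `|f x| by have := ler_norm (- f x); rewrite normrN; lra.
have E1 := pos _ csf (LintD If Iaf) sf0.
have E2 := pos _ caf Iaf (fun x => normr_ge0 (f x)).
have I2 : Lint (fun x => `|f (c * x + d)|) by apply: (@Lint_affine (fun x => `|f x|)).
apply: (addIr (rint setT (fun x => `|f x|))).
rewrite -(rintD If Iaf) E2 -mulrDr -(rintD (Lint_affine d c0 cf If) I2).
exact: E1.
Qed.

End convergence.

(** * Functions with Gaussian decay *)

Section gaussian_domination.
Variable R : realType.
Implicit Types (f g F : R -> R) (p : {poly R}).

(** This class is stable under sums, polynomial factors and bounded factors. It yields both
    integrability and the vanishing of the boundary terms in integrations by parts. *)
Definition gdom F := exists C a : R, [/\ 0 <= C, 0 < a &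
  forall x, `|F x| <= C * expR (- (a * x ^+ 2))].

Lemma gdomD F G : gdom F -> gdom G -> gdom (fun x => F x + G x).
Proof.
move=> [C [a [C0 a0 H]]] [D [b [D0 b0 K]]].
exists (C + D), (Num.min a b); split; [exact: addr_ge0|by rewrite lt_min a0|].
move=> x; rewrite (le_trans (ler_normD _ _))// mulrDl lerD//.
- apply: (le_trans (H x)); rewrite ler_wpM2l// ler_expR lerN2.
  by rewrite ler_wpM2r ?sqr_ge0// ge_min lexx.
- apply: (le_trans (K x)); rewrite ler_wpM2l// ler_expR lerN2.
  by rewrite ler_wpM2r ?sqr_ge0// ge_min lexx orbT.
Qed.

Lemma gdom_le F G : gdom F -> (forall x, `|G x| <= `|F x|) -> gdom G.
Proof.
move=> [C [a [C0 a0 H]]] GF; exists C, a; split => // x.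
exact: le_trans (GF x) (H x).
Qed.

Lemma gdomZ (c : R) F : gdom F -> gdom (fun x => c * F x).
Proof.
move=> [C [a [C0 a0 H]]]; exists (`|c| * C), a; split => //.
  exact: mulr_ge0.
by move=> x; rewrite normrM -mulrA ler_wpM2l.
Qed.

Lemma gdom_bounded F G (M : R) : gdom F -> (forall x, `|G x| <= M) ->
  gdom (fun x => F x * G x).
Proof.
move=> /(gdomZ M) gF GM; apply: (gdom_le gF) => x.
have := GM x; have := normr_ge0 (G x); rewrite !normrM => ? ?.
by rewrite mulrC ler_wpM2r// (le_trans (GM x)) ?ler_norm.
Qed.

Lemma gdomX F : gdom F -> gdom (fun x => x * F x).
Proof.
move=> [C [a [C0 a0 H]]]; exists (C * (1 + 2 / a)), (a / 2); split.
- by rewrite mulr_ge0// addr_ge0// divr_ge0// ltW.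
- by rewrite divr_gt0.
move=> x; rewrite normrM.
have E : expR (- (a * x ^+ 2)) = expR (- (a / 2 * x ^+ 2)) * expR (- (a / 2 * x ^+ 2)).
  by rewrite -expRD; congr expR; field.
(* Half of the exponent absorbs the factor:
   $|x|\le1+x^2\le(1+2/a)(1+ax^2/2)\le(1+2/a)e^{ax^2/2}$. *)
have K : `|x| * expR (- (a / 2 * x ^+ 2)) <= 1 + 2 / a.
  rewrite expRN ler_pdivrMr ?expR_gt0//.
  have /le_trans : `|x| <= (1 + 2 / a) * (1 + a / 2 * x ^+ 2).
    have -> : (1 + 2 / a) * (1 + a / 2 * x ^+ 2) = 1 + x ^+ 2 + (2 / a + a / 2 * x ^+ 2).
      by field; rewrite gt_eqF.
    have : 0 <= 2 / a + a / 2 * x ^+ 2.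
      by apply: addr_ge0; [apply: divr_ge0 => //; exact: ltW|apply: mulr_ge0; rewrite ?sqr_ge0// divr_ge0// ltW].
    rewrite -(real_normK (num_real x)); have := normr_ge0 x; nra.
  apply; rewrite ler_wpM2l//; first by rewrite addr_ge0// divr_ge0// ltW.
  exact: expR_ge1Dx.
apply: (le_trans (ler_wpM2l (normr_ge0 x) (H x))).
rewrite E (_ : `|x| * _ = C * (`|x| * expR (- (a / 2 * x ^+ 2))) * expR (- (a / 2 * x ^+ 2))); last by ring.
by rewrite ler_wpM2r ?expR_ge0// ler_wpM2l.
Qed.

Lemma gdom_horner F p : gdom F -> gdom (fun x => F x * p.[x]).
Proof.
move=> gF; elim/poly_ind: p => [|p c IH].
  exists 0, 1; split => // x; by rewrite horner0 mulr0 normr0 mul0r.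
have := gdomD (gdomX IH) (gdomZ c gF).
by congr gdom; apply/funext => x; rewrite hornerMXaddC; ring.
Qed.

Lemma gdom_gauss (a y c : R) : 0 < a ->
  gdom (fun x => expR (- (a * x ^+ 2) + y * x + c)).
Proof.
move=> a0; exists (expR (y ^+ 2 / (2 * a) + c)), (a / 2).
split; [exact: expR_ge0|by rewrite divr_gt0|].
move=> x; rewrite ger0_norm ?expR_ge0// -expRD ler_expR.
have : 0 <= (a * x - y) ^+ 2 / (2 * a).
  by rewrite divr_ge0 ?sqr_ge0// mulr_ge0// ltW.
have -> : (a * x - y) ^+ 2 / (2 * a) = a / 2 * x ^+ 2 - y * x + y ^+ 2 / (2 * a).
  by field; rewrite gt_eqF.
lra.
Qed.

Lemma Lint_gauss (a : R) : 0 < a -> Lint (fun x : R => expR (- (a * x ^+ 2))).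
Proof.
move=> a0; have := @Lint_affine R gauss_fun (Num.sqrt a) 0.
rewrite sqrtr_gt0 a0 => /(_ isT (@continuous_gauss_fun R) (@integrableT_gauss R)).
apply: Lint_eq => x; rewrite /gauss_fun addr0 exprMn sqr_sqrtr ?ltW//.
Qed.

Lemma gdom_Lint F : measurable_fun setT F -> gdom F -> Lint F.
Proof.
move=> mF [C [a [C0 a0 H]]]; apply: (Lint_bound mF _ H).
exact/LintZ/Lint_gauss.
Qed.

Lemma gdom_L2 F : measurable_fun setT F -> gdom F -> L2 F.
Proof.
move=> mF gF; apply: L2P => //; apply: gdom_Lint.
  exact: measurable_funX.
have [C [a [C0 a0 H]]] := gF.
have := gdom_bounded (G := F) (M := C) gF.
rewrite (_ : (fun x => F x * F x) = (fun x => F x ^+ 2)); last first.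
  by apply/funext => x; rewrite expr2.
apply => x; apply: (le_trans (H x)); rewrite ler_piMr// -expR0 ler_expR.
by rewrite oppr_le0 mulr_ge0 ?sqr_ge0// ltW.
Qed.

Lemma gdom_cvg0 F (u : nat -> R) : gdom F -> (forall n, `|u n| = n%:R) ->
  F (u n) @[n --> \oo] --> 0.
Proof.
move=> [C [a [C0 a0 H]]] un.
apply/cvgr0Pnorm_le => e e0; near=> n.
apply: (le_trans (H _)); rewrite -(real_normK (num_real (u n))) un.
rewrite expRN ler_pdivrMr ?expR_gt0//.
have : 1 + a * n%:R ^+ 2 <= expR (a * n%:R ^+ 2) := expR_ge1Dx _.
have n1 : (1 : R) <= n%:R by near: n; exact: nbhs_infty_ger.
have nC : C / (e * a) <= n%:R by near: n; exact: nbhs_infty_ger.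
move: nC; rewrite ler_pdivrMr ?mulr_gt0// => nC H1.
have : C <= e * (a * n%:R ^+ 2) by nra.
move=> /le_trans; apply; rewrite ler_pM2l//; lra.
Unshelve. all: by end_near. Qed.

Lemma rint_deriv0_gdom F f :
  (forall x : R, is_derive x 1 F (f x)) -> continuous f -> gdom f -> gdom F ->
  rint setT f = 0.
Proof.
move=> dF cf gf gF; apply: (rint_deriv0 dF cf).
- exact: gdom_Lint (cont_meas cf) gf.
- by apply: gdom_cvg0 => // n; rewrite normr_nat.
- by apply: gdom_cvg0 => // n; rewrite normrN normr_nat.
Qed.

End gaussian_domination.

(** * Hermite polynomials *)

Section hermite_algebra.
Variable R : realType.
Local Notation H := (@hermite R).
Implicit Types (p q : {poly R}).

Lemma hermiteSS n : H n.+2 = 2 * 'X * H n.+1 - (2 * n.+1)%:R * H n.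
Proof.
by rewrite -[LHS]/(2%:R *: 'X * H n.+1 - (2 * n.+1)%:R *: H n) !scaler_nat !mulr_natl.
Qed.

Lemma hermite1 : H 1 = 2 * 'X.
Proof. by rewrite /= scaler_nat mulr_natl. Qed.

Lemma deriv_hermite n : (H n.+1)^`() = (2 * n.+1)%:R * H n.
Proof.
have d2X : (2 * 'X)^`() = 2 :> {poly R} by rewrite mulr_natl derivMn derivX.
have dN k p : (k%:R * p)^`() = k%:R * p^`() by rewrite !mulr_natl derivMn.
elim/ltn_ind: n => -[_|[_|n IH]].
- by rewrite hermite1 d2X mulr1.
- have dH0 : (H 0)^`() = 0 by exact: derivC.
  by rewrite hermiteSS derivB derivM d2X dN dH0 hermite1 d2X mulr0 subr0; ring.
rewrite hermiteSS derivB derivM d2X dN (IH n.+1)// (IH n)//.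
rewrite hermiteSS; ring.
Qed.

Lemma horner_nat k x : (k%:R : {poly R}).[x] = k%:R.
Proof. by rewrite hornerMn hornerC. Qed.

Lemma hermiteS n : H n.+1 = 2 * 'X * H n - (H n)^`().
Proof.
case: n => [|n]; first by rewrite hermite1 /= derivC subr0 mulr1.
by rewrite deriv_hermite hermiteSS.
Qed.

Lemma size_hermite n : size (H n) = n.+1.
Proof.
elim/ltn_ind: n => -[_|[_|n IH]].
- by rewrite size_poly1.
- by rewrite hermite1 mulr_natl -scaler_nat size_scale ?pnatr_eq0// size_polyX.
rewrite hermiteSS size_polyDl; last first.
  rewrite size_polyN mulr_natl -scaler_nat size_scale ?pnatr_eq0// IH//.
  by rewrite mulr_natl mulrnAl -scaler_nat size_scale ?pnatr_eq0// -commr_polyX size_mulX -?size_poly_eq0 IH.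
by rewrite mulr_natl mulrnAl -scaler_nat size_scale ?pnatr_eq0// -commr_polyX size_mulX -?size_poly_eq0 IH.
Qed.

Lemma hermite_neq0 n : H n != 0.
Proof. by rewrite -size_poly_eq0 size_hermite. Qed.

Lemma lead_coef_hermite n : lead_coef (H n) = 2 ^+ n.
Proof.
rewrite lead_coefE size_hermite /=.
elim: n => [|n IH]; first by rewrite /= coef1.
rewrite hermiteS coefB -mulrA mulr_natl coefMn coefXM/= IH.
rewrite [X in _ - X]nth_default ?subr0.
  by rewrite exprS mulr_natl.
by rewrite -size_hermite ltnW// lt_size_deriv// hermite_neq0.
Qed.

Lemma hermite_opp n x : (H n).[- x] = (-1) ^+ n * (H n).[x].
Proof.
elim/ltn_ind: n => -[_|[_|n IH]].
- by rewrite /= !hornerC mul1r.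
- by rewrite hermite1 !hornerM !hornerX !horner_nat; ring.
rewrite hermiteSS !(horner_nat, hornerM, hornerX, hornerN, hornerD) !IH//.
rewrite !exprS; ring.
Qed.

Lemma hermite_diff_eq n :
  (H n)^`()^`() - 2 * 'X * (H n)^`() + (2 * n)%:R * H n = 0.
Proof.
case: n => [|n]; first by rewrite /= !derivC muln0; ring.
rewrite !deriv_hermite.
have -> : ((2 * n.+1)%:R * H n)^`() = (2 * n.+1)%:R * (H n)^`() :> {poly R}.
  by rewrite !mulr_natl derivMn.
rewrite hermiteS; ring.
Qed.

Lemma hermite_no_common_root n x :
  (H n.+1).[x] = 0 -> (H n).[x] = 0 -> False.
Proof.
elim: n => [|n IH].
  by move=> _ /eqP; rewrite hornerE oner_eq0.
move=> + H1; rewrite hermiteSS !(horner_nat, hornerM, hornerX, hornerN, hornerD) H1 mulr0 sub0r => /eqP.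
rewrite oppr_eq0 mulf_eq0 => /orP[|/eqP]; last exact: IH.
by rewrite -[_%:R == 0]/(_ == 0) pnatr_eq0.
Qed.

Lemma hermite_simple_root n x :
  (H n).[x] = 0 -> (H n)^`().[x] != 0.
Proof.
case: n => [/eqP|n]; first by rewrite hornerE oner_eq0.
move=> H1; apply/eqP; rewrite deriv_hermite !(horner_nat, hornerM, hornerX, hornerN, hornerD) => /eqP.
rewrite mulf_eq0 pnatr_eq0/= => /eqP; exact: hermite_no_common_root.
Qed.

(** By induction in the recurrence: $2(k+1)H_k\le x^2H_k\le xH_{k+1}$, so
    $H_{k+2}=2xH_{k+1}-2(k+1)H_k\ge xH_{k+1}$. No root can lie in this range. *)
Lemma hermite_pos_right n k x : 0 < x -> (2 * n)%:R <= x ^+ 2 -> (k <= n)%N ->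
  0 < (H k).[x] /\ x * (H k).[x] <= (H k.+1).[x].
Proof.
move=> x0 xn; elim: k => [_|k IH kn].
  rewrite hermite1 !hornerE; split=> //; lra.
have [H0 H1] := IH (ltnW kn).
have H2 : 0 < (H k.+1).[x] by apply: lt_le_trans H1; rewrite mulr_gt0.
split=> //; rewrite hermiteSS !(horner_nat, hornerM, hornerX, hornerN, hornerD).
have K : (2 * k.+1)%:R <= x ^+ 2 by apply: le_trans xn; rewrite ler_nat leq_mul2l.
suff : (2 * k.+1)%:R * (H k).[x] <= x * (H k.+1).[x] by lra.
apply: (@le_trans _ _ (x ^+ 2 * (H k).[x])); first by rewrite ler_wpM2r// ltW.
by rewrite expr2 -mulrA ler_wpM2l// ltW.
Qed.

(** The alternative $x=0$ is needed for the root of $H_1$, where the strict bound fails. *)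
Lemma hermite_root_bound n x : (H n.+1).[x] = 0 -> x ^+ 2 < (2 * n)%:R \/ x = 0.
Proof.
move=> Hx; have [->|x0] := eqVneq x 0; [by right|left].
rewrite ltNge; apply/negP => xn.
have Ha : (H n.+1).[`|x|] = 0.
  by case: (ler0P x) => // _; rewrite hermite_opp Hx mulr0.
have [|||H0 H1] := @hermite_pos_right n n `|x| => //.
- by rewrite normr_gt0.
- by rewrite real_normK ?num_real.
by move: H1; rewrite Ha leNgt mulr_gt0// normr_gt0.
Qed.

End hermite_algebra.

(** * Orthogonality and real roots of the Hermite polynomials *)

Section gauss_functional.
Variable R : realType.
Local Notation H := (@hermite R).
Local Notation mu := (@lebesgue_measure R).
Implicit Types (p q : {poly R}).

Definition gint p : R := rint setT (fun x => expR (- x ^+ 2) * p.[x]).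

Lemma gdom_expRN2 : gdom (fun x : R => expR (- x ^+ 2)).
Proof. by exists 1, 1; split => // x; rewrite !mul1r ger0_norm// expR_ge0. Qed.

Lemma gdom_poly p : gdom (fun x : R => expR (- x ^+ 2) * p.[x]).
Proof. exact/gdom_horner/gdom_expRN2. Qed.

Lemma der_gauss_poly p (x : R) : is_derive x 1
  (fun x => expR (- x ^+ 2) * p.[x]) (expR (- x ^+ 2) * (p^`() - 2 * 'X * p).[x]).
Proof. der_solve ltac:(rewrite !(horner_nat, hornerM, hornerX, hornerN, hornerD); ring). Qed.

Lemma cont_gauss_poly p : continuous (fun x : R => expR (- x ^+ 2) * p.[x]).
Proof. exact: (der_cont_all (der_gauss_poly p)). Qed.

Lemma Lint_gauss_poly p : Lint (fun x : R => expR (- x ^+ 2) * p.[x]).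
Proof. exact: gdom_Lint (cont_meas (@cont_gauss_poly p)) (gdom_poly p). Qed.

Lemma gintD p q : gint (p + q) = gint p + gint q.
Proof.
rewrite /gint -rintD; [|exact: Lint_gauss_poly..].
by apply: eq_rint => x _; rewrite hornerD mulrDr.
Qed.

Lemma gintZ c p : gint (c *: p) = c * gint p.
Proof.
rewrite /gint -rintZ; last exact: Lint_gauss_poly.
by apply: eq_rint => x _; rewrite hornerZ mulrCA.
Qed.

Lemma gintB p q : gint (p - q) = gint p - gint q.
Proof. by rewrite -scaleN1r gintD gintZ mulN1r. Qed.

Lemma gint0 : gint 0 = 0.
Proof. by rewrite -(scale0r (0 : {poly R})) gintZ mul0r. Qed.

Lemma gint_sum (I : Type) (s : seq I) (F : I -> {poly R}) :
  gint (\sum_(i <- s) F i) = \sum_(i <- s) gint (F i).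
Proof.
by elim: s => [|i s IH]; rewrite ?big_nil ?gint0// !big_cons gintD IH.
Qed.

Lemma gint1 : gint 1 = Num.sqrt pi.
Proof.
rewrite /gint /rint -[RHS]/(fine (Num.sqrt pi)%:E) -integralT_gauss.
by congr fine; apply: eq_integral => x _; rewrite hornerC mulr1.
Qed.

Lemma gint_parts p : gint (p^`() - 2 * 'X * p) = 0.
Proof.
apply: (rint_deriv0_gdom (der_gauss_poly p)).
- exact: cont_gauss_poly.
- exact: gdom_poly.
- exact: gdom_poly.
Qed.

(** Integration by parts, $e^{-x^2}H_{n+1}$ being minus the derivative of $e^{-x^2}H_n$. Iterated,
    it gives orthogonality and the norms. *)
Lemma gint_hermiteS n q : gint (H n.+1 * q) = gint (H n * q^`()).
Proof.
apply/eqP; rewrite -subr_eq0 -gintB.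
have := gint_parts (H n * q).
have -> : (H n * q)^`() - 2 * 'X * (H n * q) = (-1) *: (H n.+1 * q - H n * q^`()).
  by rewrite scaleN1r derivM hermiteS; ring.
by rewrite gintZ mulN1r => /eqP; rewrite oppr_eq0.
Qed.

Lemma gint_hermite_orth n q : (size q <= n)%N -> gint (H n * q) = 0.
Proof.
elim: n q => [|n IH] q.
  by rewrite size_poly_leq0 => /eqP ->; rewrite mulr0 gint0.
move=> sq; rewrite gint_hermiteS IH//.
have [->|q0] := eqVneq q 0; first by rewrite derivC size_poly0.
by rewrite -ltnS (leq_trans (lt_size_deriv q0)).
Qed.

Definition hsq n : R := 2 ^+ n * n`!%:R * Num.sqrt pi.

Lemma hsq_gt0 n : 0 < hsq n.
Proof.
by rewrite /hsq !mulr_gt0// ?exprn_gt0// ?ltr0n ?fact_gt0// sqrtr_gt0 pi_gt0.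
Qed.

Lemma hsqS n : hsq n.+1 = (2 * n.+1)%:R * hsq n.
Proof. by rewrite /hsq factS exprS !natrM; ring. Qed.

Lemma gint_hermite_sqr n : gint (H n * H n) = hsq n.
Proof.
elim: n => [|n IH]; first by rewrite /= mulr1 gint1 /hsq expr0 fact0 !mul1r.
rewrite gint_hermiteS deriv_hermite hsqS -IH -gintZ; congr gint.
by rewrite scaler_nat -mulr_natl; ring.
Qed.

Lemma gint_hermite_neq m n : m != n -> gint (H m * H n) = 0.
Proof.
wlog mn : m n / (m < n)%N => [W|_].
  rewrite neq_ltn => /orP[mn|nm]; first by apply: W; rewrite ?neq_ltn mn.
  by rewrite mulrC; apply: W; rewrite ?neq_ltn nm.
by rewrite mulrC gint_hermite_orth// size_hermite.
Qed.

Lemma rint_gt0 (F : R -> R) x0 : continuous F -> Lint F -> (forall x, 0 <= F x) ->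
  0 < F x0 -> 0 < rint setT F.
Proof.
move=> cF iF F0 Fx0.
have /cvgrPdist_lt/(_ (F x0 / 2)) := cF x0.
rewrite divr_gt0// => /(_ isT)/nbhs_ballP[e /= e0 He].
pose A : set R := `[x0 - e / 2, x0 + e / 2]%classic.
have mA : measurable A by exact: measurable_itv.
have iA : Lint (\1_A : R -> R) by exact: integrable_indic_itv.
have -> // : 0 < rint setT F.
apply: (@lt_le_trans _ _ (rint setT (fun x => F x0 / 2 * \1_A x))).
  rewrite rintZ// mulr_gt0 ?divr_gt0//.
  by rewrite rint_indic_itv; lra.
apply: rint_le => //; first exact: LintZ.
move=> x; rewrite indicTE; case: asboolP => [|_]; last by rewrite mulr0.
rewrite /A/= in_itv/= => /andP[? ?]; rewrite mulr1.
have := He x; rewrite /ball/= !ltr_norml => H1.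
suff /H1/andP[_] : - e < x0 - x < e by lra.
by apply/andP; split; lra.
Qed.

Lemma gint_gt0 p x0 : (forall x, 0 <= p.[x]) -> 0 < p.[x0] -> 0 < gint p.
Proof.
move=> p0 px0; apply: (@rint_gt0 _ x0).
- exact: cont_gauss_poly.
- exact: Lint_gauss_poly.
- by move=> x; rewrite mulr_ge0// expR_ge0.
- by rewrite mulr_gt0// expR_gt0.
Qed.

Lemma poly_nonroot_itv (p : {poly R}) (a b : R) : a < b -> p != 0 ->
  exists2 x, a <= x <= b & p.[x] != 0.
Proof.
move=> ab p0; apply: contrapT => Hx.
(* The points with $i<$ [size p] are distinct and more numerous than the roots of [p]. *)
pose F (i : nat) := a + (b - a) / i.+1%:R.
have := @max_poly_roots _ p [seq F i | i <- iota 0 (size p)] p0.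
rewrite size_map size_iota ltnn => H1.
suff : false by []; apply: H1.
  apply/allP => y /mapP[i _ ->]; apply/eqP; apply: contrapT => /eqP Hi.
  apply: Hx; exists (F i) => //.
  have d0 : 0 <= (b - a) / i.+1%:R by rewrite divr_ge0// subr_ge0 ltW.
  have d1 : (b - a) / i.+1%:R <= b - a by rewrite ler_pdivrMr// ler_peMr// ?ler1n// subr_ge0 ltW.
  move: d0 d1; rewrite /F; set d := _ / _ => d0 d1; apply/andP; split; lra.
rewrite map_inj_uniq ?iota_uniq// => i j /addrI/mulfI.
rewrite subr_eq0 gt_eqF// => /(_ isT)/invr_inj/eqP; rewrite eqr_nat eqSS.
by move=> /eqP.
Qed.

(* A maximal set s of roots has n elements: otherwise H n = q * pr with pr the monic polynomial
   with roots s and q of constant sign, which contradicts the orthogonality of H n to pr. *)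
Lemma hermite_roots n : exists s : seq R,
  [/\ uniq s, size s = n & all (root (H n)) s].
Proof.
pose P m := `[< exists s : seq R, [/\ uniq s, size s = m & all (root (H n)) s] >].
have exP : exists m, P m by exists 0%N; apply/asboolP; exists [::].
have ubP m : P m -> (m <= n)%N.
  move=> /asboolP[s [us <- rs]].
  by have := max_poly_roots (hermite_neq0 R n) rs us; rewrite size_hermite.
case: (ex_maxnP exP ubP) => m /asboolP[s [us sm rs]] mmax.
have mn : (m <= n)%N by apply: ubP; apply/asboolP; exists s.
have [mnE|mnN] := eqVneq m n; first by exists s; split => //; rewrite -mnE.
have {mnN} {}mn : (m < n)%N by rewrite ltn_neqAle mnN.
have := rs => /uniq_roots_dvdp; rewrite uniq_rootsE => /(_ us)/dvdpP[q Hq].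
set pr := \prod_(z <- s) _ in Hq.
have spr : size pr = m.+1 by rewrite /pr size_prod_XsubC sm.
have qroot c : q.[c] != 0.
  apply/eqP => qc; have Hc : (H n).[c] = 0 by rewrite Hq hornerM qc mul0r.
  have [cs|cs] := boolP (c \in s).
    have prc : pr.[c] = 0.
      by apply/eqP; have := root_prod_XsubC s c; rewrite cs /root.
    have := hermite_simple_root Hc; rewrite Hq derivM hornerD !hornerM qc prc.
    by rewrite mulr0 mul0r addr0 eqxx.
  have : P m.+1.
    apply/asboolP; exists (c :: s); split => /=; rewrite ?sm ?cs//.
    by rewrite rs andbT; apply/eqP.
  by move=> /mmax; rewrite ltnn.
exfalso.
have G0 : gint (q * pr ^+ 2) = 0.
  by rewrite expr2 mulrA -Hq gint_hermite_orth// spr.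
have pr0 : pr != 0 by rewrite -size_poly_eq0 spr.
have [x0 _ prx0] := poly_nonroot_itv ltr01 pr0.
have qsign x y : 0 < q.[x] -> 0 < q.[y].
  move=> qx; rewrite ltNge le_eqVlt (negbTE (qroot y))/=; apply/negP => qy.
  have [xy|yx] := leP x y.
    have /= := @poly_ivt _ (- q) x y xy; rewrite !hornerN.
    case => [|c _]; first by apply/andP; lra.
    by rewrite /root hornerN oppr_eq0 (negbTE (qroot c)).
  have /= := @poly_ivt _ q y x (ltW yx).
  case => [|c _]; first by apply/andP; split; exact: ltW.
  by rewrite /root (negbTE (qroot c)).
have [qx0|qx0] := ltP 0 q.[x0].
  have : 0 < gint (q * pr ^+ 2).
    apply: (@gint_gt0 _ x0) => [x|].
      by rewrite hornerM horner_exp mulr_ge0 ?sqr_ge0// ltW// (qsign x0).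
    by rewrite hornerM horner_exp mulr_gt0// exprn_even_gt0.
  by rewrite G0 ltxx.
have : 0 < gint ((-1) *: (q * pr ^+ 2)).
  apply: (@gint_gt0 _ x0) => [x|].
    rewrite scaleN1r hornerN hornerM horner_exp -mulNr mulr_ge0 ?sqr_ge0//.
    rewrite oppr_ge0 leNgt; apply/negP => /(qsign x x0).
    by rewrite ltNge qx0.
  rewrite scaleN1r hornerN hornerM horner_exp -mulNr mulr_gt0//.
    by rewrite oppr_gt0 lt_neqAle qroot qx0.
  by rewrite exprn_even_gt0.
by rewrite gintZ G0 mulr0 ltxx.
Qed.

End gauss_functional.

Arguments hermite : simpl never.

(** * Hermite functions at their zeros *)

Lemma ler_sqr_pos (R : realDomainType) (x y : R) : 0 <= y -> x ^+ 2 <= y ^+ 2 -> x <= y.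
Proof.
move=> y0 xy; have [x0|x0] := leP 0 x; last by apply: le_trans y0; exact: ltW.
by rewrite -(@ler_pXn2r _ 2).
Qed.

Section hermite_at_zero.
Variable R : realType.
Local Notation H := (@hermite R).

(** Since $|H_{2m}(0)|=(2m)!/m!$, this is $\binom{2m}{m}\ge4^m/\sqrt{4m+1}$. After squaring, the
    induction step is $(2m+2)^2(4m+1)\le(4m+5)(2m+1)^2$, whose sides differ by 1. *)
Lemma hermite_even0 m : 2 ^+ (2 * m) * ((2 * m)`!)%:R
  <= Num.sqrt (4 * m%:R + 1) * (H (2 * m)).[0] ^+ 2.
Proof.
have s0 (k : nat) : (0 : R) <= 4 * k%:R + 1 by rewrite addr_ge0// mulr_ge0.
apply: ler_sqr_pos; first by rewrite mulr_ge0// sqr_ge0.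
rewrite [leRHS]exprMn sqr_sqrtr//.
elim: m => [|m IH].
  by rewrite muln0 expr0 fact0 /= hornerC; lra.
have -> : (2 * m.+1 = (2 * m).+2)%N by rewrite mulnS.
rewrite hermiteSS !(horner_nat, hornerM, hornerX, hornerN, hornerD).
rewrite !factS !exprS !natrM; move: IH.
set c := ((2 * m)`!)%:R; set a := (H (2 * m)).[0]; set e := 2 ^+ (2 * m).
have -> : ((2 * m).+1)%:R = 2 * m%:R + 1 :> R by rewrite -natr1 natrM.
have -> : ((2 * m).+2)%:R = 2 * m%:R + 2 :> R by rewrite -!natr1 natrM; ring.
have -> : m.+1%:R = m%:R + 1 :> R by rewrite -natr1.
have : (0 : R) <= m%:R by [].
set t : R := m%:R => t0 IH.
have K : (2 * t + 2) ^+ 2 * (4 * t + 1) <= (4 * (t + 1) + 1) * (2 * t + 1) ^+ 2.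
  by rewrite -subr_ge0 (_ : _ - _ = 1)//; ring.
have a4 : 0 <= (a ^+ 2) ^+ 2 by exact: sqr_ge0.
have K2 := ler_wpM2l (mulr_ge0 (sqr_ge0 (4 * (2 * t + 1))) a4) K.
have K3 := ler_wpM2l (sqr_ge0 (4 * ((2 * t + 2) * (2 * t + 1)))) IH.
rewrite [leLHS](_ : _ = (4 * ((2 * t + 2) * (2 * t + 1))) ^+ 2 * (e * c) ^+ 2); last by rewrite !expr0; ring.
apply: (le_trans K3).
rewrite [leLHS](_ : _ = (4 * (2 * t + 1)) ^+ 2 * (a ^+ 2) ^+ 2 * ((2 * t + 2) ^+ 2 * (4 * t + 1))); last by ring.
apply: (le_trans K2).
by apply: ler_eqW; rewrite !expr0; ring.
Qed.

(** The right-hand side is the WKB energy of the unnormalised Hermite function at 0, where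
    $s=\sqrt{2n+1}$; it starts the propagation towards the zeros. For even [n] the value suffices;
    for odd [n] the derivative does, through $H_n'=2nH_{n-1}$. *)
Lemma hermite_zero_ge n : 2 ^+ n * n`!%:R <=
  (H n)^`().[0] ^+ 2 / Num.sqrt (2 * n + 1)%:R
    + Num.sqrt (2 * n + 1)%:R * (H n).[0] ^+ 2.
Proof.
have sp (k : nat) : (0 : R) < Num.sqrt (2 * k + 1)%:R by rewrite sqrtr_gt0 ltr0n addn1.
have [m [b ->]] : exists m (b : bool), n = (2 * m + b)%N.
  by exists n./2, (odd n); rewrite mul2n addnC odd_double_half.
case: b => /=; last first.
  rewrite addn0; apply: (le_trans (hermite_even0 m)).
  have -> : (2 * (2 * m) + 1)%:R = 4 * m%:R + 1 :> R by rewrite natrD mulnA natrM.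
  by rewrite lerDr divr_ge0 ?sqr_ge0// ltW// sqrtr_gt0 ltr_wpDl// mulr_ge0.
rewrite addn1 deriv_hermite hornerM horner_nat.
apply: (@le_trans _ _ (((2 * (2 * m).+1)%:R * (H (2 * m)).[0]) ^+ 2
         / Num.sqrt (2 * (2 * m).+1 + 1)%:R)); last first.
  by rewrite lerDl mulr_ge0 ?sqr_ge0// ltW.
rewrite ler_pdivlMr//.
have E := hermite_even0 m; rewrite exprS factS natrM.
have -> : (2 * (2 * m).+1 + 1)%:R = 4 * m%:R + 3 :> R.
  by rewrite natrD natrM -(natr1 (2 * m)) natrM; ring.
have -> : (2 * (2 * m).+1)%:R = 2 * (2 * m%:R + 1) :> R by rewrite natrM -(natr1 (2 * m)) natrM.
have -> : (2 * m).+1%:R = (2 * m%:R + 1) :> R by rewrite -natr1 natrM.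
move: E; set c := ((2 * m)`!)%:R; set a := (H (2 * m)).[0]; set e := 2 ^+ (2 * m).
have : (0 : R) <= m%:R by []; set t : R := m%:R => t0 E.
have ss : Num.sqrt (4 * t + 1) * Num.sqrt (4 * t + 3) <= 2 * (2 * t + 1).
  rewrite -sqrtrM; last by lra.
  apply: ler_sqr_pos; first by lra.
  by rewrite sqr_sqrtr; [nra|rewrite mulr_ge0; lra].
have := ler_wpM2r (sqrtr_ge0 (4 * t + 3)) E.
have a2 := sqr_ge0 a.
have := ler_wpM2r a2 ss.
set u := Num.sqrt (4 * t + 1); set v := Num.sqrt (4 * t + 3) => h1 h2.
have h3 : e * c * v <= 2 * (2 * t + 1) * a ^+ 2 by lra.
have := ler_wpM2l (_ : 0 <= 2 * (2 * t + 1)) h3.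
move=> /(_ ltac:(lra)); lra.
Qed.

End hermite_at_zero.

(** * Energies of the oscillator equation *)

Section wkb.
Variable R : realType.
Implicit Types (x k : R).

(* J is a WKB energy of the oscillator Y'' = - s^2 Y, corrected by a cross term so that
   J x * expR (x / s x ^+ 3) is nondecreasing where x <= s^3. *)
Lemma wkb_mono (Y Y1 : R -> R) (lam x0 : R) : 0 <= x0 ->
  (forall x : R, is_derive x 1 Y (Y1 x)) ->
  (forall x : R, is_derive x 1 Y1 (- (lam - x ^+ 2) * Y x)) ->
  (forall x, 0 <= x <= x0 -> 0 < lam - x ^+ 2 /\ x ^+ 2 <= (lam - x ^+ 2) ^+ 3) ->
  let s x := Num.sqrt (lam - x ^+ 2) in
  let J x := Y1 x ^+ 2 / s x + s x * Y x ^+ 2 - x / s x ^+ 3 * (Y x * Y1 x) in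
  (Y1 x0 ^+ 2 / s x0 + s x0 * Y x0 ^+ 2) * 3 >= 2 * J x0 /\
  J 0 <= J x0 * expR 1 /\ 0 <= J 0.
Proof.
move=> x00 dY dY1 hq s J.
have sp x : 0 <= x <= x0 -> 0 < s x by move=> /hq[? _]; rewrite sqrtr_gt0.
have s2 x : 0 <= x <= x0 -> s x ^+ 2 = lam - x ^+ 2.
  by move=> /hq[? _]; rewrite sqr_sqrtr// ltW.
have B1 x : 0 <= x <= x0 -> 0 <= x / s x ^+ 3 <= 1.
  move=> xx; have sx := sp x xx; have /andP[xx0 _] := xx; apply/andP; split.
    by rewrite divr_ge0// exprn_ge0// ltW.
  rewrite ler_pdivrMr ?exprn_gt0// mul1r; apply: ler_sqr_pos.
    by rewrite exprn_ge0// ltW.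
  by rewrite -exprM mulnC exprM s2//; case: (hq x xx).
have amgm x : 0 <= x <= x0 -> `|Y x * Y1 x| * 2 <= Y1 x ^+ 2 / s x + s x * Y x ^+ 2.
  move=> xx; have sx := sp x xx.
  have : 0 <= (`|Y1 x| - s x * `|Y x|) ^+ 2 / s x by rewrite divr_ge0 ?sqr_ge0// ltW.
  rewrite normrM -(real_normK (num_real (Y x))) -(real_normK (num_real (Y1 x))).
  rewrite (_ : _ / s x = `|Y1 x| ^+ 2 / s x + s x * `|Y x| ^+ 2 - `|Y x| * `|Y1 x| * 2); first lra.
  by field; rewrite gt_eqF.
have BY x : 0 <= x <= x0 -> `|x / s x ^+ 3 * (Y x * Y1 x)| <= `|Y x * Y1 x|.
  move=> /B1/andP[? ?]; rewrite normrM ler_piMl// ger0_norm//.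
have Jge x : 0 <= x <= x0 -> `|Y x * Y1 x| <= J x.
  move=> xx; have := amgm x xx; have := BY x xx; rewrite ler_norml => /andP[_].
  by rewrite /J; lra.
pose B1d x := (s x ^+ 3)^-1 + 3 * x ^+ 2 / s x ^+ 5.
have ds x : 0 <= x <= x0 -> is_derive x 1 s (- x / s x).
  move=> xx; have sx := sp x xx; have [qx _] := hq x xx.
  notypeclasses refine (der_eq (@der_sqrt R (fun x => lam - x ^+ 2) x _ qx _) _); first der_tac.
  by rewrite /= -/(s x); field; rewrite gt_eqF.
pose T x := J x * expR (x / s x ^+ 3).
(* The cross term cancels the first-order part of the derivative: with $B=x/s^3$ one finds
   $J'=-B'YY_1$. As $|YY_1|\le J$ and $B'\ge0$, the factor $e^{B}$ restores monotonicity. *)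
have dT x : 0 <= x <= x0 -> is_derive x 1 T (expR (x / s x ^+ 3) * B1d x * (J x - Y x * Y1 x)).
  move=> xx; have sx := sp x xx; have sn : s x != 0 by rewrite gt_eqF.
  have dV : is_derive x 1 (fun x => (s x)^-1) (x / s x ^+ 3).
    notypeclasses refine (der_eq (der_V sn (ds x xx)) _).
    by field.
  have dV3 : is_derive x 1 (fun x => (s x ^+ 3)^-1) (3 * x / s x ^+ 5).
    notypeclasses refine (der_eq (der_V _ (der_X 3 (ds x xx))) _); first by rewrite expf_neq0.
    by rewrite /=; field.
  have dB : is_derive x 1 (fun x => x / s x ^+ 3) (B1d x).
    notypeclasses refine (der_eq (der_M (der_id _) dV3) _).
    by rewrite /= /B1d; field.
  rewrite /T /J.
  notypeclasses refine (der_eq (der_M (der_D (der_D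
    (der_M (der_X 2 (dY1 x)) dV) (der_M (ds x xx) (der_X 2 (dY x))))
    (der_N (der_M dB (der_M (dY x) (dY1 x))))) (der_expR dB)) _).
  rewrite /= -(s2 x xx) /B1d; field.
  exact: sn.
split.
  have xx : 0 <= x0 <= x0 by rewrite x00 lexx.
  have := amgm x0 xx; have := BY x0 xx; rewrite ler_norml => /andP[+ _].
  rewrite /J; set A := Y1 x0 ^+ 2 / _; set C := _ * Y x0 ^+ 2; set D := _ * (_ * _); lra.
have z0 : 0 <= (0 : R) <= x0 by rewrite lexx.
split; last by apply: le_trans (Jge 0 z0); exact: normr_ge0.
have T0 : T 0 = J 0 by rewrite /T mul0r expR0 mulr1.
rewrite -T0; apply: (@le_trans _ _ (T x0)).
  apply: (der_mono x00 dT) => x xx; rewrite !mulr_ge0 ?expR_ge0//.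
    rewrite addr_ge0// ?invr_ge0 ?exprn_ge0// ?(ltW (sp x xx))//.
    apply: divr_ge0; first by apply: mulr_ge0; rewrite ?sqr_ge0.
    by rewrite exprn_ge0// ltW// sp.
  by rewrite subr_ge0 (le_trans (ler_norm _))// Jge.
have xx : 0 <= x0 <= x0 by rewrite x00 lexx.
rewrite /T ler_wpM2l//; first by apply: le_trans (Jge x0 xx); exact: normr_ge0.
by rewrite ler_expR; have /andP[] := B1 x0 xx.
Qed.

(** Put $q=\lambda-x^2$ and $G=Y_1^2+k^2Y^2$. Then $G'=2YY_1(k^2-q)$ with $|k^2-q|\le k^2$, so
    $|G'|\le kG$. *)
Lemma airy_zone_mono (Y Y1 : R -> R) (lam k x0 x1 : R) : 0 < k -> x0 <= x1 ->
  (forall x : R, is_derive x 1 Y (Y1 x)) ->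
  (forall x : R, is_derive x 1 Y1 (- (lam - x ^+ 2) * Y x)) ->
  (forall x, x0 <= x <= x1 -> 0 <= lam - x ^+ 2 <= 2 * k ^+ 2) ->
  Y1 x0 ^+ 2 + k ^+ 2 * Y x0 ^+ 2 <=
  (Y1 x1 ^+ 2 + k ^+ 2 * Y x1 ^+ 2) * expR (k * (x1 - x0)).
Proof.
move=> k0 x01 dY dY1 hq.
pose G x := Y1 x ^+ 2 + k ^+ 2 * Y x ^+ 2.
pose T x := G x * expR (k * x).
have dT x : x0 <= x <= x1 -> is_derive x 1 T
   (expR (k * x) * (k * G x + 2 * (Y x * Y1 x) * (k ^+ 2 - (lam - x ^+ 2)))).
  move=> xx; rewrite /T /G.
  notypeclasses refine (der_eq (der_M (der_D (der_X 2 (dY1 x))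
     (der_M (der_cst (k ^+ 2) x) (der_X 2 (dY x)))) (der_expR (der_M (der_cst k x) (der_id x)))) _).
  by rewrite /=; ring.
have : T x0 <= T x1.
  apply: (der_mono x01 dT) => x /hq/andP[h1 h2]; rewrite mulr_ge0 ?expR_ge0//.
  have h3 : `|k ^+ 2 - (lam - x ^+ 2)| <= k ^+ 2 by rewrite ler_norml; apply/andP; split; lra.
  have h4 : `|2 * (Y x * Y1 x) * (k ^+ 2 - (lam - x ^+ 2))| <= 2 * `|Y x * Y1 x| * k ^+ 2.
    by rewrite normrM normrM ger0_norm// ler_wpM2l// mulr_ge0.
  have h5 : 2 * `|Y x * Y1 x| * k ^+ 2 <= k * G x.
    rewrite /G normrM -(real_normK (num_real (Y x))) -(real_normK (num_real (Y1 x))).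
    have := sqr_ge0 (`|Y1 x| - k * `|Y x|).
    by move=> h; have := mulr_ge0 (ltW k0) h; lra.
  by have := lerNnormlW h4; lra.
rewrite /T -/(G x0) -/(G x1) => h.
have -> : k * (x1 - x0) = k * x1 - k * x0 by ring.
by rewrite expRD expRN mulrA ler_pdivlMr ?expR_gt0.
Qed.

(** The product $(a-x_1)(a+x_1)=a^2-x_1^2$ is below $2k^2$, and the second factor is at least
    $k^3=\sqrt\nu$. Hence [airy_zone_mono] costs at most the factor $e^2$ across the zone. *)
Lemma turning_zone_width (k lam nu x1 a : R) : 0 < k -> k ^+ 6 = nu -> lam = 2 * nu + 3 ->
  1 <= k ^+ 2 -> k ^+ 2 <= nu -> 0 <= x1 -> x1 < a -> x1 ^+ 2 = lam - 2 * k ^+ 2 -> a ^+ 2 < lam ->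
  k * (a - x1) <= 2.
Proof.
move=> k0 k6 lamE k2 kN x10 xa x1sq al.
rewrite leNgt; apply/negP => kl.
have : k ^+ 3 <= a + x1.
  apply: (@le_trans _ _ (2 * x1)); last by lra.
  apply: ler_sqr_pos; first by lra.
  have h : 2 * k ^+ 2 - 1 <= nu.
    by rewrite -k6 (exprM k 2 3); move: (k ^+ 2) k2 => t t1; nra.
  by rewrite -exprM k6 exprMn x1sq lamE; lra.
move=> h; have : 2 * k ^+ 3 < k * (a - x1) * (a + x1).
  apply: (@le_lt_trans _ _ (2 * (a + x1))); first by rewrite ler_wpM2l.
  by rewrite ltr_pM2r//; lra.
have -> : k * (a - x1) * (a + x1) = k * (a ^+ 2 - x1 ^+ 2) by ring.
have -> : 2 * k ^+ 3 = k * (2 * k ^+ 2) by ring.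
by rewrite ltr_pM2l// x1sq; lra.
Qed.

(** The two energies meet where $s^2=2t$: multiplied by $s$, the WKB energy becomes $y_1+2ty_0$, at
    most twice the Airy energy $y_1+ty_0$. Here [y1] and [y0] stand for the squares of $Y_1$ and
    $Y$. *)
Lemma turning_point_energy (k s t J y1 y0 : R) : 0 < k -> k <= s -> s ^+ 2 = 2 * t -> 1 <= t ->
  0 <= y1 -> 0 <= y0 -> 2 * J <= (y1 / s + s * y0) * 3 -> k * J <= 3 * (y1 + t * y0).
Proof.
move=> k0 sk st t1 y10 y00 J1; have s0 : 0 < s by exact: lt_le_trans sk.
have [J0|J0] := leP J 0.
  apply: (@le_trans _ _ 0); first by rewrite mulr_ge0_le0// ltW.
  by rewrite mulr_ge0// addr_ge0// mulr_ge0//; lra.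
have h1 : 2 * J * s <= 3 * (y1 + s ^+ 2 * y0).
  have := ler_wpM2r (ltW s0) J1.
  rewrite (_ : (y1 / s + s * y0) * 3 * s = 3 * (y1 + s ^+ 2 * y0)) //.
  by field; rewrite gt_eqF.
have h2 : k * J <= J * s by rewrite mulrC ler_pM2l.
move: h1; rewrite st; have ty0 : 0 <= t * y0 by rewrite mulr_ge0//; lra.
lra.
Qed.

End wkb.

(** * Slopes of the Hermite functions at their zeros, and spacing of the zeros *)

Section hermite_weights.
Variable R : realType.
Local Notation H := (@hermite R).
Implicit Types (x : R).

Definition gp (p : {poly R}) x := expR (- x ^+ 2 / 2) * p.[x].

Lemma der_gp (p : {poly R}) x : is_derive x 1 (gp p) (gp (p^`() - 'X * p) x).
Proof.
rewrite /gp; der_solve ltac:(rewrite !(hornerM, hornerX, hornerN, hornerD); by field).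
Qed.

Lemma gp0 (p : {poly R}) : gp p 0 = p.[0].
Proof. by rewrite /gp expr0n oppr0 mul0r expR0 mul1r. Qed.

Local Notation Y n := (gp (H n)).
Local Notation Y1 n := (gp ((H n)^`() - 'X * H n)).

Lemma der2_gp_hermite n x :
  is_derive x 1 (Y1 n) (- ((2 * n + 1)%:R - x ^+ 2) * Y n x).
Proof.
apply: (der_eq (der_gp _ _)); rewrite /gp.
have := hermite_diff_eq R n; move=> /(congr1 (fun p => p.[x])).
rewrite derivB derivM derivX.
rewrite !(horner_nat, hornerM, hornerX, hornerN, hornerD, hornerC, horner0) => E.
rewrite natrD; move: E.
set a := (H n)^`()^`().[x]; set b := (H n)^`().[x]; set c := (H n).[x] => E.
have -> : a = 2 * x * b - (2 * n)%:R * c by lra.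
ring.
Qed.

Lemma Y1_root n x : (H n).[x] = 0 -> Y1 n x = gp (H n)^`() x.
Proof.
by move=> h; rewrite /gp !(hornerM, hornerX, hornerN, hornerD) h mulr0 subr0.
Qed.

Lemma deriv_hermite_opp n x : (H n)^`().[- x] ^+ 2 = (H n)^`().[x] ^+ 2.
Proof.
case: n => [|n]; first by rewrite /= derivC !hornerC.
rewrite deriv_hermite !hornerM !horner_nat hermite_opp.
by rewrite !exprMn sqrr_sign mul1r.
Qed.

(* The zero a is reached from 0 by the WKB energy up to the turning zone lam - x^2 <= 2 k^2,
   and through that zone, which has width at most 2 / k, by the energy Y'^2 + k^2 Y^2. *)
Lemma gp_deriv_root_ge (N : nat) (k a : R) : (1 <= N)%N -> 0 < k -> k ^+ 6 = N%:R ->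
  (H N.+1).[a] = 0 ->
  k * (2 ^+ N.+1 * (N.+1)`!%:R) <= 9 * expR 3 * gp (H N.+1)^`() a ^+ 2.
Proof.
move=> N1 k0 k6.
wlog a0 : a / 0 <= a => [W|] Ha.
  have [/W|a0] := leP 0 a; first exact.
  have := W (- a); rewrite oppr_ge0 (ltW a0) hermite_opp Ha mulr0.
  by rewrite /gp !exprMn sqrrN deriv_hermite_opp => ->.
set n := N.+1; set c0 := 2 ^+ n * _.
have c00 : 0 <= c0 by rewrite mulr_ge0// exprn_ge0.
pose lam : R := (2 * n + 1)%:R.
have lamE : lam = 2 * N%:R + 3 by rewrite /lam /n natrD natrM -natr1; ring.
have k1 : 1 <= k.
  rewrite leNgt; apply/negP => kl; have : k ^+ 6 < 1 by rewrite exprn_ilt1// ltW.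
  by rewrite k6 ltrn1 ltnNge N1.
have N1r : (1 : R) <= N%:R by rewrite ler1n.
have k2 : 1 <= k ^+ 2 by rewrite expr2; nra.
pose t := k ^+ 2; have t1 : 1 <= t by [].
have tN : t ^+ 3 = N%:R by rewrite /t -exprM k6.
have tN' : t <= N%:R by rewrite -tN; nra.
pose x1 := Num.sqrt (lam - 2 * t).
have lt0 : 0 <= lam - 2 * t by rewrite lamE; lra.
have x1sq : x1 ^+ 2 = lam - 2 * t by rewrite sqr_sqrtr.
have x10 : 0 <= x1 by exact: sqrtr_ge0.
have al : a ^+ 2 < lam.
  have [?|->] := hermite_root_bound Ha; last by rewrite expr0n/= lamE; lra.
  by apply: (@lt_trans _ _ (2 * N)%:R) => //; rewrite lamE natrM; lra.
have dY := der_gp (H n); have dY1 := der2_gp_hermite n.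
have J0E : c0 <= Y1 n 0 ^+ 2 / Num.sqrt (lam - 0 ^+ 2)
   + Num.sqrt (lam - 0 ^+ 2) * Y n 0 ^+ 2 - 0 / Num.sqrt (lam - 0 ^+ 2) ^+ 3 * (Y n 0 * Y1 n 0).
  rewrite expr0n subr0 !mul0r subr0 !gp0 !(hornerM, hornerX, hornerN, hornerD).
  rewrite mul0r subr0; exact: hermite_zero_ge.
(* This fixes $k^6=N$: outside the turning zone $(\lambda-y^2)^3\ge(2k^2)^3=8N\ge2N+3=\lambda\ge
   y^2$, the hypothesis of [wkb_mono]. *)
have hq (y : R) : y ^+ 2 <= lam - 2 * t -> 0 < lam - y ^+ 2 /\ y ^+ 2 <= (lam - y ^+ 2) ^+ 3.
  move=> yy; have q2 : 2 * t <= lam - y ^+ 2 by lra.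
  split; first by lra.
  have : (2 * t) ^+ 3 <= (lam - y ^+ 2) ^+ 3.
    by rewrite lerXn2r// ?nnegrE; lra.
  by rewrite exprMn tN; move: lamE yy N1r; lra.
have e1 := expR_gt0 (1 : R); have e2 := expR_gt0 (2 : R).
have e12 : expR 3 = expR 1 * expR 2 :> R by rewrite -expRD; congr expR; ring.
have e2g : 1 <= expR (2 : R) by rewrite -expR0 ler_expR.
have e1g : 1 <= expR (1 : R) by rewrite -expR0 ler_expR.
(* If the zero comes before the turning zone, the WKB energy alone reaches it. *)
have [ax|xa] := leP a x1.
  have ax2 : a ^+ 2 <= lam - 2 * t by rewrite -x1sq lerXn2r ?nnegrE.
  have [] := @wkb_mono R (Y n) (Y1 n) lam a a0 dY dY1.
    move=> x /andP[x0 xa]; apply: hq; apply: le_trans ax2.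
    by rewrite lerXn2r ?nnegrE// (le_trans x0).
  move=> _ [J1 _].
  have Ya : Y n a = 0 by rewrite /gp Ha mulr0.
  have := le_trans J0E J1.
  rewrite Ya expr0n mulr0 mul0r mulr0 subr0 addr0 Y1_root//.
  set s := Num.sqrt (lam - a ^+ 2); set g := gp _ a.
  have sk : k <= s.
    apply: ler_sqr_pos; rewrite ?sqrtr_ge0// sqr_sqrtr; last by lra.
    by rewrite -/t; lra.
  have s0 : 0 < s by apply: lt_le_trans sk.
  rewrite mulrAC ler_pdivlMr// => h.
  have h1 : k * c0 <= g ^+ 2 * expR 1 by apply: le_trans h; rewrite mulrC ler_wpM2l.
  apply: (le_trans h1); rewrite e12.
  have g2 := sqr_ge0 g.
  have : g ^+ 2 * expR 1 * 1 <= g ^+ 2 * expR 1 * expR 2 by rewrite ler_wpM2l// mulr_ge0// ltW.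
  have : 0 <= g ^+ 2 * expR 1 * expR 2 by apply: mulr_ge0; [apply: mulr_ge0 => //; exact: ltW|exact: ltW].
  lra.
have [] := @wkb_mono R (Y n) (Y1 n) lam x1 x10 dY dY1.
  move=> x /andP[x0 xx1]; apply: hq; rewrite -x1sq.
  by rewrite lerXn2r ?nnegrE// (le_trans x0).
rewrite x1sq (_ : lam - (lam - 2 * t) = 2 * t); last by ring.
set s := Num.sqrt (2 * t).
move=> J1 [J2 _].
have := le_trans J0E J2; move: J1; set J := (_ + _ - _) => J1 J3.
have st : s ^+ 2 = 2 * t by rewrite sqr_sqrtr; lra.
have s0 : 0 < s by rewrite sqrtr_gt0; lra.
have sk : k <= s by apply: ler_sqr_pos; rewrite ?(ltW s0)// st -/t; lra.
have := @airy_zone_mono R (Y n) (Y1 n) lam k x1 a k0 (ltW xa) dY dY1.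
have h0 x : x1 <= x <= a -> 0 <= lam - x ^+ 2 <= 2 * k ^+ 2.
  move=> /andP[xx xa']; have x0 : 0 <= x by apply: le_trans xx.
  have : x ^+ 2 <= a ^+ 2 by rewrite lerXn2r ?nnegrE.
  have : x1 ^+ 2 <= x ^+ 2 by rewrite lerXn2r ?nnegrE.
  by rewrite x1sq -/t => ? ?; apply/andP; split; lra.
move=> /(_ h0) G1.
have ka : k * (a - x1) <= 2 := turning_zone_width k0 k6 lamE t1 tN' x10 xa x1sq al.
have Ya : Y n a = 0 by rewrite /gp Ha mulr0.
move: G1; rewrite Ya expr0n mulr0 addr0 (Y1_root Ha); set g := gp _ a => G1.
have G2 : Y1 n x1 ^+ 2 + t * Y n x1 ^+ 2 <= g ^+ 2 * expR 2.
  by apply: (le_trans G1); rewrite ler_wpM2l ?sqr_ge0// ler_expR.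
have G3 : k * J <= 3 * (Y1 n x1 ^+ 2 + t * Y n x1 ^+ 2).
  by apply: (turning_point_energy k0 sk st t1 _ _ J1); exact: sqr_ge0.
have h4 : k * c0 <= k * J * expR 1 by rewrite -mulrA ler_pM2l.
apply: (le_trans h4).
have h5 : k * J <= 3 * (g ^+ 2 * expR 2) by apply: (le_trans G3); rewrite ler_wpM2l.
have := ler_wpM2r (ltW e1) h5; rewrite e12.
have : 0 <= g ^+ 2 * expR 2 * expR 1 by apply: mulr_ge0; [apply: mulr_ge0; [exact: sqr_ge0|exact: ltW]|exact: ltW].
lra.
Qed.

(** Let $M$ be the maximum of $|Y|$ on $[a,b]$. By Rolle $Y'$ vanishes somewhere in between, so
    $|Y'|\le\lambda M(b-a)$ from $|Y''|\le\lambda M$, and $M\le\lambda M(b-a)^2$ because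
    $Y(a)=0$. *)
Lemma hermite_root_spacing n (a b : R) : a < b ->
  (H n.+1).[a] = 0 -> (H n.+1).[b] = 0 -> 1 <= (2 * n.+1 + 1)%:R * (b - a) ^+ 2.
Proof.
move=> ab Ha Hb; set lam : R := _%:R.
have Ya : Y n.+1 a = 0 by rewrite /gp Ha mulr0.
have Yb : Y n.+1 b = 0 by rewrite /gp Hb mulr0.
have dY := der_gp (H n.+1); have dY1 := der2_gp_hermite n.+1.
have rb x : (H n.+1).[x] = 0 -> x ^+ 2 <= lam.
  move=> /hermite_root_bound[/ltW xx|->]; last by rewrite expr0n.
  by apply: (le_trans xx); rewrite ler_nat addn1; apply: leqW; rewrite leq_pmul2l// leqnSn.
have xl x : a <= x <= b -> `|lam - x ^+ 2| <= lam.
  move=> /andP[ax xb]; have := rb a Ha; have := rb b Hb => h1 h2.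
  have : x ^+ 2 <= lam.
    have [x0|x0] := leP 0 x.
      by apply: le_trans h1; rewrite lerXn2r ?nnegrE// (le_trans x0).
    apply: le_trans h2; rewrite -sqrrN -[leRHS]sqrrN lerXn2r ?nnegrE; lra.
  by move=> h3; rewrite ler_norml; have := sqr_ge0 x => ?; apply/andP; split; lra.
have [c cab cmax] : exists2 c, a <= c <= b & forall x, a <= x <= b -> `|Y n.+1 x| <= `|Y n.+1 c|.
  have [|c] := @EVT_max R (fun x => `|Y n.+1 x|) a b (ltW ab).
    apply: continuous_subspaceT => x; apply: continuous_comp; last exact: norm_continuous.
    exact: der_cont (dY x).
  by rewrite in_itv/= => ? h; exists c => // x xx; apply: h; rewrite in_itv.
have M0 : 0 < `|Y n.+1 c|.
  have [x xab px] := poly_nonroot_itv ab (hermite_neq0 R n.+1).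
  by apply: lt_le_trans (cmax x xab); rewrite normr_gt0 mulf_neq0// gt_eqF// expR_gt0.
have [d dab] := MVT_closed (ltW ab) (fun x _ => dY x).
rewrite Ya Yb subrr => /esym/eqP; rewrite mulf_eq0 subr_eq0 (gt_eqF ab) orbF => /eqP Yd.
have bd x : a <= x <= b -> `|Y1 n.+1 x| <= lam * `|Y n.+1 c| * (b - a).
  move=> xab.
  have K u v : u <= v -> a <= u -> v <= b -> `|Y1 n.+1 v - Y1 n.+1 u| <= lam * `|Y n.+1 c| * (b - a).
    move=> uv au vb; have [w /andP[uw wv] ->] := MVT_closed uv (fun x _ => dY1 x).
    have wab : a <= w <= b by rewrite (le_trans au) ?(le_trans wv).
    rewrite normrM [X in X * _ <= _]normrM normrN; apply: ler_pM; rewrite ?mulr_ge0//.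
      by apply: ler_pM => //; [exact: xl|exact: cmax].
    by rewrite ger0_norm ?subr_ge0//; lra.
  have /andP[ad db] := dab; have /andP[ax xb] := xab.
  have [xd|dx] := leP x d.
    by have := K x d xd ax db; rewrite Yd sub0r normrN.
  by have := K d x (ltW dx) ad xb; rewrite Yd subr0.
have /andP[ac cb] := cab.
have [w /andP[aw wc] E] := MVT_closed ac (fun x _ => dY x).
have : `|Y n.+1 c| <= lam * `|Y n.+1 c| * (b - a) * (b - a).
  rewrite -[X in `|X| <= _]subr0 -Ya E normrM; apply: ler_pM => //.
    by apply: bd; rewrite aw (le_trans wc).
  by rewrite ger0_norm ?subr_ge0//; lra.
rewrite (_ : lam * _ * _ * _ = `|Y n.+1 c| * (lam * (b - a) ^+ 2)); last by ring.
by rewrite ler_pMr.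
Qed.

End hermite_weights.

(** * Stability of Hermite interpolation *)

Section quadrature.
Variable R : realType.
Local Notation H := (@hermite R).
Variables (N : nat) (s : seq R).
Hypotheses (us : uniq s) (ss : size s = N.+1) (rs : all (root (H N.+1)) s).
Implicit Types (a b : R) (g : {poly R}).

(** The Lagrange polynomial of the node [a] up to normalisation: its value at [a] is
    $H_{N+1}'(a)$. *)
Definition hermite_quot a := H N.+1 %/ ('X - a%:P).
Local Notation L := hermite_quot.

Lemma hermite_node a : a \in s -> (H N.+1).[a] = 0.
Proof. by move=> /(allP rs)/rootP. Qed.

Lemma hermite_quotE a : a \in s -> H N.+1 = L a * ('X - a%:P).
Proof. by move=> /(allP rs) ra; rewrite divpK// dvdp_XsubCl. Qed.

Lemma size_hermite_quot a : a \in s -> size (L a) = N.+1.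
Proof.
by move=> sa; rewrite /L size_divp ?polyXsubC_eq0// size_hermite size_XsubC subn1.
Qed.

Lemma hermite_quot_node a : a \in s -> (L a).[a] = (H N.+1)^`().[a].
Proof.
move=> sa; rewrite (hermite_quotE sa) derivM derivXsubC hornerD !hornerM.
by rewrite hornerXsubC hornerC subrr mulr0 add0r mulr1.
Qed.

Lemma hermite_quot_node_neq a b : a \in s -> b \in s -> b != a -> (L a).[b] = 0.
Proof.
move=> sa sb ba; have := hermite_node sb.
rewrite (hermite_quotE sa) hornerM hornerXsubC => /eqP.
by rewrite mulf_eq0 subr_eq0 (negbTE ba) orbF => /eqP.
Qed.

Lemma lagrange_hermite g : (size g <= N.+1)%N ->
  g = \sum_(a <- s) (g.[a] / (H N.+1)^`().[a]) *: L a.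
Proof.
move=> sg; apply/eqP; rewrite -subr_eq0; set d := _ - _; apply/negP => /negP d0.
have sd : (size d <= N.+1)%N.
  rewrite /d (leq_trans (size_polyD _ _))// geq_max sg size_polyN.
  rewrite big_seq; elim/big_ind: _ => /= [|p q hp hq|a sa]; first by rewrite size_poly0.
    by rewrite (leq_trans (size_polyD _ _))// geq_max hp.
  by rewrite (leq_trans (size_scale_leq _ _))// size_hermite_quot.
have := max_poly_roots d0 _ us; rewrite ss ltnNge sd => K.
suff : false by []; apply: K.
apply/allP => b sb; rewrite /root /d hornerD hornerN horner_sum (bigD1_seq b)//=.
rewrite hornerZ hermite_quot_node// mulfVK ?hermite_simple_root ?hermite_node//.
rewrite big1_seq ?addr0 ?subrr//= => a /andP[ab sa].
by rewrite hornerZ hermite_quot_node_neq ?mulr0// eq_sym.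
Qed.

(** The product of the two quotients is $H_{N+1}$ times a polynomial of smaller degree. *)
Lemma gint_quot_orth a b : a \in s -> b \in s -> b != a -> gint (L a * L b) = 0.
Proof.
move=> sa sb ba; have : root (L b) a.
  by apply/rootP; rewrite hermite_quot_node_neq// eq_sym.
move=> /factor_theorem[q Lq]; rewrite Lq.
have -> : L a * (q * ('X - a%:P)) = H N.+1 * q by rewrite (hermite_quotE sa); ring.
apply: gint_hermite_orth; have [->|q0] := eqVneq q 0; first by rewrite size_poly0.
have := size_hermite_quot sb; rewrite Lq size_Mmonic ?monicXsubC// size_XsubC addn2 /=.
by move=> [->].
Qed.

(** Pair the quotient with $H_N$ in two ways. Comparison of leading coefficients gives $2\|H_N\|^2$.
    The Lagrange expansion of $H_N$ has all its coefficients equal to $1/(2(N+1))$, as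
    $H_{N+1}'=2(N+1)H_N$, and only the term of the node [a] survives. *)
Lemma gint_quot_sqr a : a \in s -> gint (L a * L a) = 2 * hsq R N.+1.
Proof.
move=> sa.
have H1 : gint (L a * H N) = 2 * hsq R N.
  have -> : L a * H N = H N * (L a - 2 *: H N) + 2 *: (H N * H N).
    by rewrite mulrBr -scalerAr; ring.
  rewrite gintD gintZ gint_hermite_sqr gint_hermite_orth ?add0r//.
  apply/leq_sizeP => j; rewrite leq_eqVlt => /predU1P[<-|Nj].
    rewrite coefB coefZ.
    have -> : (H N)`_N = 2 ^+ N by rewrite -lead_coef_hermite lead_coefE size_hermite.
    have -> : (L a)`_N = lead_coef (L a) by rewrite lead_coefE size_hermite_quot.
    have := lead_coef_hermite R N.+1; rewrite (hermite_quotE sa) lead_coef_Mmonic ?monicXsubC//.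
    by move=> ->; rewrite exprS subrr.
  by rewrite coefB coefZ !nth_default ?size_hermite ?size_hermite_quot// mulr0 subrr.
have E : H N = \sum_(b <- s) (2 * N.+1)%:R^-1 *: L b.
  rewrite {1}(lagrange_hermite (g := H N)) ?size_hermite//.
  rewrite big_seq [RHS]big_seq; apply: eq_bigr => b sb; congr (_ *: _).
  rewrite deriv_hermite hornerM horner_nat invfM mulrC mulfVK//.
  by apply/eqP => /(hermite_no_common_root (hermite_node sb)).
have := H1; rewrite E big_distrr/= gint_sum (bigD1_seq a)//=.
rewrite -scalerAr gintZ big1_seq ?addr0 => [|b /andP[ba sb]]; last first.
  by rewrite -scalerAr gintZ gint_quot_orth// mulr0.
move=> K; rewrite hsqS mulrCA -K mulrA divff ?mul1r// pnatr_eq0.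
Qed.

Lemma gauss_hermite_quadrature g : (size g <= N.+1)%N ->
  gint (g * g) = 2 * hsq R N.+1 * \sum_(a <- s) (g.[a] / (H N.+1)^`().[a]) ^+ 2.
Proof.
move=> sg; rewrite {1}(lagrange_hermite sg) big_distrl/= gint_sum big_distrr/=.
rewrite big_seq [RHS]big_seq; apply: eq_bigr => a sa.
rewrite -scalerAl gintZ {2}(lagrange_hermite sg) big_distrr/= gint_sum.
rewrite (bigD1_seq a)//= -scalerAr gintZ gint_quot_sqr// big1_seq ?addr0.
  by ring.
by move=> b /andP[ba sb]; rewrite -scalerAr gintZ gint_quot_orth// mulr0.
Qed.

(** In terms of the samples of $e^{-x^2/2}g$ the weights are
    $2\|H_{N+1}\|^2/(e^{-a^2/2}H_{N+1}'(a))^2$, and [gp_deriv_root_ge] bounds them by a multiple of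
    $1/k$. *)
Lemma gint_sqr_le_nodes g (k : R) : (1 <= N)%N -> 0 < k -> k ^+ 6 = N%:R ->
  (size g <= N.+1)%N ->
  k * gint (g * g) <= 18 * expR 3 * Num.sqrt pi * \sum_(a <- s) gp g a ^+ 2.
Proof.
move=> N1 k0 k6 sg; rewrite gauss_hermite_quadrature// mulrA !big_distrr/=.
rewrite big_seq [leRHS]big_seq; apply: ler_sum => a sa.
have := gp_deriv_root_ge N1 k0 k6 (hermite_node sa).
have h0 := hermite_simple_root (hermite_node sa).
rewrite /gp /hsq; set h := (H N.+1)^`().[a] in h0 *; set c := 2 ^+ _ * _%:R.
set e := expR (_ / 2); move=> K.
have e0 : 0 < e by exact: expR_gt0.
have h2 : 0 < h ^+ 2 by rewrite exprn_even_gt0.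
have sp0 : 0 < Num.sqrt (pi : R) by rewrite sqrtr_gt0 pi_gt0.
have K2 : k * c / h ^+ 2 <= 9 * expR 3 * e ^+ 2.
  by rewrite ler_pdivrMr//; apply: (le_trans K); rewrite exprMn mulrA.
have := ler_wpM2l (_ : 0 <= 2 * Num.sqrt pi * g.[a] ^+ 2) K2.
move=> /(_ ltac:(by apply: mulr_ge0; [apply: mulr_ge0 => //; exact: ltW|exact: sqr_ge0])).
by congr (_ <= _); rewrite ?exprMn ?exprVn; field.
Qed.

End quadrature.

(** * Samples of functions of $H^1$ *)

Section sampling.
Variable R : realType.
Local Notation mu := (@lebesgue_measure R).
Implicit Types (a b d x : R) (w v : R -> R) (s : seq R).

Lemma rint_indic_itvco a b : a <= b ->
  rint setT (\1_(`[a, b[%classic) : R -> R) = b - a.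
Proof.
move=> ab; rewrite /rint integral_indic//= setIT.
have := lebesgue_measure_itv `[a, b[; rewrite /= lte_fin => ->.
by move: ab; rewrite le_eqVlt => /predU1P[->|ab]; rewrite ?ltxx ?subrr// ab.
Qed.

Lemma sum_indic_le1 s d x : uniq s ->
  (forall a b, a \in s -> b \in s -> a < b -> d <= b - a) ->
  \sum_(a <- s) (\1_(`[a, a + d[%classic) x : R) <= 1.
Proof.
move=> us sp; have [[c cs xc]|nx] := pselect (exists2 c, c \in s & `[c, c + d[%classic x).
  rewrite (bigD1_seq c)//= big1_seq ?addr0 => [|a /andP[ac sa]].
    by have /andP[] := indic01 `[c, c + d[%classic x.
  rewrite indicTE asboolF// => /= xa; move: xc xa; rewrite /= !in_itv/=.
  move=> /andP[h1 h2] /andP[h3 h4]; move: ac; rewrite neq_lt => /orP[/sp|/sp].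
    by move=> /(_ sa cs); lra.
  by move=> /(_ cs sa); lra.
rewrite big1_seq// => a /= sa; rewrite indicTE asboolF// => xa.
by apply: nx; exists a.
Qed.

Lemma rint_sqr_le (A : set R) w : measurable A -> L2 w -> L2 (\1_A : R -> R) ->
  (rint A w) ^+ 2 <= rint setT (\1_A : R -> R) * rint setT (fun x => w x ^+ 2 * \1_A x).
Proof.
move=> mA Lw L1.
have sq x : (\1_A x : R) * \1_A x = \1_A x.
  by rewrite indicTE; case: ifP; rewrite ?mulr1 ?mulr0.
have := ip_CS_sqr (L2_indic mA Lw) L1.
rewrite (_ : L2inner _ _ = rint A w); last first.
  by rewrite rint_indic; apply: eq_rint => x _; rewrite -mulrA sq.
move=> /le_trans; apply; rewrite mulrC; apply: ler_eqW.
congr (_ * _); apply: eq_rint => x _; rewrite ?sq//.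
by rewrite mulrACA sq expr2.
Qed.

Lemma L2_indic_itv (i : interval R) (a b : R) : [set` i] `<=` `[a, b]%classic ->
  L2 (\1_[set` i] : R -> R).
Proof.
move=> iab; have mi : measurable [set` i] by exact: measurable_itv.
apply: L2P; first exact: measurable_indic.
apply: (Lint_bound _ (integrable_indic_itv a b true false)).
  by apply: measurable_funX; exact: measurable_indic.
move=> x; rewrite !indicTE; case: asboolP => [/iab|_].
  by move=> xi; rewrite asboolT// expr1n normr1.
by rewrite expr0n normr0; case: ifP.
Qed.

(** For $x\in[a,a+d)$ use $w(a)^2\le2w(x)^2+2(w(x)-w(a))^2$, the last square being at most
    $d\int|w'|^2$ over that interval by Cauchy-Schwarz. Averaging in $x$ gives the bound at one
    node; the half-open intervals are disjoint, so the bounds add up. *)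
Lemma H1_sample_bound w w' s d : H1 w w' -> uniq s -> 0 < d ->
  (forall a b, a \in s -> b \in s -> a < b -> d <= b - a) ->
  \sum_(a <- s) w a ^+ 2 <= 2 / d * L2norm w ^+ 2 + 2 * d * L2norm w' ^+ 2.
Proof.
move=> [Lw [Lw' dw]] us d0 sp.
pose I a := `[a, a + d[%classic : set R.
have mI a : measurable (I a) by exact: measurable_itv.
have LI a : L2 (\1_(I a) : R -> R).
  apply: (@L2_indic_itv _ a (a + d)) => x /=; rewrite !in_itv/=.
  by move=> /andP[-> /ltW ->].
have iI v a : L2 v -> Lint (fun x => v x ^+ 2 * \1_(I a) x).
  by move=> Lv; apply: Lint_indic => //; exact: L2_Lint.
pose W' a := rint setT (fun x => w' x ^+ 2 * \1_(I a) x).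
pose W a := rint setT (fun x => w x ^+ 2 * \1_(I a) x).
have pt a x : I a x -> w a ^+ 2 <= 2 * w x ^+ 2 + 2 * d * W' a.
  rewrite /I/= in_itv/= => /andP[ax xd].
  have := dw _ _ ax => E.
  have mA : measurable (`[a, x]%classic : set R) by exact: measurable_itv.
  have L1 : L2 (\1_(`[a, x]%classic) : R -> R) by exact: (@L2_indic_itv _ a x).
  have := rint_sqr_le mA Lw' L1; rewrite -E rint_indic_itv// => K.
  have W'0 : 0 <= W' a by apply: rint_ge0 => y _; rewrite mulr_ge0 ?sqr_ge0//; have /andP[] := indic01 (I a) y.
  have : rint setT (fun y => w' y ^+ 2 * \1_(`[a, x]%classic) y) <= W' a.
    apply: rint_le; [by apply: Lint_indic => //; exact: L2_Lint|exact: iI|].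
    move=> y; rewrite ler_wpM2l ?sqr_ge0// !indicTE.
    case: asboolP; last by case: ifP.
    by rewrite /= in_itv/= => /andP[ay yx]; rewrite asboolT//= /I/= in_itv/= ay; lra.
  move=> K2; have K3 : (w x - w a) ^+ 2 <= d * W' a.
    apply: (le_trans K); apply: ler_pM => //; rewrite ?subr_ge0//; last lra.
    by apply: rint_ge0 => y _; rewrite mulr_ge0 ?sqr_ge0//; have /andP[] := indic01 `[a, x]%classic y.
  have := sqr_ge0 (w a - 2 * w x); nra.
have avg a : d * w a ^+ 2 <= 2 * W a + 2 * d ^+ 2 * W' a.
  have iI1 : Lint (\1_(I a) : R -> R) by exact: integrable_indic_itv.
  have e1 : d * w a ^+ 2 = rint setT (fun x => w a ^+ 2 * \1_(I a) x).
    by rewrite rintZ// rint_indic_itvco; [ring|lra].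
  have e2 : 2 * W a + 2 * d ^+ 2 * W' a =
     rint setT (fun x => 2 * (w x ^+ 2 * \1_(I a) x) + 2 * d * W' a * \1_(I a) x).
    rewrite rintD; [|exact/LintZ/iI|exact: LintZ].
    rewrite !rintZ//; last exact: iI.
    by rewrite rint_indic_itvco; [rewrite /W; ring|lra].
  rewrite e1 e2; apply: rint_le.
  - exact: LintZ.
  - by apply: LintD; [exact/LintZ/iI|exact: LintZ].
  - move=> x; rewrite indicTE; case: asboolP => [xI|_]; last by rewrite !mulr0 addr0.
    by rewrite !mulr1; exact: pt.
have sumW v : L2 v -> \sum_(a <- s) rint setT (fun x => v x ^+ 2 * \1_(I a) x) <= L2norm v ^+ 2.
  move=> Lv; rewrite -rint_sum; last by move=> a; exact: iI.
  rewrite sqr_L2norm /L2inner.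
  apply: rint_le; [by apply: Lint_sum => a; exact: iI|exact: L2M_Lint|].
  move=> x; rewrite -big_distrr/= -expr2 ler_piMr ?sqr_ge0//.
  exact: sum_indic_le1.
rewrite -(ler_pM2l d0).
have -> : d * (2 / d * L2norm w ^+ 2 + 2 * d * L2norm w' ^+ 2)
  = 2 * L2norm w ^+ 2 + 2 * d ^+ 2 * L2norm w' ^+ 2 by field; rewrite gt_eqF.
rewrite big_distrr/=.
apply: (le_trans (ler_sum _ (fun a _ => avg a))).
rewrite big_split/= -!big_distrr/=.
apply: lerD.
  by rewrite ler_pM2l//; exact: sumW.
by rewrite ler_pM2l ?mulr_gt0 ?exprn_gt0//; exact: sumW.
Qed.

End sampling.

(** * The approximation space at scale $\beta$ *)

Section hatP_basics.
Variable R : realType.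
Local Notation H := (@hermite R).
Implicit Types (b x : R) (p q : {poly R}).

Lemma hatP_gp b p x : 0 < b -> hatP b p x = gp (p \Po (b^-1 *: 'X)) (b * x).
Proof.
move=> b0; rewrite /hatP /gp horner_comp hornerZ hornerX exprMn.
by rewrite mulKf// gt_eqF.
Qed.

Lemma size_comp_scale b p : b != 0 -> size (p \Po (b *: 'X)) = size p.
Proof. by move=> b0; rewrite size_comp_poly2// size_scale// size_polyX. Qed.

Lemma rint_gauss_scale b p : 0 < b ->
  rint setT (fun x => expR (- (b ^+ 2 * x ^+ 2)) * p.[b * x]) = b^-1 * gint p.
Proof.
move=> b0; rewrite /gint (@rint_affine _ (fun x => expR (- x ^+ 2) * p.[x]) b 0)//.
- rewrite mulKf ?gt_eqF//; apply: eq_rint => x _.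
  by rewrite addr0 exprMn.
- exact: cont_gauss_poly.
- exact: Lint_gauss_poly.
Qed.

Lemma hatP_ip b p q : 0 < b -> L2inner (hatP b p) (hatP b q) =
   b^-1 * gint ((p \Po (b^-1 *: 'X)) * (q \Po (b^-1 *: 'X))).
Proof.
move=> b0; rewrite -rint_gauss_scale//; apply: eq_rint => x _.
rewrite !hatP_gp// /gp hornerM exprMn mulrACA -expRD; congr (expR _ * _).
by field.
Qed.

Lemma gdom_hatP b p : 0 < b -> gdom (hatP b p).
Proof.
move=> b0; have := gdom_horner p (@gdom_gauss R (b ^+ 2 / 2) 0 0 _).
have b2 : 0 < b ^+ 2 / 2 by rewrite divr_gt0// exprn_gt0.
move=> /(_ b2); congr gdom; apply/funext => x; rewrite /hatP; congr (expR _ * _).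
by field.
Qed.

Lemma der_hatP b p x : is_derive x 1 (hatP b p) (hatP b (p^`() - b ^+ 2 *: 'X * p) x).
Proof.
rewrite /hatP; der_solve ltac:(rewrite !(hornerM, hornerZ, hornerX, hornerN, hornerD); by field).
Qed.

Lemma cont_hatP b p : continuous (hatP b p).
Proof. exact: (der_cont_all (der_hatP b p)). Qed.

Lemma meas_hatP b p : measurable_fun setT (hatP b p).
Proof. by apply: cont_meas; exact: cont_hatP. Qed.

Lemma L2_hatP b p : 0 < b -> L2 (hatP b p).
Proof. by move=> b0; exact: gdom_L2 (meas_hatP b p) (gdom_hatP p b0). Qed.

Lemma Lint_hatP b p : 0 < b -> Lint (hatP b p).
Proof. by move=> b0; exact: gdom_Lint (meas_hatP b p) (gdom_hatP p b0). Qed.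

Lemma derive1_hatP b p : derive1 (hatP b p) = hatP b (p^`() - b ^+ 2 *: 'X * p).
Proof.
by apply/funext => x; rewrite derive1E; have := der_hatP b p x => ?; exact: derive_val.
Qed.

Lemma H1_hatP b p : 0 < b -> H1 (hatP b p) (hatP b (p^`() - b ^+ 2 *: 'X * p)).
Proof.
move=> b0; split; first exact: L2_hatP.
split; first exact: L2_hatP.
by move=> x y xy; rewrite (rint_deriv_itv xy (der_hatP b p))//; exact: cont_hatP.
Qed.

Lemma L2_Lint_itv (w : R -> R) (a c : R) : L2 w -> Lint (fun x => w x * \1_(`[a, c]%classic) x).
Proof.
by move=> Lw; apply: L2M_Lint => //; exact: (@L2_indic_itv _ _ a c).
Qed.

Lemma H1B (w w' v v' : R -> R) : H1 w w' -> H1 v v' ->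
  H1 (fun x => w x - v x) (fun x => w' x - v' x).
Proof.
move=> [Lw [Lw' dw]] [Lv [Lv' dv]]; split; first exact: L2B.
split; first exact: L2B.
move=> a c ac; have := dw a c ac; have := dv a c ac; rewrite !(rint_indic _ `[a, c]%classic) => E1 E2.
transitivity (rint setT (fun x => w' x * \1_(`[a, c]%classic) x - v' x * \1_(`[a, c]%classic) x)).
  by rewrite rintB; [rewrite -E1 -E2; ring|exact: L2_Lint_itv..].
by apply: eq_rint => x _; rewrite mulrBl.
Qed.

End hatP_basics.

Section interpolation.
Variable R : realType.
Local Notation H := (@hermite R).
Implicit Types (b k x : R) (p q : {poly R}).

Lemma hermite_fun_eq0 n x : (H n).[x] = 0 -> hermite_fun n x = 0.
Proof. by move=> h; rewrite /hermite_fun h mulr0. Qed.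

(** [If] minus the element of [p] interpolates [f] minus that element, so quadrature reduces its
    norm to samples of the difference at nodes with spacing at least $d=1/(b\sqrt{2N+3})$. As $1/d$
    is of order $bk^3$, division of $\frac1dA+dB$ by $bk$ leaves $k^2A+b^{-2}k^{-4}B$. The square
    roots of these factors are the $N^{1/6}$ and $\beta^{-1}N^{-1/3}$ of the theorem. *)
Lemma hermite_interp_stable (N : nat) b k (f If g' : R -> R) p :
  (1 <= N)%N -> 0 < b -> 0 < k -> k ^+ 6 = N%:R ->
  is_hermite_interp N b f If -> (size p <= N.+1)%N ->
  H1 (fun x => f x - hatP b p x) g' ->
  L2norm (fun x => If x - hatP b p x) ^+ 2 <=
  200 * expR 3 * Num.sqrt pi *
   (k ^+ 2 * L2norm (fun x => f x - hatP b p x) ^+ 2 + b ^- 2 * k ^- 4 * L2norm g' ^+ 2).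
Proof.
move=> N1 b0 k0 k6 [[chi schi ->] nodes] sp Hg.
have bn0 : b != 0 by rewrite gt_eqF.
have [s [us ss rs]] := hermite_roots R N.+1.
pose q := (chi - p) \Po (b^-1 *: 'X).
have sq : (size q <= N.+1)%N.
  rewrite size_comp_scale ?invr_eq0// (leq_trans (size_polyD _ _))// geq_max schi.
  by rewrite size_polyN.
have hB x : hatP b chi x - hatP b p x = hatP b (chi - p) x.
  by rewrite /hatP hornerD hornerN; ring.
rewrite (eq_L2norm hB) sqr_L2norm hatP_ip// -/q.
have K1 := gint_sqr_le_nodes us ss rs N1 k0 k6 sq.
pose t := [seq a / b | a <- s].
have ut : uniq t by rewrite map_inj_uniq// => x y /(mulIf _); apply; rewrite invr_eq0.
pose lam : R := (2 * N.+1 + 1)%:R.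
have lam0 : 0 < lam by rewrite ltr0n addn1.
pose sl := Num.sqrt lam.
have sl0 : 0 < sl by rewrite sqrtr_gt0.
have sl2 : sl ^+ 2 = lam by rewrite sqr_sqrtr// ltW.
pose d := (b * sl)^-1.
have d0 : 0 < d by rewrite invr_gt0 mulr_gt0.
have spt x y : x \in t -> y \in t -> x < y -> d <= y - x.
  move=> /mapP[x' xs ->] /mapP[y' ys ->]; rewrite ltr_pM2r ?invr_gt0// => xy.
  have := hermite_root_spacing xy (hermite_node rs xs) (hermite_node rs ys).
  rewrite -/lam -sl2 -exprMn => h.
  have {}h : 1 <= sl * (y' - x').
    apply: ler_sqr_pos; last by rewrite expr1n.
    by apply: mulr_ge0; [exact: ltW|rewrite subr_ge0; exact: ltW].
  rewrite -mulrBl /d invfM mulrC ler_pM2r ?invr_gt0// -[leLHS]mul1r.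
  by rewrite ler_pdivrMr// mulrC.
have K2 := H1_sample_bound Hg ut d0 spt.
have E : \sum_(a <- s) gp q a ^+ 2 = \sum_(x <- t) (f x - hatP b p x) ^+ 2.
  rewrite big_map big_seq [RHS]big_seq; apply: eq_bigr => a sa.
  have := nodes a (hermite_fun_eq0 (hermite_node rs sa)) => <-.
  by rewrite hB hatP_gp// mulrCA divff// mulr1.
rewrite E in K1.
set A := L2norm _ ^+ 2 in K2 *; set B := L2norm g' ^+ 2 in K2 *.
have A0 : 0 <= A by exact: sqr_ge0.
have B0 : 0 <= B by exact: sqr_ge0.
pose c : R := expR 3 * Num.sqrt pi.
have c0 : 0 < c by rewrite mulr_gt0 ?expR_gt0// sqrtr_gt0 pi_gt0.
have N1r : (1 : R) <= N%:R by rewrite ler1n.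
have lamE : lam = 2 * N%:R + 3 by rewrite /lam natrD natrM -(natr1 N); ring.
have k3 : 0 < k ^+ 3 by rewrite exprn_gt0.
have slu : sl <= 3 * k ^+ 3.
  apply: ler_sqr_pos; first by rewrite mulr_ge0// ltW.
  by rewrite exprMn -exprM k6 sl2 lamE; lra.
have sll : k ^+ 3 <= sl.
  apply: ler_sqr_pos; first exact: ltW.
  by rewrite -exprM k6 sl2 lamE; lra.
rewrite -(ler_pM2l k0) -(ler_pM2l b0).
have -> : b * (k * (b^-1 * gint (q * q))) = k * gint (q * q) by field.
apply: (le_trans K1).
apply: (@le_trans _ _ (18 * c * (2 / d * A + 2 * d * B))).
  rewrite (_ : 18 * expR 3 * Num.sqrt pi = 18 * c); last by rewrite /c mulrA.
  by apply: ler_wpM2l => //; rewrite mulr_ge0// ltW.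
have h1 : 2 / d * A <= 6 * (b * k ^+ 3 * A).
  rewrite /d invrK; have := ler_wpM2r A0 (ler_wpM2l (ltW b0) slu); lra.
have h2 : 2 * d * B <= 2 * (B / (b * k ^+ 3)).
  rewrite /d; have : (b * sl)^-1 <= (b * k ^+ 3)^-1.
    by rewrite lef_pV2 ?posrE ?mulr_gt0// ler_pM2l.
  by move=> /(ler_wpM2r B0); rewrite mulrC; lra.
have -> : b * (k * (200 * expR 3 * Num.sqrt pi * (k ^+ 2 * A + b ^- 2 * k ^- 4 * B)))
  = 200 * c * (b * k ^+ 3 * A + B / (b * k ^+ 3)).
  by rewrite /c; field; rewrite bn0 gt_eqF.
have bk0 : 0 < b * k ^+ 3 by rewrite mulr_gt0.
have h3 : 0 <= b * k ^+ 3 * A by rewrite mulr_ge0// ltW.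
have h4 : 0 <= B / (b * k ^+ 3) by rewrite divr_ge0// ltW.
apply: (@le_trans _ _ (18 * c * (6 * (b * k ^+ 3 * A) + 2 * (B / (b * k ^+ 3))))).
  by rewrite ler_wpM2l ?lerD// mulr_ge0// ltW.
have h5 := mulr_ge0 (ltW c0) h3; have h6 := mulr_ge0 (ltW c0) h4; lra.
Qed.

End interpolation.

(** * Gaussian windows in frequency *)

Section joint_measurability.
Variable R : realType.
Local Notation mu := (@lebesgue_measure R).
Implicit Types (f g : R -> R) (F G : R -> R -> R).

Definition meas2 F := measurable_fun setT (fun p : R * R => F p.1 p.2).

Lemma meas2_fst f : measurable_fun setT f -> meas2 (fun x _ => f x).
Proof. by move=> mf; apply: (measurableT_comp mf); exact: measurable_fst. Qed.

Lemma meas2_snd f : measurable_fun setT f -> meas2 (fun _ y => f y).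
Proof. by move=> mf; apply: (measurableT_comp mf); exact: measurable_snd. Qed.

Lemma meas2M F G : meas2 F -> meas2 G -> meas2 (fun x y => F x y * G x y).
Proof. by move=> mF mG; exact: measurable_funM. Qed.

Lemma meas2D F G : meas2 F -> meas2 G -> meas2 (fun x y => F x y + G x y).
Proof. by move=> mF mG; exact: measurable_funD. Qed.

Lemma meas2B F G : meas2 F -> meas2 G -> meas2 (fun x y => F x y - G x y).
Proof. by move=> mF mG; exact: measurable_funB. Qed.

Lemma meas2_comp f F : continuous f -> meas2 F -> meas2 (fun x y => f (F x y)).
Proof. by move=> cf mF; apply: (measurableT_comp (cont_meas cf)); exact: mF. Qed.

Lemma meas2_swap F : meas2 F -> meas2 (fun x y => F y x).
Proof.
move=> mF; apply: (@measurableT_comp _ _ _ _ _ _ (fun p : R * R => F p.1 p.2) _ (fun p => (p.2, p.1))) => //.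
by apply: measurable_fun_pair; [exact: measurable_snd|exact: measurable_fst].
Qed.

Lemma meas2_section F x : meas2 F -> measurable_fun setT (F x).
Proof.
move=> mF; apply: (@measurableT_comp _ _ _ _ _ _ (fun p : R * R => F p.1 p.2) _ (fun y => (x, y))) => //.
exact: measurable_fun_pair.
Qed.

Lemma meas2_id_fst : meas2 (fun x _ => x). Proof. exact: measurable_fst. Qed.
Lemma meas2_id_snd : meas2 (fun _ y => y). Proof. exact: measurable_snd. Qed.

Lemma fubini_rint F f g : meas2 F -> Lint f -> Lint g ->
  (forall x y, `|F x y| <= f x * g y) ->
  [/\ rint setT (fun x => rint setT (F x)) = rint setT (fun y => rint setT (F^~ y)),
      Lint (fun x => rint setT (F x)) & forall x, Lint (F x)].
Proof.
move=> mF If Ig HF.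
have IFx x : Lint (F x).
  apply: (Lint_bound _ (LintZ (f x) Ig)) => //; exact: meas2_section.
have IFy y : Lint (F^~ y).
  apply: (Lint_bound _ (LintZ (g y) If)) => [|x]; last by rewrite mulrC.
  exact: (@meas2_section (fun x y => F y x)) (meas2_swap mF).
pose h (p : R * R) := (F p.1 p.2)%:E.
have mh : measurable_fun setT h by apply: measurableT_comp; [|exact: mF].
have ih : (mu \x mu)%E.-integrable setT h.
  apply/integrable12ltyP => //.
  apply: (@le_lt_trans _ _ (\int[mu]_x (f x * rint setT g)%:E)%E); last first.
    have /integrableP[_] := LintZ (rint setT g) If.
    apply: le_lt_trans; apply: le_trans (le_abse_integral _ _ _) => //.
      rewrite (_ : (fun x => (f x * rint setT g)%:E) = (EFin \o (fun x => rint setT g * f x))).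
        exact: lee_abs.
      by apply/funext => x; rewrite /= mulrC.
    by apply: measurableT_comp => //; exact: Lint_meas (LintZ (rint setT g) If).
  apply: ge0_le_integral => //.
  - by move=> x _; apply: integral_ge0.
  - have mah : measurable_fun setT (fun p : R * R => `|h p|%E) by exact: measurableT_comp.
    exact: (@measurable_fun_fubini_tonelli_F _ _ _ _ _ mu _ mah (fun p => abse_ge0 _)).
  - apply: measurableT_comp => //; apply: measurable_funM => //; exact: Lint_meas.
  - move=> x _; rewrite /h/= (rint_EFin (Lint_abs (IFx x))) lee_fin.
    rewrite -rintZ//; apply: rint_le; [exact: Lint_abs|exact: LintZ|by []].
have E := Fubini ih.
have e1 : (fun x => (\int[mu]_y h (x, y))%E) = (fun x => (rint setT (F x))%:E).
  by apply/funext => x; rewrite /h/= (rint_EFin (IFx x)).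
have e2 : (fun y => (\int[mu]_x h (x, y))%E) = (fun y => (rint setT (F^~ y))%:E).
  by apply/funext => y; rewrite /h/= (rint_EFin (IFy y)).
split; last exact: IFx.
  by rewrite e1 e2 in E; rewrite /rint E.
have := integrable_fubini_F ih; rewrite /fubini_F e1; exact.
Qed.

(** A Gaussian factor in [x] makes the integrand integrable on the plane, so that Fubini provides
    measurability; the factor is then divided out. *)
Lemma meas_rint F g : meas2 F -> Lint g -> (forall x y, `|F x y| <= g y) ->
  measurable_fun setT (fun x => rint setT (F x)).
Proof.
move=> mF Ig HF.
have IF x : Lint (F x) by apply: (Lint_bound _ Ig) => //; exact: meas2_section.
have mg : measurable_fun setT (fun x : R => expR (- x ^+ 2)).
  exact: (cont_meas (@continuous_gauss_fun R)).
have [||||_ H _] := @fubini_rint (fun x y => expR (- x ^+ 2) * F x y) (fun x => expR (- x ^+ 2)) g.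
- by apply: meas2M => //; exact: meas2_fst.
- exact: integrableT_gauss.
- exact: Ig.
- by move=> x y; rewrite normrM ger0_norm ?expR_ge0// ler_wpM2l ?expR_ge0.
have -> : (fun x => rint setT (F x)) =
    (fun x => expR (x ^+ 2) * rint setT (fun y => expR (- x ^+ 2) * F x y)).
  by apply/funext => x; rewrite rintZ// mulrA -expRD addrN expR0 mul1r.
apply: measurable_funM; last exact: Lint_meas H.
apply: cont_meas; apply: (@der_cont_all _ _ (fun k => expR (k ^+ 2) * (2 * k))) => x.
by der_solve ltac:(by ring).
Qed.

End joint_measurability.

(** * Cosine transform of the Gaussian *)

Section gaussian_fourier.
Variable R : realType.
Local Notation mu := (@lebesgue_measure R).
Implicit Types (x t c k phi : R).

(** The phase [phi] treats cosine and sine transforms at once. *)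
Let G t phi x := expR (- x ^+ 2) * cos (t * x + phi).

Let dG t phi x : is_derive x 1 (G t phi)
   (- 2 * (x * expR (- x ^+ 2)) * cos (t * x + phi) - t * expR (- x ^+ 2) * sin (t * x + phi)).
Proof. rewrite /G; der_solve ltac:(by ring). Qed.

Let gdG (F : R -> R) (f : R -> R) : gdom F -> (forall x, `|f x| <= 1) -> gdom (fun x => F x * f x).
Proof. exact: gdom_bounded. Qed.

Lemma abs_cos_le1 x : `|cos x| <= 1 :> R.
Proof. by rewrite ler_norml cos_geN1 cos_le1. Qed.

Lemma abs_sin_le1 x : `|sin x| <= 1 :> R.
Proof. by rewrite ler_norml sin_geN1 sin_le1. Qed.

Lemma Lint_gauss_cos t phi : Lint (G t phi).
Proof.
apply: gdom_Lint; first exact: cont_meas (der_cont_all (dG t phi)).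
by apply: gdG (gdom_expRN2 R) _ => x; exact: abs_cos_le1.
Qed.

Let S t phi x := expR (- x ^+ 2) * sin (t * x + phi).

Let dS t phi x : is_derive x 1 (S t phi)
   (- 2 * (x * expR (- x ^+ 2)) * sin (t * x + phi) + t * expR (- x ^+ 2) * cos (t * x + phi)).
Proof. rewrite /S; der_solve ltac:(by ring). Qed.

Let dXS t phi x : is_derive x 1 (fun x => x * expR (- x ^+ 2) * sin (t * x + phi))
   ((expR (- x ^+ 2) - 2 * x ^+ 2 * expR (- x ^+ 2)) * sin (t * x + phi)
   + t * (x * expR (- x ^+ 2)) * cos (t * x + phi)).
Proof. der_solve ltac:(by ring). Qed.

Let cXS t phi : continuous (fun x => x * expR (- x ^+ 2) * sin (t * x + phi)).
Proof. exact: der_cont_all (dXS t phi). Qed.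

Let IXS t phi : Lint (fun x => x * expR (- x ^+ 2) * sin (t * x + phi)).
Proof.
apply: gdom_Lint; first exact: cont_meas (@cXS t phi).
by apply: gdG (gdomX (gdom_expRN2 R)) _ => x; exact: abs_sin_le1.
Qed.

Let parts t phi : 2 * rint setT (fun x => x * expR (- x ^+ 2) * sin (t * x + phi))
  = t * rint setT (G t phi).
Proof.
pose f x := t * G t phi x - 2 * (x * expR (- x ^+ 2) * sin (t * x + phi)).
have dSf x : is_derive x 1 (S t phi) (f x).
  by apply: (der_eq (dS t phi x)); rewrite /f /G; ring.
have cf : continuous f.
  move=> x; apply: (cvgB (F := nbhs x)); apply: cvgMr.
    exact: (der_cont_all (dG t phi)).
  exact: cXS.
have gf : gdom f.
  have g0 := gdom_expRN2 R.
  have g1 := gdG (gdomZ t g0) (fun x => abs_cos_le1 (t * x + phi)).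
  have g2 := gdG (gdomZ (- 2) (gdomX g0)) (fun x => abs_sin_le1 (t * x + phi)).
  by have := gdomD g1 g2; congr gdom; apply/funext => x; rewrite /f /G; ring.
have gS : gdom (S t phi) by apply: gdG (gdom_expRN2 R) _ => x; exact: abs_sin_le1.
have := rint_deriv0_gdom dSf cf gf gS.
rewrite /f rintB; [|exact/LintZ/Lint_gauss_cos|exact: LintZ].
rewrite !rintZ//; last exact: Lint_gauss_cos.
by move=> /eqP; rewrite subr_eq0 => /eqP.
Qed.

(** As a function of the frequency $s$ the integral satisfies $F'=-\frac s2F$, by differentiation
    under the integral and the integration by parts [parts]; hence $F(s)e^{s^2/4}$ is constant. *)
Lemma gauss_cos_transform t phi :
  rint setT (G t phi) = Num.sqrt pi * expR (- (t ^+ 2 / 4)) * cos phi.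
Proof.
pose F s := rint setT (G s phi).
have dF (s : R) : is_derive s 1 F (- (s / 2) * F s).
  have Gd (r x : R) : is_derive r 1 (fun s => G s phi x) (- (x * expR (- x ^+ 2) * sin (r * x + phi))).
    by rewrite /G; der_solve ltac:(by ring).
  have p1 r x : partial1of2 (fun s x => G s phi x) r x = - (x * expR (- x ^+ 2) * sin (r * x + phi)).
    rewrite partial1of2E; have := Gd r x => ?; exact: derive_val.
  have sI : `]s - 1, s + 1[%classic s by rewrite /= in_itv/=; apply/andP; split; lra.
  have Ib : Lint (fun x => `|x * expR (- x ^+ 2)|).
    apply: Lint_abs; apply: gdom_Lint; last by apply: gdomX; exact: gdom_expRN2.
    by apply: measurable_funM => //; exact: (cont_meas (@continuous_gauss_fun R)).
  have h1 r : `]s - 1, s + 1[%classic r -> Lint (G r phi) by move=> _; exact: Lint_gauss_cos.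
  have h2 r x : `]s - 1, s + 1[%classic r -> [set: R] x -> derivable (fun s => G s phi x) r 1.
    by move=> _ _; case: (Gd r x).
  have h3 r x : `]s - 1, s + 1[%classic r -> [set: R] x ->
     `|partial1of2 (fun s x => G s phi x) r x| <= `|x * expR (- x ^+ 2)|.
    by move=> _ _; rewrite p1 normrN normrM ler_piMr ?abs_sin_le1.
  have dv := @derivable_under_integral R _ _ mu (fun s x => G s phi x) setT measurableT
     s _ _ sI h1 h2 _ (fun x => normr_ge0 _) Ib h3.
  have dd := @differentiation_under_integral R _ _ mu (fun s x => G s phi x) setT measurableT
     s _ _ sI h1 h2 _ (fun x => normr_ge0 _) Ib h3.
  split; first exact: dv.
  rewrite -derive1E dd -[LHS]/(rint setT (fun x => partial1of2 (fun s x => G s phi x) s x)).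
  rewrite (_ : (fun x => _) = (fun x => - (x * expR (- x ^+ 2) * sin (s * x + phi)))); last first.
    by apply/funext => x; rewrite p1.
  by rewrite rintN//; have := parts s phi; rewrite -/(F s); lra.
have dH (s : R) : is_derive s 1 (fun s => F s * expR (s ^+ 2 / 4)) 0.
  notypeclasses refine (der_eq (der_M (dF s) _) _).
    notypeclasses refine (der_expR _); der_tac.
  by rewrite /=; field.
have := is_derive_0_is_cst t 0 dH.
rewrite expr0n mul0r expR0 mulr1.
have -> : F 0 = Num.sqrt pi * cos phi.
  have <- := gint1 R; rewrite /gint mulrC -rintZ; last exact: Lint_gauss_poly.
  by apply: eq_rint => x _; rewrite /G hornerC mulr1 mul0r add0r mulrC.
by move=> E; rewrite -/(F t) expRN mulrAC -E mulfK// gt_eqF// expR_gt0.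
Qed.

Lemma gauss_cos_transform_shift c (k0 t : R) : 0 < c ->
  Lint (fun k => expR (- (c ^+ 2 * (k - k0) ^+ 2)) * cos (k * t)) /\
  rint setT (fun k => expR (- (c ^+ 2 * (k - k0) ^+ 2)) * cos (k * t))
  = Num.sqrt pi / c * expR (- (t ^+ 2 / (4 * c ^+ 2))) * cos (k0 * t).
Proof.
move=> c0; have cG := der_cont_all (dG (t / c) (k0 * t)).
have IG := Lint_gauss_cos (t / c) (k0 * t).
have E k : G (t / c) (k0 * t) (c * k + - (c * k0)) = expR (- (c ^+ 2 * (k - k0) ^+ 2)) * cos (k * t).
  rewrite /G -mulrBr exprMn; congr (_ * cos _).
  by field; rewrite gt_eqF.
have I2 := Lint_affine (- (c * k0)) c0 cG IG.
split; first exact: Lint_eq I2.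
have := rint_affine (- (c * k0)) c0 cG IG.
rewrite gauss_cos_transform (_ : (fun x => G _ _ _) = (fun k => expR (- (c ^+ 2 * (k - k0) ^+ 2)) * cos (k * t))); last first.
  by apply/funext => k; rewrite -E.
move=> H; apply: (mulfI (lt0r_neq0 c0)); rewrite -H.
rewrite (_ : (t / c) ^+ 2 / 4 = t ^+ 2 / (4 * c ^+ 2)); last by field; rewrite gt_eqF.
by field; rewrite gt_eqF.
Qed.

Lemma rint_gauss_shift c (k0 : R) : 0 < c ->
  Lint (fun k => expR (- (c ^+ 2 * (k - k0) ^+ 2))) /\
  rint setT (fun k => expR (- (c ^+ 2 * (k - k0) ^+ 2))) = Num.sqrt pi / c.
Proof.
move=> c0; have [I E] := gauss_cos_transform_shift k0 0 c0.
have e : (fun k => expR (- (c ^+ 2 * (k - k0) ^+ 2)) * cos (k * 0)) = (fun k => expR (- (c ^+ 2 * (k - k0) ^+ 2))).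
  by apply/funext => k; rewrite mulr0 cos0 mulr1.
by rewrite e in I E; rewrite E mulr0 cos0 expr0n mul0r oppr0 expR0 !mulr1.
Qed.

End gaussian_fourier.

(** * Cosine and sine transforms and the spectral density of a pair *)

Section fourier.
Variable R : realType.
Local Notation mu := (@lebesgue_measure R).
Implicit Types (w v : R -> R) (c k t x y : R).

(** [Ctr] and [Str] are the real part and minus the imaginary part of $\int w(x)e^{-ikx}dx$, without
    the factor $(2\pi)^{-1/2}$. *)
Definition Ctr w k := rint setT (fun x => w x * cos (k * x)).
Definition Str w k := rint setT (fun x => w x * sin (k * x)).

Lemma cont_linear k : continuous (fun x : R => k * x).
Proof. by apply: (@der_cont_all _ _ (fun=> k)) => x; der_solve ltac:(by ring). Qed.

Lemma Lint_cos w k : Lint w -> Lint (fun x => w x * cos (k * x)).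
Proof.
move=> Iw; apply: (Lint_bound _ (Lint_abs Iw)) => [|x].
  apply: measurable_funM; first exact: Lint_meas.
  apply: cont_meas => x; apply: continuous_comp; [exact: cont_linear|exact: continuous_cos].
by rewrite normrM ler_piMr ?abs_cos_le1.
Qed.

Lemma Lint_sin w k : Lint w -> Lint (fun x => w x * sin (k * x)).
Proof.
move=> Iw; apply: (Lint_bound _ (Lint_abs Iw)) => [|x].
  apply: measurable_funM; first exact: Lint_meas.
  apply: cont_meas => x; apply: continuous_comp; [exact: cont_linear|exact: continuous_sin].
by rewrite normrM ler_piMr ?abs_sin_le1.
Qed.

Lemma CtrD w v k : Lint w -> Lint v -> Ctr (fun x => w x + v x) k = Ctr w k + Ctr v k.
Proof.
move=> Iw Iv; rewrite /Ctr -rintD; [|exact: Lint_cos..].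
by apply: eq_rint => x _; rewrite mulrDl.
Qed.

Lemma StrD w v k : Lint w -> Lint v -> Str (fun x => w x + v x) k = Str w k + Str v k.
Proof.
move=> Iw Iv; rewrite /Str -rintD; [|exact: Lint_sin..].
by apply: eq_rint => x _; rewrite mulrDl.
Qed.

Lemma CtrB w v k : Lint w -> Lint v -> Ctr (fun x => w x - v x) k = Ctr w k - Ctr v k.
Proof.
move=> Iw Iv; rewrite /Ctr -rintB; [|exact: Lint_cos..].
by apply: eq_rint => x _; rewrite mulrBl.
Qed.

Lemma StrB w v k : Lint w -> Lint v -> Str (fun x => w x - v x) k = Str w k - Str v k.
Proof.
move=> Iw Iv; rewrite /Str -rintB; [|exact: Lint_sin..].
by apply: eq_rint => x _; rewrite mulrBl.
Qed.

Lemma Ctr_bound w k : Lint w -> `|Ctr w k| <= rint setT (fun x => `|w x|).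
Proof.
move=> Iw; apply: rint_abs_le; [exact: Lint_cos|exact: Lint_abs|].
by move=> x; rewrite normrM ler_piMr ?abs_cos_le1.
Qed.

Lemma Str_bound w k : Lint w -> `|Str w k| <= rint setT (fun x => `|w x|).
Proof.
move=> Iw; apply: rint_abs_le; [exact: Lint_sin|exact: Lint_abs|].
by move=> x; rewrite normrM ler_piMr ?abs_sin_le1.
Qed.

Lemma meas2_cos : meas2 (fun k x : R => cos (k * x)).
Proof.
apply: meas2_comp; first exact: continuous_cos.
by apply: meas2M; [exact: meas2_id_fst|exact: meas2_id_snd].
Qed.

Lemma meas2_sin : meas2 (fun k x : R => sin (k * x)).
Proof.
apply: meas2_comp; first exact: continuous_sin.
by apply: meas2M; [exact: meas2_id_fst|exact: meas2_id_snd].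
Qed.

Lemma meas_Ctr w : Lint w -> measurable_fun setT (Ctr w).
Proof.
move=> Iw; apply: (meas_rint _ (Lint_abs Iw)) => [|k x].
  by apply: meas2M; [apply: meas2_snd; exact: Lint_meas|exact: meas2_cos].
by rewrite normrM ler_piMr ?abs_cos_le1.
Qed.

Lemma meas_Str w : Lint w -> measurable_fun setT (Str w).
Proof.
move=> Iw; apply: (meas_rint _ (Lint_abs Iw)) => [|k x].
  by apply: meas2M; [apply: meas2_snd; exact: Lint_meas|exact: meas2_sin].
by rewrite normrM ler_piMr ?abs_sin_le1.
Qed.

(** The real part of $\widehat w\,\overline{\widehat v}$ for the unnormalised transforms; hence the
    factor $2\pi$ in Plancherel's identity. *)
Definition spec w v k := Ctr w k * Ctr v k + Str w k * Str v k.

Lemma meas_spec w v : Lint w -> Lint v -> measurable_fun setT (spec w v).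
Proof.
move=> Iw Iv; apply: measurable_funD.
  by apply: measurable_funM; exact: meas_Ctr.
by apply: measurable_funM; exact: meas_Str.
Qed.

Lemma spec_bound w v k : Lint w -> Lint v -> `|spec w v k| <=
  2 * rint setT (fun x => `|w x|) * rint setT (fun x => `|v x|).
Proof.
move=> Iw Iv; apply: (le_trans (ler_normD _ _)); rewrite !normrM.
have h1 : `|Ctr w k| * `|Ctr v k| <= rint setT (fun x => `|w x|) * rint setT (fun x => `|v x|).
  by apply: ler_pM => //; exact: Ctr_bound.
have h2 : `|Str w k| * `|Str v k| <= rint setT (fun x => `|w x|) * rint setT (fun x => `|v x|).
  by apply: ler_pM => //; exact: Str_bound.
lra.
Qed.

(** The cosine transform in $k$ of the window $e^{-c^2(k-k_0)^2}$, by
    [gauss_cos_transform_shift]. *)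
Definition gker c k0 t := Num.sqrt pi / c * expR (- (t ^+ 2 / (4 * c ^+ 2))) * cos (k0 * t).

Lemma Lint_gauss_spec w v c k0 : Lint w -> Lint v -> 0 < c ->
  Lint (fun k => expR (- (c ^+ 2 * (k - k0) ^+ 2)) * spec w v k).
Proof.
move=> Iw Iv c0; have [Ig _] := rint_gauss_shift k0 c0.
apply: (Lint_bound _ (LintZ (2 * rint setT (fun x => `|w x|) * rint setT (fun x => `|v x|)) Ig)).
  by apply: measurable_funM; [exact: Lint_meas|exact: meas_spec].
move=> k; rewrite normrM ger0_norm ?expR_ge0// mulrC ler_wpM2r ?expR_ge0//.
exact: spec_bound.
Qed.

Lemma cont_gker c k0 : 0 < c -> continuous (gker c k0).
Proof.
move=> c0; apply: (@der_cont_all _ _ (fun t => Num.sqrt pi / c * (expR (- (t ^+ 2 / (4 * c ^+ 2))) *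
   (- (2 * t / (4 * c ^+ 2)))) * cos (k0 * t) + Num.sqrt pi / c * expR (- (t ^+ 2 / (4 * c ^+ 2))) * (- sin (k0 * t) * k0))) => t.
by rewrite /gker; der_solve ltac:(by ring).
Qed.

Lemma gker_bound c k0 t : 0 < c -> `|gker c k0 t| <= Num.sqrt pi / c.
Proof.
move=> c0; have s0 : 0 <= Num.sqrt (pi : R) / c by rewrite divr_ge0 ?sqrtr_ge0// ltW.
rewrite /gker !normrM -mulrA -normrM (ger0_norm s0) ler_piMr// -[leRHS]mulr1.
apply: ler_pM => //; rewrite ?abs_cos_le1// ger0_norm ?expR_ge0//.
rewrite -expR0 ler_expR oppr_le0 divr_ge0 ?sqr_ge0//.
by rewrite mulr_ge0 ?sqr_ge0.
Qed.

(** The density is the double integral of $w(x)v(y)\cos(k(x-y))$. The window makes the integral in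
    $(k,x,y)$ absolutely convergent, so $k$ can be integrated first, which leaves [gker]. *)
Lemma gauss_spec_kernel w v c k0 : Lint w -> Lint v -> 0 < c ->
  rint setT (fun k => expR (- (c ^+ 2 * (k - k0) ^+ 2)) * spec w v k)
  = rint setT (fun x => w x * rint setT (fun y => v y * gker c k0 (x - y))).
Proof.
move=> Iw Iv c0.
pose g k := expR (- (c ^+ 2 * (k - k0) ^+ 2)).
have [Ig _] := rint_gauss_shift k0 c0; rewrite -/g in Ig.
have g0 k : 0 <= g k by exact: expR_ge0.
have mg : measurable_fun setT g by exact: Lint_meas.
pose V k x := cos (k * x) * Ctr v k + sin (k * x) * Str v k.
have VE k x : V k x = rint setT (fun y => v y * cos (k * (x - y))).
  rewrite /V /Ctr /Str -!rintZ; [|exact: Lint_sin|exact: Lint_cos].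
  rewrite -rintD; [|exact/LintZ/Lint_cos|exact/LintZ/Lint_sin].
  by apply: eq_rint => y _; rewrite mulrBr cosB; ring.
pose nv := rint setT (fun x => `|v x|).
have Vb k x : `|V k x| <= 2 * nv.
  apply: (le_trans (ler_normD _ _)); rewrite !normrM.
  have h1 : `|cos (k * x)| * `|Ctr v k| <= 1 * nv.
    by apply: ler_pM; rewrite ?abs_cos_le1 ?Ctr_bound.
  have h2 : `|sin (k * x)| * `|Str v k| <= 1 * nv.
    by apply: ler_pM; rewrite ?abs_sin_le1 ?Str_bound.
  lra.
have mV : meas2 V.
  apply: meas2D; apply: meas2M.
  - exact: meas2_cos.
  - by apply: meas2_fst; exact: meas_Ctr.
  - exact: meas2_sin.
  - by apply: meas2_fst; exact: meas_Str.
transitivity (rint setT (fun k => rint setT (fun x => g k * (w x * V k x)))).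
  apply: eq_rint => k _.
  rewrite rintZ; last first.
    apply: (Lint_bound _ (LintZ (2 * nv) (Lint_abs Iw))).
      by apply: measurable_funM; [exact: Lint_meas|exact: meas2_section].
    by move=> x; rewrite normrM mulrC ler_wpM2r.
  congr (_ * _); rewrite /spec /Ctr /Str -/(Ctr v k) -/(Str v k).
  rewrite mulrC [X in _ + X]mulrC -!rintZ; [|exact: Lint_sin|exact: Lint_cos].
  rewrite -rintD; [|exact/LintZ/Lint_cos|exact/LintZ/Lint_sin].
  by apply: eq_rint => x _; rewrite /V; ring.
have [||||-> _ _] := @fubini_rint R (fun k x => g k * (w x * V k x)) (fun k => g k) (fun x => 2 * nv * `|w x|).
- by apply: meas2M; [exact: meas2_fst|apply: meas2M => //; apply: meas2_snd; exact: Lint_meas].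
- exact: Ig.
- exact/LintZ/Lint_abs.
- by move=> k x; rewrite normrM ger0_norm// ler_wpM2l// normrM mulrC ler_wpM2r.
apply: eq_rint => x _.
have [||||F1 F2 _] := @fubini_rint R (fun k y => g k * (v y * cos (k * (x - y)))) g (fun y => `|v y|).
- apply: meas2M; first exact: meas2_fst.
  apply: meas2M; first by apply: meas2_snd; exact: Lint_meas.
  apply: meas2_comp; first exact: continuous_cos.
  apply: meas2M; first exact: meas2_id_fst.
  by apply: meas2B; [exact: meas2_fst|exact: meas2_id_snd].
- exact: Ig.
- exact: Lint_abs.
- by move=> k y; rewrite normrM ger0_norm// ler_wpM2l// normrM ler_piMr ?abs_cos_le1.
transitivity (w x * rint setT (fun k => rint setT (fun y => g k * (v y * cos (k * (x - y)))))).
  rewrite -(rintZ _ F2).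
  apply: eq_rint => k _; rewrite mulrCA VE rintZ//.
  apply: (Lint_bound _ (Lint_abs Iv)).
    apply: measurable_funM; first exact: Lint_meas.
    apply: measurableT_comp; first exact: (cont_meas (@continuous_cos R)).
    by apply: measurable_funM => //; exact: measurable_funB.
  by move=> y; rewrite normrM ler_piMr ?abs_cos_le1.
congr (_ * _).
rewrite F1.
apply: eq_rint => y _.
have [I1 E1] := gauss_cos_transform_shift k0 (x - y) c0.
rewrite /gker -E1 -rintZ//; apply: eq_rint => k _; rewrite /g; ring.
Qed.

End fourier.

(** * Plancherel's identity *)

Section monotone_limit.
Variable R : realType.
Local Notation mu := (@lebesgue_measure R).

Lemma rint_monotone (F : nat -> R -> R) (f : R -> R) (B : R) :
  (forall n, Lint (F n)) -> (forall n x, 0 <= F n x) ->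
  (forall x m n, (m <= n)%N -> F m x <= F n x) ->
  (forall x, F n x @[n --> \oo] --> f x) -> measurable_fun setT f ->
  (forall n, rint setT (F n) <= B) ->
  Lint f /\ rint setT (F n) @[n --> \oo] --> rint setT f.
Proof.
move=> IF F0 Fm Ff mf FB.
have f0 x : 0 <= f x.
  have := Ff x => Fx; rewrite -(cvg_lim _ Fx)//; apply: limr_ge; first by apply/cvg_ex; exists (f x).
  exact: nearW.
have FfE x : (F n x)%:E @[n --> \oo] --> (f x)%:E by apply: cvg_EFin; [exact: nearW|exact: Ff].
have M := @cvg_monotone_convergence _ _ _ mu setT measurableT (fun n x => (F n x)%:E).
have {}M : (\int[mu]_x (F n x)%:E @[n --> \oo] --> \int[mu]_x (f x)%:E)%E.
  have -> : (\int[mu]_x (f x)%:E = \int[mu]_x (fun x => limn (fun n => (F n x)%:E)) x)%E.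
    by apply: eq_integral => x _; apply/esym/cvg_lim => //; exact: FfE.
  apply: M.
  - by move=> n; apply: measurableT_comp => //; exact: Lint_meas.
  - by move=> n x _; rewrite lee_fin.
  - by move=> x _ m n mn; rewrite lee_fin Fm.
have If : Lint f.
  apply/Lint_nonneg => //; apply: (@le_lt_trans _ _ B%:E); last exact: ltry.
  rewrite -(cvg_lim _ M)//; apply: lime_le; first by apply/cvg_ex; eexists; exact: M.
  by apply: nearW => n; rewrite rint_EFin// lee_fin.
split => //; apply: fine_cvg; move: M.
by rewrite (rint_EFin If).
Qed.

End monotone_limit.

(** For a splitting $w=v+u$ with [a], [b], [d] the norms of $w$, $v$, $u$, [P] the spectral cross
    term and [Q] the spectral energy of $u$. *)
Lemma quadratic_perturbation (R : realType) (p a b d e P Q : R) :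
  0 < p -> 0 <= d -> 0 <= b -> b <= a -> a <= b + d ->
  - (4 * p * (b * d)) <= P -> 0 <= Q -> d * (12 * p * (1 + a)) <= e ->
  2 * p * a ^+ 2 <= 2 * p * b ^+ 2 + 2 * P + Q + e.
Proof.
move=> p0 d0 b0 ba ab HP Q0 He.
have h1 : b * d <= a * d by rewrite ler_wpM2r.
have h2 : a ^+ 2 <= b ^+ 2 + 2 * (a * d) by nra.
have := ler_wpM2l (ltW p0) h1; have := ler_wpM2l (ltW p0) h2.
have := mulr_ge0 (ltW p0) d0; lra.
Qed.

Section plancherel.
Variable R : realType.
Local Notation mu := (@lebesgue_measure R).
Implicit Types (w v h : R -> R) (c k t x y : R).

Let sp0 : 0 < Num.sqrt (pi : R). Proof. by rewrite sqrtr_gt0 pi_gt0. Qed.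
Let spi : Num.sqrt (pi : R) ^+ 2 = pi. Proof. by rewrite sqr_sqrtr// pi_ge0. Qed.

(* As [c] tends to 0, [hker c / (2 * pi)] is an approximation of the identity. *)
Definition hker c t := Num.sqrt pi / c * expR (- (t ^+ 2 / (4 * c ^+ 2))).

Lemma gker0 c t : gker c 0 t = hker c t.
Proof. by rewrite /gker mul0r cos0 mulr1. Qed.

Lemma hker_ge0 c t : 0 < c -> 0 <= hker c t.
Proof. by move=> c0; rewrite mulr_ge0 ?expR_ge0// divr_ge0 ?(ltW sp0)// ltW. Qed.

Lemma hker_bound c t : 0 < c -> hker c t <= Num.sqrt pi / c.
Proof. by move=> c0; have := gker_bound 0 t c0; rewrite gker0 ger0_norm ?hker_ge0. Qed.

Lemma cont_hker c : 0 < c -> continuous (hker c).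
Proof.
move=> c0; have := @cont_gker R c 0 c0.
by rewrite (_ : gker c 0 = hker c)//; apply/funext => t; rewrite gker0.
Qed.

Lemma meas2_hker c : 0 < c -> meas2 (fun x y => hker c (x - y)).
Proof.
move=> c0; apply: meas2_comp; first exact: cont_hker.
by apply: meas2B; [exact: meas2_id_fst|exact: meas2_id_snd].
Qed.

Lemma hkerM_bound v c t y : 0 < c -> `|v y * hker c t| <= Num.sqrt pi / c * `|v y|.
Proof.
move=> c0; rewrite normrM mulrC ler_wpM2r// ger0_norm ?hker_ge0//.
exact: hker_bound.
Qed.

Lemma Lint_hkerM v c x : Lint v -> 0 < c -> Lint (fun y => v y * hker c (x - y)).
Proof.
move=> Iv c0; apply: (Lint_bound _ (LintZ (Num.sqrt pi / c) (Lint_abs Iv))).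
  by apply: measurable_funM; [exact: Lint_meas|exact: (meas2_section _ (meas2_hker c0))].
by move=> y; exact: hkerM_bound.
Qed.

Lemma meas_hker_conv v c : Lint v -> 0 < c ->
  measurable_fun setT (fun x => rint setT (fun y => v y * hker c (x - y))).
Proof.
move=> Iv c0; apply: (meas_rint _ (LintZ (Num.sqrt pi / c) (Lint_abs Iv))) => [|x y].
  by apply: meas2M; [apply: meas2_snd; exact: Lint_meas|exact: meas2_hker].
exact: hkerM_bound.
Qed.

Lemma hkerC c x y : hker c (x - y) = hker c (y - x).
Proof. by rewrite /hker -sqrrN opprB. Qed.

Lemma rint_gauss_width c x : 0 < c ->
  Lint (fun y => expR (- ((x - y) ^+ 2 / c ^+ 2))) /\
  rint setT (fun y => expR (- ((x - y) ^+ 2 / c ^+ 2))) = Num.sqrt pi * c.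
Proof.
move=> c0; have [I E] := @rint_gauss_shift R c^-1 x ltac:(by rewrite invr_gt0).
have e : (fun k => expR (- (c ^- 1 ^+ 2 * (k - x) ^+ 2))) = (fun y => expR (- ((x - y) ^+ 2 / c ^+ 2))).
  apply/funext => y; rewrite -(sqrrN (x - y)) opprB exprVn expr1; congr (expR (- _)).
  by rewrite mulrC.
by rewrite -e; split=> //; move: E; rewrite invrK.
Qed.

Lemma hker_rint c x : 0 < c ->
  Lint (fun y => hker c (x - y)) /\ rint setT (fun y => hker c (x - y)) = 2 * pi.
Proof.
move=> c0; have c2 : 0 < 2 * c by rewrite mulr_gt0.
have [I E] := rint_gauss_width x c2.
have e : (fun y => hker c (x - y)) = (fun y => Num.sqrt pi / c * expR (- ((x - y) ^+ 2 / (2 * c) ^+ 2))).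
  apply/funext => y; rewrite /hker; congr (_ * expR (- (_ / _))).
  by rewrite exprMn; ring.
rewrite e; split; first exact: LintZ.
rewrite rintZ// E -[in RHS]spi; field.
by rewrite gt_eqF.
Qed.

Lemma hker_conv_L1 h c : (forall x, 0 <= h x) -> Lint h -> 0 < c ->
  Lint (fun x => rint setT (fun y => h y * hker c (x - y))) /\
  rint setT (fun x => rint setT (fun y => h y * hker c (x - y))) = 2 * pi * rint setT h.
Proof.
move=> h0 Ih c0.
pose F x y := h y * hker c (x - y).
have mF : meas2 F by apply: meas2M; [apply: meas2_snd; exact: Lint_meas|exact: meas2_hker].
have F0 x y : 0 <= F x y by rewrite mulr_ge0// hker_ge0.
have Fb x y : `|F x y| <= Num.sqrt pi / c * h y.
  by rewrite ger0_norm// /F mulrC ler_wpM2r// hker_bound.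
have IF x : Lint (F x).
  by apply: (Lint_bound _ (LintZ (Num.sqrt pi / c) Ih)) => //; exact: meas2_section.
have mr : measurable_fun setT (fun x => rint setT (F x)).
  exact: meas_rint mF (LintZ (Num.sqrt pi / c) Ih) Fb.
have mh : measurable_fun setT (fun p : R * R => (F p.1 p.2)%:E).
  by apply: measurableT_comp; [|exact: mF].
have T := @fubini_tonelli _ _ _ _ _ mu mu (fun p => (F p.1 p.2)%:E) mh (fun p => F0 p.1 p.2).
have e1 : (\int[mu]_x \int[mu]_y (F x y)%:E = \int[mu]_x (rint setT (F x))%:E)%E.
  by apply: eq_integral => x _; rewrite rint_EFin.
have e2 : (\int[mu]_y \int[mu]_x (F x y)%:E = (2 * pi * rint setT h)%:E)%E.
  transitivity (\int[mu]_y (2 * pi * h y)%:E)%E.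
    apply: eq_integral => y _.
    have [Ik Ek] := hker_rint y c0.
    have Ik' : Lint (fun x => hker c (x - y)) by apply: Lint_eq Ik => x; exact: hkerC.
    have Ek' : rint setT (fun x => hker c (x - y)) = 2 * pi.
      by rewrite -Ek; apply: eq_rint => x _; exact: hkerC.
    transitivity ((rint setT (fun x => h y * hker c (x - y)))%:E).
      exact: (rint_EFin (LintZ (h y) Ik')).
    by rewrite (rintZ _ Ik') Ek' mulrC.
  by rewrite (rint_EFin (LintZ (2 * pi) Ih)) rintZ.
rewrite /= e1 e2 in T.
have r0 x : 0 <= rint setT (F x) by apply: rint_ge0 => y _.
split; first by apply/Lint_nonneg => //; rewrite T ltry.
by rewrite /rint T.
Qed.

(** The spectral energy damped by a Gaussian; it increases to the full one as [c] decreases to 0. *)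
Definition gspec w c := rint setT (fun k => expR (- (c ^+ 2 * k ^+ 2)) * spec w w k).

Lemma gspecE w c : Lint w -> 0 < c -> gspec w c =
  rint setT (fun x => w x * rint setT (fun y => w y * hker c (x - y))).
Proof.
move=> Iw c0; have := gauss_spec_kernel 0 Iw Iw c0.
rewrite /gspec; under eq_fun do rewrite subr0; move=> ->.
by apply: eq_rint => x _; congr (_ * _); apply: eq_rint => y _; rewrite gker0.
Qed.

Lemma spec_ge0 w k : 0 <= spec w w k.
Proof. by rewrite /spec addr_ge0// -expr2 sqr_ge0. Qed.

(** In the kernel form use $w(x)w(y)\le\frac12(w(x)^2+w(y)^2)$; the kernel has mass $2\pi$ in each
    variable. *)
Lemma gspec_le w c : Lint w -> L2 w -> 0 < c -> gspec w c <= 2 * pi * L2inner w w.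
Proof.
move=> Iw Lw c0; rewrite gspecE//.
have Iw2 := L2_Lint Lw.
have [IA EA] := hker_conv_L1 (fun x => sqr_ge0 (w x)) Iw2 c0.
set A := fun x => _ in IA EA.
have -> : 2 * pi * L2inner w w = rint setT (fun x => 2^-1 * (2 * pi * w x ^+ 2 + A x)).
  rewrite rintZ; last exact/LintD/IA/LintZ.
  rewrite rintD//; last exact: LintZ.
  rewrite rintZ// EA (_ : L2inner w w = rint setT (fun x => w x ^+ 2)).
    by field.
  by apply: eq_rint => x _; rewrite expr2.
have Iy x := Lint_hkerM x Iw c0; have Iy2 x := Lint_hkerM x Iw2 c0.
apply: rint_le.
- have mw : measurable_fun setT w by exact: Lint_meas.
  have mr := meas_hker_conv Iw c0.
  apply: (Lint_bound _ (LintZ (Num.sqrt pi / c * rint setT (fun x => `|w x|)) (Lint_abs Iw))).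
    exact: measurable_funM.
  move=> x; rewrite normrM mulrC ler_wpM2r// -rintZ; last exact: Lint_abs.
  apply: rint_abs_le => //; first exact/LintZ/Lint_abs.
  by move=> y; exact: hkerM_bound.
- by apply: LintZ; apply: LintD => //; exact: LintZ.
move=> x; have [Ik Ek] := hker_rint x c0.
rewrite -rintZ// (_ : 2^-1 * _ = rint setT (fun y => 2^-1 * (w x ^+ 2 * hker c (x - y) + w y ^+ 2 * hker c (x - y)))).
  apply: rint_le; [exact: LintZ|by apply/LintZ/LintD => //; exact: LintZ|].
  move=> y; have := hker_ge0 (x - y) c0; set K := hker _ _ => K0.
  have := mulr_ge0 (sqr_ge0 (w x - w y)) K0; nra.
rewrite rintZ; last by apply: LintD => //; exact: LintZ.
rewrite rintD//; last exact: LintZ.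
by rewrite rintZ// Ek /A; congr (_ * (_ + _)); ring.
Qed.

Let cn (n : nat) : R := n.+1%:R^-1.
Let cn0 n : 0 < cn n. Proof. by rewrite invr_gt0. Qed.

Lemma spec_limit w B : Lint w -> (forall n, gspec w (cn n) <= B) ->
  Lint (spec w w) /\ gspec w (cn n) @[n --> \oo] --> rint setT (spec w w).
Proof.
move=> Iw HB; apply: rint_monotone HB.
- move=> n; have := Lint_gauss_spec 0 Iw Iw (cn0 n).
  by apply: Lint_eq => k; rewrite subr0.
- by move=> n k; rewrite mulr_ge0 ?expR_ge0// spec_ge0.
- move=> k m n mn; rewrite ler_wpM2r ?spec_ge0// ler_expR lerN2 ler_wpM2r ?sqr_ge0//.
  by rewrite lerXn2r ?nnegrE ?(ltW (cn0 _))// lef_pV2 ?posrE// ler_nat.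
- move=> k; rewrite -[X in _ --> X]mul1r; apply: cvgMl.
  rewrite -[X in _ --> X]expR0; apply: cvg_comp; last exact: continuous_expR.
  rewrite -oppr0; apply: cvgN; rewrite -[X in _ --> X](mul0r (k ^+ 2)); apply: cvgMl.
  rewrite (_ : (0 : R) = 0 ^+ 2); last by rewrite expr0n.
  apply: (@cvg_comp _ _ _ cn (fun z => z ^+ 2)); last exact: exprn_continuous.
  exact: cvg_harmonic.
- exact: meas_spec.
Qed.

Lemma bessel w : Lint w -> L2 w ->
  Lint (spec w w) /\ rint setT (spec w w) <= 2 * pi * L2inner w w.
Proof.
move=> Iw Lw; have [|I E] := @spec_limit w (2 * pi * L2inner w w) Iw.
  by move=> n; exact: gspec_le.
split => //; apply: (ler_cvg_to E (cvg_cst _)).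
by apply: nearW => n; exact: gspec_le.
Qed.

Lemma Lint_osc_ball v (M : R) x (r : R) : Lint v -> (forall x, `|v x| <= M) ->
  Lint (fun y => `|v y - v x| * \1_(ball x r) y).
Proof.
move=> Iv vM; have mv := Lint_meas Iv.
have IB : Lint (\1_(ball x r) : R -> R).
  by rewrite ball_itv; exact: integrable_indic_itv.
apply: (Lint_bound _ (LintZ (2 * M) IB)).
  apply: measurable_funM; last exact: Lint_meas.
  by apply: measurableT_comp => //; exact: measurable_funB.
move=> y; have /andP[i0 _] := indic01 (ball x r) y.
rewrite normrM normr_id (ger0_norm i0) ler_wpM2r//.
rewrite (le_trans (ler_normB _ _))//; have := vM x; have := vM y; lra.
Qed.

Lemma lebesgue_pt_avg v (M : R) x (d : R) : Lint v -> (forall x, `|v x| <= M) ->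
  lebesgue_pt v x -> 0 < d ->
  exists2 r0 : R, 0 < r0 & forall r, 0 < r < r0 ->
    rint setT (fun y => `|v y - v x| * \1_(ball x r) y) <= 2 * r * d.
Proof.
move=> Iv vM lx d0.
have mv := Lint_meas Iv.
have : \forall r \near (0 : R)^'+, (davg v x r < d%:E)%E.
  exact: (lx _ (@nbhs_open_ereal_lt _ 0 (fun=> d) d0)).
move=> /nbhs_ballP[e /= e0 He]; exists e => // r /andP[r0 re].
have hb : ball (0 : R) e r by rewrite /ball/= sub0r normrN gtr0_norm.
have := He r hb r0.
have ID := Lint_osc_ball x r Iv vM.
rewrite /davg /iavg lebesgue_measure_ball ?(ltW r0)//.
rewrite (_ : (\int[_]_(_ in _) _)%E = (rint setT (fun y => `|v y - v x| * \1_(ball x r) y))%:E); last first.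
  rewrite -rint_EFin// integral_mkcond; apply: eq_integral => y _.
  rewrite /patch indicE; case: ifP => _; last by rewrite mulr0.
  by rewrite mulr1.
rewrite inver gt_eqF ?pmulrn_lgt0//.
rewrite -EFinM lte_fin mulrC ltr_pdivrMr ?pmulrn_lgt0// => /ltW.
by rewrite mulr2n => h; apply: (le_trans h); lra.
Qed.

(** The integral is split at distance $Lc$ from [x]. Inside, the kernel is at most $\sqrt\pi/c$ and
    [x] is a Lebesgue point; outside, the Gaussian tail is small because [L] is large. *)
Lemma hker_approx v (M : R) x : Lint v -> (forall x, `|v x| <= M) -> lebesgue_pt v x ->
  rint setT (fun y => v y * hker (cn n) (x - y)) @[n --> \oo] --> 2 * pi * v x.
Proof.
move=> Iv vM lx; have mv := Lint_meas Iv.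
have M0 : 0 <= M by apply: le_trans (vM 0).
apply/cvgrPdist_le => e e0.
(* $K/L^2$ will bound the contribution from $|x-y|\ge Lc$, and [L] is taken so large that this is at
   most $e/2$. *)
pose K := 16 * M * (Num.sqrt pi * (Num.sqrt pi * 3)).
have K0 : 0 <= K by rewrite !mulr_ge0// ltW.
pose L := 1 + 2 * K / e.
have L1 : 1 <= L by rewrite /L lerDl divr_ge0 ?mulr_ge0// ltW.
have KL : K / L ^+ 2 <= e / 2.
  rewrite ler_pdivrMr ?exprn_gt0//; last by lra.
  have : L <= L ^+ 2 by rewrite expr2 ler_peMl//; lra.
  have : K <= e / 2 * L.
    have -> : e / 2 * L = e / 2 + K by rewrite /L; field; rewrite gt_eqF.
    by rewrite lerDr divr_ge0// ltW.
  move=> h1 h2; apply: (le_trans h1); rewrite ler_wpM2l// divr_ge0// ltW//.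
(* With this [d] the ball of radius $Lc$ contributes at most $\frac{\sqrt\pi}c\cdot2Lc\cdot
   d=e/2$. *)
pose d := e / (4 * Num.sqrt pi * L).
have d0 : 0 < d by rewrite divr_gt0// !mulr_gt0//; lra.
have [r0 r00 Hr] := lebesgue_pt_avg Iv vM lx d0.
near=> n.
have c0 := cn0 n; set c := cn n in c0 *.
have cr : L * c < r0.
  rewrite /c /cn ltr_pdivrMr// -ltr_pdivrMl// mulrC.
  apply: (@lt_le_trans _ _ n%:R); last by rewrite ler_nat.
  by near: n; exact: nbhs_infty_gtr.
have [Ik Ek] := hker_rint x c0.
have IvK := Lint_hkerM x Iv c0.
rewrite mulrC -Ek -rintZ// -rintB//; last exact: LintZ.
have c8 : 0 < 3 * c by rewrite mulr_gt0.
have [Ig Eg] := rint_gauss_width x c8.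
pose B := ball x (L * c).
have IvB : Lint (fun y => `|v y - v x| * \1_B y) := Lint_osc_ball x (L * c) Iv vM.
apply: (@le_trans _ _ (rint setT (fun y => Num.sqrt pi / c * (`|v y - v x| * \1_B y)
    + 16 * M * (Num.sqrt pi / c) / L ^+ 2 * expR (- ((x - y) ^+ 2 / (3 * c) ^+ 2))))).
  apply: rint_abs_le.
  - by apply: LintB => //; exact: LintZ.
  - by apply: LintD; exact: LintZ.
  move=> y; rewrite -mulrBl normrM distrC (ger0_norm (hker_ge0 _ c0)).
  have vyx : `|v y - v x| <= 2 * M.
    by rewrite (le_trans (ler_normB _ _))//; have := vM x; have := vM y; lra.
  have spc : 0 <= Num.sqrt pi / c by apply: divr_ge0; exact: ltW.
  rewrite indicTE; case: asboolP => [_|nB].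
    rewrite mulr1; apply: (@le_trans _ _ (Num.sqrt pi / c * `|v y - v x|)).
      by rewrite mulrC ler_wpM2r// hker_bound.
    rewrite lerDl mulr_ge0 ?expR_ge0// divr_ge0 ?sqr_ge0// mulr_ge0// mulr_ge0//.
  rewrite mulr0 mulr0 add0r.
  have xy : L * c <= `|x - y| by move: nB; rewrite /B /ball/= => /negP; rewrite -leNgt.
  have s2 : L ^+ 2 / 8 <= (x - y) ^+ 2 / (8 * c ^+ 2).
    rewrite -(real_normK (num_real (x - y))) invfM mulrA [leRHS]mulrAC ler_wpM2r//.
    rewrite ler_pdivlMr ?exprn_gt0// -exprMn lerXn2r ?nnegrE//.
    by rewrite mulr_ge0 ?ltW//; lra.
  (* One half of the exponent gives $8/L^2$ through $e^{-u}\le1/u$. The other half is relaxed from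
     $8c^2$ to $9c^2$, a Gaussian of width $3c$ whose mass is known. *)
  have h1 : hker c (x - y) <= Num.sqrt pi / c * (8 / L ^+ 2 * expR (- ((x - y) ^+ 2 / (3 * c) ^+ 2))).
    rewrite /hker ler_wpM2l//.
    have -> : - ((x - y) ^+ 2 / (4 * c ^+ 2)) = - ((x - y) ^+ 2 / (8 * c ^+ 2)) + - ((x - y) ^+ 2 / (8 * c ^+ 2)).
      by field; rewrite gt_eqF.
    rewrite expRD; apply: ler_pM; rewrite ?expR_ge0//.
      rewrite expRN -[leRHS]invf_div lef_pV2 ?posrE ?expR_gt0//; last first.
        by rewrite divr_gt0// exprn_gt0//; lra.
      by apply: (le_trans s2); apply: le_trans (expR_ge1Dx _); rewrite lerDr.
    rewrite ler_expR lerN2 ler_wpM2l ?sqr_ge0// lef_pV2 ?posrE ?exprn_gt0//.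
      by rewrite exprMn ler_wpM2r ?sqr_ge0//; lra.
    by rewrite mulr_gt0// exprn_gt0.
  apply: (le_trans (ler_pM _ _ vyx h1)); rewrite ?hker_ge0//.
  apply: ler_eqW; field.
  by rewrite (gt_eqF c0) gt_eqF//; lra.
rewrite rintD; [|exact: LintZ..].
rewrite !rintZ// Eg.
have h1 : Num.sqrt pi / c * rint setT (fun y => `|v y - v x| * \1_B y) <= e / 2.
  have Lc : 0 < L * c < r0 by rewrite cr andbT mulr_gt0//; lra.
  have := Hr _ Lc; rewrite -/B => h.
  have spc : 0 <= Num.sqrt pi / c by apply: divr_ge0; exact: ltW.
  apply: (le_trans (ler_wpM2l spc h)).
  apply: ler_eqW; rewrite /d; field.
  by rewrite (gt_eqF c0) (gt_eqF sp0) gt_eqF//; lra.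
have h2 : 16 * M * (Num.sqrt pi / c) / L ^+ 2 * (Num.sqrt pi * (3 * c)) = K / L ^+ 2.
  by rewrite /K; field; rewrite (gt_eqF c0) gt_eqF//; lra.
rewrite h2; lra.
Unshelve. all: by end_near. Qed.

(** Almost every point is a Lebesgue point, so the smoothed function tends to $2\pi v$ almost
    everywhere, and the bound [M] supplies the domination. *)
Lemma plancherel_bounded v (M : R) : Lint v -> L2 v -> (forall x, `|v x| <= M) ->
  rint setT (spec v v) = 2 * pi * L2inner v v.
Proof.
move=> Iv Lv vM; have mv := Lint_meas Iv.
have M0 : 0 <= M by apply: le_trans (vM 0).
have [_ E1] := @spec_limit v (2 * pi * L2inner v v) Iv (fun n => gspec_le Iv Lv (cn0 n)).
pose T n x := rint setT (fun y => v y * hker (cn n) (x - y)).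
have IvK n x := Lint_hkerM x Iv (cn0 n).
have [|||||_ E2] := @rint_dominated R (fun n x => v x * T n x) (fun x => v x * (2 * pi * v x)) (fun x => M * (2 * pi) * `|v x|).
- by move=> n; apply: measurable_funM => //; exact: meas_hker_conv.
- by apply: measurable_funM => //; exact: measurable_funM.
- exact/LintZ/Lint_abs.
- have := lebesgue_differentiation (open_integrable_locally openT Iv).
  move=> /ae_imply; apply => x lx; apply: cvgMr.
  exact: hker_approx vM lx.
- move=> n x; rewrite normrM mulrC ler_wpM2r//.
  have [Ik Ek] := hker_rint x (cn0 n).
  rewrite -Ek -rintZ//; apply: rint_abs_le => //; first exact: LintZ.
  by move=> y; rewrite normrM (ger0_norm (hker_ge0 _ (cn0 n))) ler_wpM2r// hker_ge0.
have E3 : (fun n => gspec v (cn n)) = (fun n => rint setT (fun x => v x * T n x)).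
  by apply/funext => n; rewrite gspecE.
rewrite E3 in E1.
rewrite (cvg_unique (@Rhausdorff R) E1 E2) /L2inner -rintZ; last exact: L2M_Lint.
by apply: eq_rint => x _; ring.
Qed.

(** The transforms are estimated one by one with [bessel], which makes the constant twice the sharp
    $2\pi$; it serves to control errors only. *)
Lemma spec_CS w v : Lint w -> L2 w -> Lint v -> L2 v ->
  [/\ Lint (spec w v), L2 (Ctr w), L2 (Str w) &
  `|rint setT (spec w v)| <= 4 * pi * (L2norm w * L2norm v)].
Proof.
move=> Iw Lw Iv Lv.
have key (u : R -> R) : Lint u -> L2 u -> [/\ L2 (Ctr u), L2 (Str u),
    L2norm (Ctr u) <= Num.sqrt (2 * pi) * L2norm u & L2norm (Str u) <= Num.sqrt (2 * pi) * L2norm u].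
  move=> Iu Lu; have [Is Es] := bessel Iu Lu.
  have LC : L2 (Ctr u).
    apply: L2P; first exact: meas_Ctr.
    apply: (Lint_bound _ Is); first by apply: measurable_funX; exact: meas_Ctr.
    by move=> k; rewrite ger0_norm ?sqr_ge0// /spec -!expr2 lerDl sqr_ge0.
  have LS : L2 (Str u).
    apply: L2P; first exact: meas_Str.
    apply: (Lint_bound _ Is); first by apply: measurable_funX; exact: meas_Str.
    by move=> k; rewrite ger0_norm ?sqr_ge0// /spec -!expr2 lerDr sqr_ge0.
  have p0 : 0 <= 2 * pi :> R by rewrite mulr_ge0// pi_ge0.
  have E : rint setT (spec u u) = L2inner (Ctr u) (Ctr u) + L2inner (Str u) (Str u).
    exact: (rintD (L2M_Lint LC LC) (L2M_Lint LS LS)).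
  rewrite E -!sqr_L2norm in Es.
  split => //; apply: ler_sqr_pos; rewrite ?mulr_ge0 ?sqrtr_ge0 ?L2norm_ge0//.
    by rewrite exprMn (sqr_sqrtr p0); apply: (le_trans _ Es); rewrite lerDl sqr_ge0.
  by rewrite exprMn (sqr_sqrtr p0); apply: (le_trans _ Es); rewrite lerDr sqr_ge0.
have [Cw Sw Cw2 Sw2] := key w Iw Lw; have [Cv Sv Cv2 Sv2] := key v Iv Lv.
split => //.
  by apply: LintD; exact: L2M_Lint.
rewrite /spec rintD; [|exact: L2M_Lint..].
apply: (le_trans (ler_normD _ _)).
have p0 : 0 <= 2 * pi :> R by rewrite mulr_ge0// pi_ge0.
have h1 := le_trans (ip_CS Cw Cv) (ler_pM (L2norm_ge0 _) (L2norm_ge0 _) Cw2 Cv2).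
have h2 := le_trans (ip_CS Sw Sv) (ler_pM (L2norm_ge0 _) (L2norm_ge0 _) Sw2 Sv2).
apply: (le_trans (lerD h1 h2)).
have := sqr_sqrtr p0; move: (L2norm w) (L2norm v) (Num.sqrt (2 * pi)) => a b s s2.
have -> : 4 * pi * (a * b) = 2 * (2 * pi) * (a * b) by ring.
by rewrite -s2; apply: ler_eqW; ring.
Qed.

Lemma specD w v u k : Lint w -> Lint v -> Lint u ->
  spec (fun x => w x + v x) u k = spec w u k + spec v u k.
Proof. by move=> Iw Iv Iu; rewrite /spec CtrD// StrD//; ring. Qed.

Lemma specC w v k : spec w v k = spec v w k.
Proof. by rewrite /spec; ring. Qed.

Lemma spec_expand w v : Lint w -> L2 w -> Lint v -> L2 v ->
  rint setT (spec (fun x => w x + v x) (fun x => w x + v x))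
  = rint setT (spec w w) + 2 * rint setT (spec w v) + rint setT (spec v v).
Proof.
move=> Iw Lw Iv Lv.
have [I1 _ _ _] := spec_CS Iw Lw Iw Lw; have [I2 _ _ _] := spec_CS Iw Lw Iv Lv.
have [I3 _ _ _] := spec_CS Iv Lv Iv Lv.
rewrite -rintZ// -rintD//; last exact: LintZ.
rewrite -rintD//; last exact/LintD/LintZ.
apply: eq_rint => k _; rewrite specD//; last exact: LintD.
by rewrite (specC w (fun x => w x + v x)) (specC v (fun x => w x + v x)) !specD// (specC v w); ring.
Qed.

(** [bessel] is one inequality. For the other, the values of [w] are cut at height [n]: the identity
    holds for the bounded part, and the remainder tends to 0 in $L^2$. *)
Lemma plancherel_sqr w : Lint w -> L2 w -> rint setT (spec w w) = 2 * pi * L2inner w w.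
Proof.
move=> Iw Lw; have mw := Lint_meas Iw.
apply/eqP; rewrite eq_le; apply/andP; split; first by case: (bessel Iw Lw).
pose v (n : nat) x := Num.max (- n%:R) (Num.min n%:R (w x)).
have mv n : measurable_fun setT (v n).
  by apply: (@measurable_maxr _ _ R _ (fun=> - n%:R) (fun x => Num.min n%:R (w x))) => //;
    apply: (@measurable_minr _ _ R _ (fun=> n%:R) w).
have vn n x : `|v n x| <= n%:R.
  have n0 : (0 : R) <= n%:R by [].
  rewrite ler_norml /v; apply/andP; split; first by rewrite le_max lexx.
  by rewrite ge_max ge_min lexx /= andbT; lra.
have vw n x : `|v n x| <= `|w x|.
  have n0 : (0 : R) <= n%:R by [].
  rewrite /v; case: (leP (w x) n%:R) => h1; case: (leP (- n%:R) _) => h2 //.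
  - by rewrite ler0_norm ?oppr_le0// opprK ler0_norm; lra.
  - by rewrite ger0_norm// ger0_norm; lra.
  - by rewrite ler0_norm ?oppr_le0//; rewrite (ger0_norm (x := w x)); lra.
have uw n x : `|w x - v n x| <= `|w x|.
  have n0 : (0 : R) <= n%:R by [].
  rewrite /v; case: (leP (w x) n%:R) => h1; case: (leP (- n%:R) _) => h2.
  - by rewrite subrr normr0.
  - by rewrite opprK ler0_norm ?ler0_norm; lra.
  - by rewrite ger0_norm ?ger0_norm; lra.
  - by lra.
have Iv n : Lint (v n) by apply: (Lint_bound (mv n) (Lint_abs Iw)).
have Lv n : L2 (v n) by apply: L2_bound Lw _.
have Iu n : Lint (fun x => w x - v n x) by exact: LintB.
have Lu n : L2 (fun x => w x - v n x) by exact: L2B.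
have [|||||_ E2] := @rint_dominated R (fun n x => (w x - v n x) ^+ 2) (fun=> 0) (fun x => w x ^+ 2).
- by move=> n; apply: measurable_funX; exact: L2_meas.
- by [].
- exact: L2_Lint.
- apply: aeW => x; apply: cvg_near_cst; near=> n.
  have wn : `|w x| <= n%:R by near: n; exact: nbhs_infty_ger.
  move: wn; rewrite ler_norml => /andP[w1 w2].
  by rewrite /v min_r// max_r// subrr expr0n.
- move=> n x; rewrite normrX -(real_normK (num_real (w x))) lerXn2r ?nnegrE//.
rewrite rint0 in E2.
have E3 : L2norm (fun x => w x - v n x) @[n --> \oo] --> 0.
  rewrite -(sqrtr0 R); exact: (cvg_comp _ _ E2 (@sqrt_continuous R 0)).
have p0 : 0 < pi :> R := pi_gt0 R.
have nw0 : 0 <= L2norm w := L2norm_ge0 w.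
pose D := 12 * pi * (1 + L2norm w).
have D0 : 0 < D by apply: mulr_gt0; [exact: mulr_gt0|exact: ltr_pwDl].
apply/ler_addgt0Pr => e e0.
near \oo => n.
have un : L2norm (fun x => w x - v n x) <= e / D.
  near: n; move/cvgr0Pnorm_le : E3 => /(_ (e / D)).
  have : 0 < e / D by exact: divr_gt0.
  move=> h /(_ h); apply: filterS => m; exact: le_trans (ler_norm _).
move: un; set u := fun x => w x - v n x; set nu := L2norm u => un.
have nu0 : 0 <= nu := L2norm_ge0 u.
have wE : (fun x => v n x + u x) = w by apply/funext => x; rewrite /u; ring.
have := spec_expand (Iv n) (Lv n) (Iu n) (Lu n); rewrite -/u wE => E.
have P1 := plancherel_bounded (Iv n) (Lv n) (vn n).
have [_ _ _ P2] := spec_CS (Iv n) (Lv n) (Iu n) (Lu n).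
have P3 : 0 <= rint setT (spec u u) by apply: rint_ge0 => k _; exact: spec_ge0.
have nv : L2norm (v n) <= L2norm w by exact: L2norm_le.
have nw : L2norm w <= L2norm (v n) + nu.
  by apply: (L2norm_triangle (Lv n) (Lu n)) => x; ring.
have nv0 := L2norm_ge0 (v n).
rewrite E P1 -!sqr_L2norm.
move: P2; rewrite -/u -/nu ler_norml => /andP[P2 _].
by apply: quadratic_perturbation nu0 nv0 nv nw P2 P3 _ => //; move: un; rewrite (ler_pdivlMr _ _ D0).
Unshelve. all: by end_near. Qed.

Theorem plancherel w v : Lint w -> L2 w -> Lint v -> L2 v ->
  rint setT (spec w v) = 2 * pi * L2inner w v.
Proof.
move=> Iw Lw Iv Lv; have := spec_expand Iw Lw Iv Lv.
rewrite !plancherel_sqr//; [|exact: LintD|exact: L2D].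
rewrite ipDl ?ipDr//; last exact: L2D.
by rewrite (ipC v w); lra.
Qed.

End plancherel.

(** * Hermite projection and coherent states *)

Section hermite_projection.
Variable R : realType.
Local Notation H := (@hermite R).
Variable b : R.
Hypothesis b0 : 0 < b.
Implicit Types (w v : R -> R) (p q : {poly R}).

Definition hpoly n : {poly R} := H n \Po (b *: 'X).
Definition hfun n := hatP b (hpoly n).

Let bn0 : b != 0. Proof. by rewrite gt_eqF. Qed.

Lemma comp_scaleK p : (p \Po (b *: 'X)) \Po (b^-1 *: 'X) = p.
Proof.
rewrite -comp_polyA comp_polyZ comp_polyX scalerA mulfV// scale1r.
exact: comp_polyXr.
Qed.

Lemma size_hpoly n : size (hpoly n) = n.+1.
Proof. by rewrite /hpoly size_comp_scale ?gt_eqF// size_hermite. Qed.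

Lemma hfunE n x : hfun n x = expR (- (b ^+ 2 * x ^+ 2) / 2) * (H n).[b * x].
Proof. by rewrite /hfun /hatP /hpoly horner_comp hornerZ hornerX. Qed.

Lemma L2_hfun n : L2 (hfun n). Proof. exact: L2_hatP. Qed.

Definition hnorm2 n := b^-1 * hsq R n.

Lemma hnorm2_gt0 n : 0 < hnorm2 n.
Proof. by rewrite mulr_gt0 ?invr_gt0// hsq_gt0. Qed.

Lemma hfun_sqr n : L2inner (hfun n) (hfun n) = hnorm2 n.
Proof. by rewrite hatP_ip// !comp_scaleK gint_hermite_sqr. Qed.

Lemma hfun_orth m n : m != n -> L2inner (hfun m) (hfun n) = 0.
Proof. by move=> mn; rewrite hatP_ip// !comp_scaleK gint_hermite_neq// mulr0. Qed.

Definition hcoef w i := L2inner w (hfun i) / hnorm2 i.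

(** The modes are 0 to $n-1$, so the degree is below [n]; the Galerkin space corresponds to
    $n=N+1$. *)
Definition hproj n w : {poly R} := \sum_(i < n) hcoef w i *: hpoly i.

Lemma hatP_sum (I : Type) (s : seq I) (F : I -> {poly R}) x :
  hatP b (\sum_(i <- s) F i) x = \sum_(i <- s) hatP b (F i) x.
Proof. by rewrite /hatP horner_sum big_distrr. Qed.

Lemma hatPZ (c : R) p x : hatP b (c *: p) x = c * hatP b p x.
Proof. by rewrite /hatP hornerZ mulrCA. Qed.

Lemma hatPD p q x : hatP b (p + q) x = hatP b p x + hatP b q x.
Proof. by rewrite /hatP hornerD mulrDr. Qed.

Lemma hatPB p q x : hatP b (p - q) x = hatP b p x - hatP b q x.
Proof. by rewrite /hatP hornerD hornerN; ring. Qed.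

Lemma hproj_fun n w x : hatP b (hproj n w) x = \sum_(i < n) hcoef w i * hfun i x.
Proof. by rewrite hatP_sum; apply: eq_bigr => i _; rewrite hatPZ. Qed.

Lemma size_hproj n w : (size (hproj n w) <= n)%N.
Proof.
rewrite /hproj; elim/big_ind: _ => [|p q hp hq|i _]; first by rewrite size_poly0.
  by rewrite (leq_trans (size_polyD _ _))// geq_max hp.
by rewrite (leq_trans (size_scale_leq _ _))// size_hpoly.
Qed.

Lemma ip_hproj n w v : L2 v ->
  L2inner (hatP b (hproj n w)) v = \sum_(i < n) hcoef w i * L2inner (hfun i) v.
Proof.
move=> Lv; rewrite (eq_ip (hproj_fun n w) (fun x => erefl (v x))).
rewrite ip_suml//; last by move=> i; exact/L2Z/L2_hfun.
by apply: eq_bigr => i _; rewrite ipZl//; exact: L2_hfun.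
Qed.

Lemma hres_orth_hfun n w i : L2 w -> (i < n)%N ->
  L2inner (fun x => w x - hatP b (hproj n w) x) (hfun i) = 0.
Proof.
move=> Lw ltin; have Li := L2_hfun i.
rewrite ipBl//; last exact: L2_hatP.
rewrite ip_hproj// (bigD1 (Ordinal ltin))//= big1 ?addr0 => [|j ji].
  by rewrite hfun_sqr /hcoef divfK ?subrr// gt_eqF// hnorm2_gt0.
by rewrite hfun_orth ?mulr0//; apply: contra ji => /eqP ji; apply/eqP/val_inj.
Qed.

Lemma orth_hfun_hatP n v p : L2 v -> (forall i, (i < n)%N -> L2inner v (hfun i) = 0) ->
  (size p <= n)%N -> L2inner v (hatP b p) = 0.
Proof.
move=> Lv; elim: n p => [|n IH] p Hv sp.
  move: sp; rewrite size_poly_leq0 => /eqP ->.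
  rewrite -[RHS](rint0 R); apply: eq_rint => x _.
  by rewrite /hatP horner0 !mulr0.
pose c := p`_n / lead_coef (hpoly n).
have lc0 : lead_coef (hpoly n) != 0 by rewrite lead_coef_eq0 -size_poly_eq0 size_hpoly.
have sq : (size (p - c *: hpoly n)%R <= n)%N.
  apply/leq_sizeP => j; rewrite leq_eqVlt => /predU1P[<-|nj].
    have -> : (p - c *: hpoly n)`_n = p`_n - c * lead_coef (hpoly n).
      by rewrite coefB coefZ lead_coefE size_hpoly.
    by rewrite /c divfK// subrr.
  by rewrite coefB coefZ !nth_default ?size_hpoly ?mulr0 ?subr0// (leq_trans sp).
have := IH _ (fun i ni => Hv i (ltnW ni)) sq.
rewrite (eq_ip (fun x => erefl (v x)) (hatPB p (c *: hpoly n))).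
rewrite ipBr//; [|exact: L2_hatP..].
rewrite (eq_ip (g1 := hatP b (c *: hpoly n)) (fun x => erefl (v x)) (hatPZ c (hpoly n))).
rewrite ipZr//; last exact: L2_hatP.
by rewrite -[hatP b (hpoly n)]/(hfun n) Hv// mulr0 subr0.
Qed.

Lemma hres_orth n w p : L2 w -> (size p <= n)%N ->
  L2inner (fun x => w x - hatP b (hproj n w) x) (hatP b p) = 0.
Proof.
move=> Lw sp; apply: (orth_hfun_hatP _ _ sp).
  by apply: L2B => //; exact: L2_hatP.
by move=> i ni; exact: hres_orth_hfun.
Qed.

Lemma hproj_best n w p : L2 w -> (size p <= n)%N ->
  L2norm (fun x => w x - hatP b (hproj n w) x) <= L2norm (fun x => w x - hatP b p x).
Proof.
move=> Lw sp; set r := fun x => w x - hatP b (hproj n w) x.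
have Lr : L2 r by apply: L2B => //; exact: L2_hatP.
have Lp := L2_hatP p b0.
have Lq : L2 (hatP b (hproj n w - p)) by exact: L2_hatP.
have sq : (size (hproj n w - p)%R <= n)%N.
  by rewrite (leq_trans (size_polyD _ _))// geq_max size_hproj size_polyN.
have E x : w x - hatP b p x = r x + hatP b (hproj n w - p) x by rewrite hatPB /r; ring.
rewrite (eq_L2norm E) !L2norm_sqrt ler_sqrt ?ip_ge0//.
rewrite (ipDl Lr Lq (L2D Lr Lq)) (ipDr Lr Lq Lr) (ipDr Lr Lq Lq).
rewrite hres_orth// (ipC _ r) hres_orth// addr0 add0r lerDl.
exact: ip_ge0.
Qed.

Lemma hres_sqr n w : L2 w -> L2norm (fun x => w x - hatP b (hproj n w) x) ^+ 2 =
  L2inner w w - \sum_(i < n) L2inner w (hfun i) ^+ 2 / hnorm2 i.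
Proof.
move=> Lw; set r := fun x => _; rewrite sqr_L2norm.
have Lp : L2 (hatP b (hproj n w)) by exact: L2_hatP.
have Lr : L2 r by exact: L2B.
have -> : L2inner r r = L2inner r w.
  by rewrite {2}/r ipBr// hres_orth ?size_hproj// subr0.
rewrite /r ipBl// ip_hproj//; congr (_ - _); apply: eq_bigr => i _.
by rewrite (ipC (hfun i)) /hcoef expr2; ring.
Qed.

(** The projection has no mode of index at least [n], so this is a coefficient of the residual. *)
Lemma hcoef_bound n w i : L2 w -> (n <= i)%N ->
  `|L2inner w (hfun i)| <= L2norm (fun x => w x - hatP b (hproj n w) x) * L2norm (hfun i).
Proof.
move=> Lw ni; have Lp : L2 (hatP b (hproj n w)) by exact: L2_hatP.
have Li := L2_hfun i.
have <- : L2inner (fun x => w x - hatP b (hproj n w) x) (hfun i) = L2inner w (hfun i).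
  rewrite ipBl// ip_hproj// big1 ?subr0// => j _.
  by rewrite hfun_orth ?mulr0// neq_ltn (leq_trans (ltn_ord j) ni).
by apply: ip_CS => //; exact: L2B.
Qed.

End hermite_projection.

(** * Tail of the Poisson law *)

Section exp_tail.
Variable R : realType.

(** Induction by integration: the difference of the two sides for $M+1$ has the difference for $M$
    as its derivative and is nonnegative at 0. *)
Lemma expR_taylor_tail (M : nat) (m : R) : 0 <= m ->
  expR m - \sum_(i < M) m ^+ i / i`!%:R <= 2 ^- M * expR (2 * m).
Proof.
elim: M m => [|M IH] m m0.
  by rewrite big_ord0 subr0 expr0 invr1 mul1r ler_expR; lra.
pose g (x : R) := 2 ^- M.+1 * expR (2 * x) - expR x + \sum_(i < M.+1) x ^+ i / i`!%:R.
have dS (x : R) (k : nat) : is_derive x 1 (fun x => \sum_(i < k.+1) x ^+ i / i`!%:R)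
    (\sum_(i < k) x ^+ i / i`!%:R).
  elim: k => [|k IHk].
    rewrite big_ord0 (_ : (fun x => _) = (fun=> 1)); first exact: der_cst.
    by apply/funext => y; rewrite big_ord1 expr0 fact0 divr1.
  rewrite (_ : (fun x => _) = (fun x => \sum_(i < k.+1) x ^+ i / i`!%:R + x ^+ k.+1 / k.+1`!%:R)); last first.
    by apply/funext => y; rewrite [LHS]big_ord_recr.
  rewrite big_ord_recr/=; apply: der_D => //.
  notypeclasses refine (der_eq (der_M (der_X k.+1 (der_id x)) (der_cst _ _)) _).
  rewrite /= mulr0 add0r mulr1 factS natrM; field.
  by rewrite pnatr_eq0 -lt0n fact_gt0/= nat1r pnatr_eq0.
have dg (x : R) : 0 <= x <= m -> is_derive x 1 g
    (2 ^- M * expR (2 * x) - (expR x - \sum_(i < M) x ^+ i / i`!%:R)).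
  move=> _; rewrite /g.
  notypeclasses refine (der_eq (der_D _ (dS x M)) _); first der_tac.
  by rewrite /= exprS; field; rewrite expf_neq0.
have := der_mono m0 dg.
have H (x : R) : 0 <= x <= m -> 0 <= 2 ^- M * expR (2 * x) - (expR x - \sum_(i < M) x ^+ i / i`!%:R).
  by move=> /andP[x0 _]; rewrite subr_ge0; exact: IH.
move=> /(_ H) K.
have g0 : 0 <= g 0.
  rewrite /g mulr0 expR0 mulr1 big_ord_recl expr0 fact0 divr1 big1 => [|i _].
    by rewrite addr0 subrK invr_ge0 exprn_ge0.
  by rewrite expr0n mul0r.
by have := le_trans g0 K; rewrite /g; lra.
Qed.

(** The Chernoff bound $P(X\ge M)\le2^{-M}E[2^X]$ for a Poisson variable of mean [m]. *)
Lemma poisson_tail (M : nat) (m : R) : 0 <= m ->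
  1 - expR (- m) * \sum_(i < M) m ^+ i / i`!%:R <= 2 ^- M * expR m.
Proof.
move=> m0; have := ler_wpM2l (expR_ge0 (- m)) (expR_taylor_tail M m0).
rewrite mulrBr -expRD addNr expR0 => /le_trans; apply.
rewrite mulrCA -expRD (_ : - m + 2 * m = m)//; ring.
Qed.

End exp_tail.

(** * Coherent states *)

Section coherent_states.
Variable R : realType.
Local Notation H := (@hermite R).
Implicit Types (b y k phi t x : R).

(* Real and imaginary part of [(y + i k)^n]. *)
Fixpoint cpow y k n : R * R := match n with
  | 0 => (1, 0)
  | m.+1 => let z := cpow y k m in (y * z.1 - k * z.2, y * z.2 + k * z.1)
  end.

Lemma cpow_sqr y k n : (cpow y k n).1 ^+ 2 + (cpow y k n).2 ^+ 2 = (y ^+ 2 + k ^+ 2) ^+ n.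
Proof.
elim: n => [|n IH]; first by rewrite /= expr1n expr0n addr0.
by rewrite [RHS]exprS -IH /=; move: (cpow y k n) => [a c] /=; ring.
Qed.

Let F n y k phi t :=
  expR (- (t - y) ^+ 2 / 2) * cos (k * (t - y) + phi) * (expR (- t ^+ 2 / 2) * (H n).[t]).

Let dF n y k phi t : is_derive t 1 (F n y k phi)
  (y * F n y k phi t - k * F n y k (phi - pi / 2) t - F n.+1 y k phi t).
Proof.
rewrite /F hermiteS addrA cosBpihalf; move: (H n) => p.
by der_solve ltac:(rewrite !(horner_nat, hornerM, hornerX, hornerN, hornerD); field).
Qed.

Let cF n y k phi : continuous (F n y k phi).
Proof. exact: der_cont_all (dF n y k phi). Qed.

Let gF n y k phi : gdom (F n y k phi).
Proof.
have := gdom_bounded (gdom_horner (H n) (gdom_gauss y (- (y ^+ 2 / 2)) ltr01))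
  (fun t => abs_cos_le1 (k * (t - y) + phi)).
congr gdom; apply/funext => t; rewrite /F.
rewrite [RHS](_ : _ = (expR (- (t - y) ^+ 2 / 2) * expR (- t ^+ 2 / 2)) * (H n).[t] * cos (k * (t - y) + phi)); last by ring.
by rewrite -expRD; congr (expR _ * _ * _); field.
Qed.

Let IF n y k phi : Lint (F n y k phi).
Proof. exact: gdom_Lint (cont_meas (@cF n y k phi)) (@gF n y k phi). Qed.

(** $e^{-t^2/2}H_{n+1}$ is the image of $e^{-t^2/2}H_n$ under $t-d/dt$. The adjoint $t+d/dt$ has the
    complex coherent state as eigenvector with eigenvalue $y+ik$; on the real part the factor $i$
    becomes the phase shift by $-\pi/2$. *)
Let rintFS n y k phi : rint setT (F n.+1 y k phi) =
  y * rint setT (F n y k phi) - k * rint setT (F n y k (phi - pi / 2)).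
Proof.
apply/esym/eqP; rewrite -subr_eq0 -!rintZ// -rintB; [|exact: LintZ..].
rewrite -rintB//; last by apply: LintB; exact: LintZ.
apply/eqP/(rint_deriv0_gdom (dF n y k phi)) => //.
- by move=> t; apply: cvgB; [apply: cvgB; apply: cvgMr; exact: cF|exact: cF].
- have := gdomD (gdomD (gdomZ y (gF n y k phi)) (gdomZ (- k) (gF n y k (phi - pi / 2)))) (gdomZ (-1) (gF n.+1 y k phi)).
  by congr gdom; apply/funext => t; ring.
Qed.

Let rintF0 y k phi : rint setT (F 0 y k phi) =
  Num.sqrt pi * expR (- ((y ^+ 2 + k ^+ 2) / 4)) * cos (phi - k * y / 2).
Proof.
rewrite (@rint_affine _ _ 1 (y / 2) ltr01)// mul1r.
have E t : F 0 y k phi (1 * t + y / 2) =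
    expR (- (y ^+ 2 / 4)) * (expR (- t ^+ 2) * cos (k * t + (phi - k * y / 2))).
  rewrite /F /= hornerC mulr1 mulrA -expRD.
  by rewrite [LHS]mulrAC -expRD; congr (expR _ * cos _); field.
rewrite (eq_rint (fun t _ => E t)) rintZ; last exact: Lint_gauss_cos.
rewrite gauss_cos_transform (_ : - ((y ^+ 2 + k ^+ 2) / 4) = - (y ^+ 2 / 4) + - (k ^+ 2 / 4)); last by field.
by rewrite expRD; ring.
Qed.

Let rintF n y k phi : rint setT (F n y k phi) =
  Num.sqrt pi * expR (- ((y ^+ 2 + k ^+ 2) / 4)) *
  ((cpow y k n).1 * cos (phi - k * y / 2) - (cpow y k n).2 * sin (phi - k * y / 2)).
Proof.
elim: n phi => [|n IH] phi; first by rewrite rintF0 /= mul1r mul0r subr0.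
rewrite rintFS !IH (_ : phi - pi / 2 - k * y / 2 = phi - k * y / 2 - pi / 2); last by ring.
rewrite cosBpihalf sinBpihalf /=.
by move: (cpow y k n) => [a c] /=; ring.
Qed.

(** Real form of the Gaussian wave packet at position [y] and frequency [k]; the phases [phi] and
    [phi - pi / 2] together carry the complex state. *)
Definition coherent b y k phi x := expR (- (b ^+ 2 * (x - y) ^+ 2) / 2) * cos (k * (x - y) + phi).

Lemma cont_coherent b y k phi : continuous (coherent b y k phi).
Proof.
apply: (@der_cont_all _ _ (fun x => expR (- (b ^+ 2 * (x - y) ^+ 2) / 2) * (- (b ^+ 2 * (x - y))) *
  cos (k * (x - y) + phi) - expR (- (b ^+ 2 * (x - y) ^+ 2) / 2) * k * sin (k * (x - y) + phi))) => x.
by rewrite /coherent; der_solve ltac:(by field).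
Qed.

Lemma L2_coherent b y k phi : 0 < b -> L2 (coherent b y k phi).
Proof.
move=> b0; apply: gdom_L2; first by apply: cont_meas; exact: cont_coherent.
have a0 : 0 < b ^+ 2 / 2 by rewrite divr_gt0// exprn_gt0.
have := gdom_bounded (gdom_gauss (b ^+ 2 * y) (- (b ^+ 2 * y ^+ 2 / 2)) a0)
  (fun t => abs_cos_le1 (k * (t - y) + phi)).
by congr gdom; apply/funext => t; rewrite /coherent; congr (expR _ * _); field.
Qed.

Lemma coherent_hfun b y k phi n : 0 < b ->
  L2inner (coherent b y k phi) (hfun b n) = b^-1 *
  (Num.sqrt pi * expR (- (((b * y) ^+ 2 + (k / b) ^+ 2) / 4)) *
  ((cpow (b * y) (k / b) n).1 * cos (phi - k * y / 2) - (cpow (b * y) (k / b) n).2 * sin (phi - k * y / 2))).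
Proof.
move=> b0; have bn0 : b != 0 by rewrite gt_eqF.
have -> : k * y / 2 = (k / b) * (b * y) / 2 by field.
rewrite -rintF [in RHS](@rint_affine _ _ b 0 b0)// mulrA mulVf// mul1r.
apply: eq_rint => x _; rewrite /F /coherent hfunE addr0 -mulrBr !exprMn.
by rewrite (_ : k / b * (b * (x - y)) = k * (x - y))//; field.
Qed.

Lemma coherent_norm b y k phi : 0 < b ->
  L2inner (coherent b y k phi) (coherent b y k phi) +
  L2inner (coherent b y k (phi - pi / 2)) (coherent b y k (phi - pi / 2)) = Num.sqrt pi / b.
Proof.
move=> b0; rewrite /L2inner -rintD; [|by apply: L2M_Lint; exact: L2_coherent..].
have [_ <-] := rint_gauss_shift y b0.
apply: eq_rint => x _; rewrite /coherent addrA cosBpihalf.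
rewrite (_ : expR (- (b ^+ 2 * (x - y) ^+ 2)) = expR (- (b ^+ 2 * (x - y) ^+ 2) / 2) ^+ 2); last first.
  by rewrite [RHS]expr2 -expRD; congr expR; field.
by rewrite -[RHS]mulr1 -(cos2Dsin2 (k * (x - y) + phi)); ring.
Qed.

(* The coefficients of a coherent state on the Hermite functions are Poisson distributed. *)
Lemma coherent_proj_error b y k phi M : 0 < b ->
  L2norm (fun x => coherent b y k phi x - hatP b (hproj b M (coherent b y k phi)) x) ^+ 2
  <= Num.sqrt pi / b * (2 ^- M * expR (((b * y) ^+ 2 + (k / b) ^+ 2) / 2)).
Proof.
move=> b0; have bn0 : b != 0 by rewrite gt_eqF.
have sp0 : 0 < Num.sqrt (pi : R) by rewrite sqrtr_gt0 pi_gt0.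
have L1 := L2_coherent y k phi b0; have L2' := L2_coherent y k (phi - pi / 2) b0.
rewrite [leLHS](hres_sqr b0 M L1).
(* Only the two phases together have exactly Poisson coefficients, so the errors of both are added
   and that of the shifted state, being nonnegative, is dropped. *)
have := sqr_ge0 (L2norm (fun x => coherent b y k (phi - pi / 2) x
  - hatP b (hproj b M (coherent b y k (phi - pi / 2))) x)).
rewrite [X in (0 <= X) -> _](hres_sqr b0 M L2').
have := coherent_norm y k phi b0.
set s := ((b * y) ^+ 2 + (k / b) ^+ 2).
have s0 : 0 <= s / 2 by rewrite divr_ge0// addr_ge0// sqr_ge0.
have := ler_wpM2l (ltW (divr_gt0 sp0 b0)) (poisson_tail M s0).
have -> : Num.sqrt pi / b * (1 - expR (- (s / 2)) * \sum_(i < M) (s / 2) ^+ i / i`!%:R) =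
  Num.sqrt pi / b - (\sum_(i < M) L2inner (coherent b y k phi) (hfun b i) ^+ 2 / hnorm2 b i +
   \sum_(i < M) L2inner (coherent b y k (phi - pi / 2)) (hfun b i) ^+ 2 / hnorm2 b i).
  rewrite mulrBr mulr1; congr (_ - _); rewrite -big_split/= !mulr_sumr.
  apply: eq_bigr => i _; rewrite !coherent_hfun//.
  rewrite (_ : phi - pi / 2 - k * y / 2 = phi - k * y / 2 - pi / 2); last by ring.
  rewrite cosBpihalf sinBpihalf.
  have e4 : expR (- (s / 2)) = expR (- (s / 4)) ^+ 2 by rewrite expr2 -expRD; congr expR; field.
  have := cpow_sqr (b * y) (k / b) i; rewrite -/s exprMn e4 => <-.
  have := cos2Dsin2 (phi - k * y / 2).
  move: (cpow (b * y) (k / b) i) => [z1 z2] /=.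
  rewrite /hnorm2 /hsq.
  have i0 : i`!%:R != 0 :> R by rewrite pnatr_eq0 -lt0n fact_gt0.
  have t0 : (2 : R) ^+ i != 0 by rewrite expf_neq0.
  move: (cos _) (sin _) (expR _) => c s' e cs.
  rewrite -[LHS]mulr1 -[X in _ * X = _]cs exprVn.
  move: (2 ^+ i) (i`!%:R) i0 t0 => t f i0 t0.
  by field; rewrite bn0 i0 t0 gt_eqF.
move: (\sum_(i < M) _) (\sum_(i < M) _) (L2inner _ _) (L2inner _ _) (Num.sqrt pi / b * _) => *; lra.
Qed.

End coherent_states.

(** * Frequency tails *)

Section fourier_tail.
Variable R : realType.
Local Notation mu := (@lebesgue_measure R).
Implicit Types (w v : R -> R) (k x : R).

Definition trunc w (r : R) x := w x * \1_(`[- r, r]%classic) x.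

Lemma L2_trunc w r : L2 w -> L2 (trunc w r).
Proof. by move=> Lw; exact: L2_indic. Qed.

Lemma Lint_trunc w r : L2 w -> Lint (trunc w r).
Proof. by move=> Lw; exact: L2_Lint_itv. Qed.

Lemma trunc_in w r x : `|x| <= r -> trunc w r x = w x.
Proof.
rewrite ler_norml => xr.
by rewrite /trunc indicE mem_set ?mulr1//= in_itv.
Qed.

Lemma trunc_out w r x : r < `|x| -> trunc w r x = 0.
Proof.
move=> rx; rewrite /trunc indicE memNset ?mulr0//= in_itv/= -ler_norml.
by rewrite leNgt rx.
Qed.

Definition outside (K : R) : set R := [set k | K < `|k|].

Lemma measurable_outside K : measurable (outside K).
Proof.
apply: open_measurable; rewrite (_ : outside K = (fun k : R => `|k|) @^-1` [set y | K < y])//.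
by apply: open_comp; [move=> x _; exact: norm_continuous|exact: open_gt].
Qed.

Lemma truncB w r x : w x - trunc w r x = w x * \1_(outside r) x.
Proof.
have [xr|xr] := leP `|x| r.
  rewrite trunc_in// subrr indicE memNset ?mulr0//= /outside/=.
  by apply/negP; rewrite -leNgt.
by rewrite trunc_out// subr0 indicE mem_set ?mulr1.
Qed.

Lemma L2norm_distC w v : L2norm (fun x => w x - v x) = L2norm (fun x => v x - w x).
Proof. by congr Num.sqrt; apply: eq_rint => x _; rewrite -sqrrN opprB. Qed.

Lemma ler_sqrD (a c : R) : a ^+ 2 <= a ^+ 2 + c ^+ 2 /\ c ^+ 2 <= a ^+ 2 + c ^+ 2.
Proof. by rewrite lerDl lerDr !sqr_ge0. Qed.

Lemma Ctr_Str_norm w : Lint w -> L2 w -> [/\ L2 (Ctr w), L2 (Str w) &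
  L2norm (Ctr w) ^+ 2 + L2norm (Str w) ^+ 2 = 2 * pi * L2norm w ^+ 2].
Proof.
move=> Iw Lw; have [_ LC LS _] := spec_CS Iw Lw Iw Lw; split => //.
rewrite [X in X + _]sqr_L2norm [X in _ + X]sqr_L2norm [X in _ * X]sqr_L2norm.
rewrite -(plancherel Iw Lw Iw Lw) /spec.
by rewrite (rintD (L2M_Lint LC LC) (L2M_Lint LS LS)).
Qed.

Lemma Ctr_Str_le w : Lint w -> L2 w ->
  L2norm (Ctr w) <= Num.sqrt (2 * pi) * L2norm w /\
  L2norm (Str w) <= Num.sqrt (2 * pi) * L2norm w.
Proof.
move=> Iw Lw; have [LC LS E] := Ctr_Str_norm Iw Lw.
have p0 : 0 <= 2 * pi :> R by rewrite mulr_ge0// pi_ge0.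
split; apply: ler_sqr_pos; rewrite ?mulr_ge0 ?sqrtr_ge0 ?L2norm_ge0//;
  rewrite exprMn (sqr_sqrtr p0) -E; [exact: (ler_sqrD _ _).1|exact: (ler_sqrD _ _).2].
Qed.

(** The boolean selects the cosine or the sine transform, so that each estimate is proved once. *)
Definition tailtr (s : bool) (K : R) w k := (if s then Ctr w k else Str w k) * \1_(outside K) k.

Lemma L2_tailtr s K w : Lint w -> L2 w -> L2 (tailtr s K w).
Proof.
move=> Iw Lw; have [LC LS _] := Ctr_Str_norm Iw Lw.
by case: s; apply: L2_indic => //; exact: measurable_outside.
Qed.

Lemma tailtr_bound s K w : Lint w -> L2 w ->
  L2norm (tailtr s K w) <= Num.sqrt (2 * pi) * L2norm w.
Proof.
move=> Iw Lw; have [LC LS E] := Ctr_Str_norm Iw Lw.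
have H : L2norm (tailtr s K w) <= L2norm (if s then Ctr w else Str w).
  apply: L2norm_le; [exact: L2_tailtr|by case: s|] => k.
  have /andP[i0 i1] := indic01 (outside K) k.
  by rewrite /tailtr normrM (ger0_norm i0); case: s; rewrite ler_piMr.
by apply: (le_trans H); have [C S] := Ctr_Str_le Iw Lw; case: s {H}.
Qed.

Lemma tailtr_dist s K w v : Lint w -> L2 w -> Lint v -> L2 v ->
  L2norm (tailtr s K w) <= L2norm (tailtr s K v) + Num.sqrt (2 * pi) * L2norm (fun x => w x - v x).
Proof.
move=> Iw Lw Iv Lv; have Iu := LintB Iw Iv; have Lu := L2B Lw Lv.
have E k : tailtr s K w k = tailtr s K v k + tailtr s K (fun x => w x - v x) k.
  by rewrite /tailtr -mulrDl; case: s; rewrite ?CtrB ?StrB//; congr (_ * _); ring.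
apply: (le_trans (L2norm_triangle (L2_tailtr s K Iv Lv) (L2_tailtr s K Iu Lu) E)).
by rewrite lerD2l; exact: tailtr_bound.
Qed.

Lemma fourier_trunc_tail w K (r : R) : L2 w ->
  rint (outside K) (fourier_trunc_sq w r) =
  (L2norm (tailtr true K (trunc w r)) ^+ 2 + L2norm (tailtr false K (trunc w r)) ^+ 2) / (2 * pi).
Proof.
move=> Lw; have It := Lint_trunc r Lw; have Lt := L2_trunc r Lw.
have L1 := L2_tailtr true K It Lt; have L2' := L2_tailtr false K It Lt.
rewrite (rint_indic _ (outside K)) [X in X + _]sqr_L2norm [X in _ + X]sqr_L2norm /L2inner.
have [I1 I2] := (L2M_Lint L1 L1, L2M_Lint L2' L2').
rewrite -(rintD I1 I2) mulrC -(rintZ _ (LintD I1 I2)).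
apply: eq_rint => k _; rewrite /fourier_trunc_sq /tailtr.
have -> : rint `[- r, r]%classic (fun x => w x * cos (k * x)) = Ctr (trunc w r) k.
  by rewrite rint_indic; apply: eq_rint => x _; rewrite mulrAC.
have -> : rint `[- r, r]%classic (fun x => w x * sin (k * x)) = Str (trunc w r) k.
  by rewrite rint_indic; apply: eq_rint => x _; rewrite mulrAC.
have : \1_(outside K) k ^+ 2 = \1_(outside K) k :> R.
  by rewrite indicTE; case: ifP; rewrite ?expr1n ?expr0n.
move: (\1_(outside K) k : R) (Ctr _ _) (Str _ _) => i a c ii.
by rewrite -[in LHS]ii; ring.
Qed.

Lemma trunc_cvg w : L2 w -> L2norm (fun x => w x - trunc w n%:R x) @[n --> \oo] --> 0.
Proof.
move=> Lw.
have [|||||_ E2] := @rint_dominated R (fun n x => (w x - trunc w n%:R x) ^+ 2) (fun=> 0) (fun x => w x ^+ 2).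
- move=> n; apply: measurable_funX; apply: L2_meas; apply: L2B => //; exact: L2_trunc.
- by [].
- exact: L2_Lint.
- apply: aeW => x; apply: cvg_near_cst; near=> n.
  rewrite trunc_in ?subrr ?expr0n//.
  by near: n; exact: nbhs_infty_ger.
- move=> n x; rewrite truncB normrX -(real_normK (num_real (w x))) lerXn2r ?nnegrE//.
  have /andP[i0 i1] := indic01 (outside n%:R) x.
  by rewrite normrM (ger0_norm i0) ler_piMr.
rewrite rint0 in E2.
rewrite -(sqrtr0 R); exact: (cvg_comp _ _ E2 (@sqrt_continuous R 0)).
Unshelve. all: by end_near. Qed.

Lemma trunc_dist w (m n : R) : L2 w -> m <= n ->
  L2norm (fun x => trunc w n x - trunc w m x) <= L2norm (fun x => w x - trunc w m x).
Proof.
move=> Lw mn; have Lm := L2_trunc m Lw; have Ln := L2_trunc n Lw.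
apply: L2norm_le; [exact: L2B..|] => x.
have [xn|xn] := leP `|x| n; first by rewrite (trunc_in w xn).
rewrite !trunc_out//; first by rewrite subrr normr0.
exact: le_lt_trans xn.
Qed.

(** The norms form a Cauchy sequence by [tailtr_dist]. Convergence gives the [limn] in
    [fourier_tail_norm] its meaning. *)
Lemma tailtr_cvg s K w : L2 w -> cvgn (fun n => L2norm (tailtr s K (trunc w n%:R))).
Proof.
move=> Lw; apply/cauchy_cvgP/cauchy_exP => e e0.
have p0 : 0 < Num.sqrt (2 * pi) :> R by rewrite sqrtr_gt0 mulr_gt0// pi_gt0.
have /cvgr0Pnorm_lt/(_ (e / Num.sqrt (2 * pi))) := trunc_cvg Lw.
rewrite divr_gt0// => /(_ isT) [m _ Hm].
exists (L2norm (tailtr s K (trunc w m%:R))); exists m => // n /= mn.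
rewrite /ball/=.
have mn' : m%:R <= n%:R :> R by rewrite ler_nat.
have := Hm m (leqnn m); rewrite /= ger0_norm ?L2norm_ge0// ltr_pdivlMr// mulrC.
apply: le_lt_trans.
have [In Ln] := (Lint_trunc n%:R Lw, L2_trunc n%:R Lw).
have [Im Lm] := (Lint_trunc m%:R Lw, L2_trunc m%:R Lw).
have d1 := tailtr_dist s K In Ln Im Lm; have d2 := tailtr_dist s K Im Lm In Ln.
have d := ler_wpM2l (ltW p0) (trunc_dist Lw mn').
have e1 : L2norm (fun x => trunc w m%:R x - trunc w n%:R x) = L2norm (fun x => trunc w n%:R x - trunc w m%:R x).
  exact: L2norm_distC.
rewrite e1 in d2.
move: d1 d2 d; move: (L2norm _) (L2norm _) (Num.sqrt _ * _) (Num.sqrt _ * _) => a c f g d1 d2 d.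
by rewrite ler_norml; apply/andP; split; lra.
Qed.

(** Compare with the truncation at some $n\ge r$, which differs from that at [r] by at most the part
    of [w] outside $[-r,r]$, and let [n] tend to infinity. *)
Lemma tailtr_le_tail_norm s K w (r : R) : L2 w ->
  L2norm (tailtr s K (trunc w r)) <=
  Num.sqrt (2 * pi) * (fourier_tail_norm w K + L2norm (fun x => w x * \1_(outside r) x)).
Proof.
move=> Lw; have p0 : 0 < 2 * pi :> R by rewrite mulr_gt0// pi_gt0.
have s0 : 0 < Num.sqrt (2 * pi) :> R by rewrite sqrtr_gt0.
pose a n := rint (outside K) (fourier_trunc_sq w n%:R).
have ac : cvgn a.
  rewrite /a; under eq_fun do rewrite fourier_trunc_tail//.
  have [c1 c2] := (@tailtr_cvg true K w Lw, @tailtr_cvg false K w Lw).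
  apply: (@cvgP _ _ ((_ ^+ 2 + _ ^+ 2) / (2 * pi))).
  by apply: cvgMl; apply: cvgD; [exact: (cvg_comp _ _ c1 (@exprn_continuous R 2 _))|exact: (cvg_comp _ _ c2 (@exprn_continuous R 2 _))].
have sa : Num.sqrt (a n) @[n --> \oo] --> fourier_tail_norm w K.
  exact: (cvg_comp _ _ ac (@sqrt_continuous R (limn a))).
have sb : Num.sqrt (2 * pi) * (Num.sqrt (a n) + L2norm (fun x => w x * \1_(outside r) x)) @[n --> \oo] -->
   Num.sqrt (2 * pi) * (fourier_tail_norm w K + L2norm (fun x => w x * \1_(outside r) x)).
  by apply: cvgMr; apply: cvgD => //; exact: cvg_cst.
apply: (ler_cvg_to (cvg_cst (L2norm (tailtr s K (trunc w r)))) sb).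
near=> n.
have nr : r <= n%:R by near: n; exact: nbhs_infty_ger.
apply: (le_trans (tailtr_dist s K (Lint_trunc r Lw) (L2_trunc r Lw) (Lint_trunc n%:R Lw) (L2_trunc n%:R Lw))).
rewrite [leRHS]mulrDr; apply: lerD.
  apply: ler_sqr_pos; rewrite ?mulr_ge0 ?sqrtr_ge0 ?L2norm_ge0//.
  have a0 : 0 <= a n.
    by rewrite /a fourier_trunc_tail// divr_ge0 ?(ltW p0)// addr_ge0// sqr_ge0.
  rewrite exprMn (sqr_sqrtr (ltW p0)) (sqr_sqrtr a0) /a fourier_trunc_tail//.
  rewrite mulrCA mulfV ?gt_eqF// mulr1.
  case: s => /=; [exact: (ler_sqrD _ _).1|exact: (ler_sqrD _ _).2].
rewrite ler_pM2l// -(eq_L2norm (truncB w r)).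
have := trunc_dist Lw nr; apply: le_trans.
by rewrite (L2norm_distC (trunc w r)).
Unshelve. all: by end_near. Qed.

End fourier_tail.

(** * Projection error *)

Section high_frequency.
Variable R : realType.
Implicit Types (w v r : R -> R) (b c k x y K X : R).

Lemma rint_absM_le f g : L2 f -> L2 g ->
  rint setT (fun x : R => `|f x * g x|) <= L2norm f * L2norm g.
Proof.
move=> Lf Lg.
have La h : L2 h -> L2 (fun x : R => `|h x|) /\ L2norm (fun x : R => `|h x|) = L2norm h.
  move=> Lh; split.
    by apply: (L2_bound _ Lh) => [|x]; [apply: measurableT_comp => //; exact: L2_meas|rewrite normr_id].
  by congr Num.sqrt; apply: eq_rint => x _; rewrite real_normK ?num_real.
have [[Laf <-] [Lag <-]] := (La f Lf, La g Lg).
apply: le_trans (ip_CS Laf Lag); apply: ler_eqW.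
rewrite ger0_norm; first by apply: eq_rint => x _; rewrite normrM.
by apply: rint_ge0 => x _; rewrite mulr_ge0.
Qed.

(** [chi] is a high-pass weight: beyond [K] it is at most 1 and the frequency tails of [w] pay,
    while below [K] the factor [e] makes a crude bound sufficient. *)
Lemma weighted_spec_bound w r K e (chi : R -> R) :
  Lint w -> L2 w -> Lint r -> L2 r -> measurable_fun setT chi ->
  (forall k, 0 <= chi k <= 1) -> 0 <= e -> (forall k, `|k| <= K -> chi k <= e) ->
  `|rint setT (fun k => chi k * spec w r k)| <=
  Num.sqrt (2 * pi) * L2norm r * (L2norm (tailtr true K w) + L2norm (tailtr false K w))
  + e * (4 * pi * (L2norm w * L2norm r)).
Proof.
move=> Iw Lw Ir Lr mchi chi01 e0 chie.
have [LC LS _] := Ctr_Str_norm Iw Lw; have [LCr LSr _] := Ctr_Str_norm Ir Lr.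
have [LT1 LT2] := (L2_tailtr true K Iw Lw, L2_tailtr false K Iw Lw).
have [C1 S1] := Ctr_Str_le Iw Lw; have [C2 S2] := Ctr_Str_le Ir Lr.
have J1 := Lint_abs (L2M_Lint LT1 LCr); have J2 := Lint_abs (L2M_Lint LT2 LSr).
have J3 := Lint_abs (L2M_Lint LC LCr); have J4 := Lint_abs (L2M_Lint LS LSr).
have J12 := LintD J1 J2; have J34 := LintZ e (LintD J3 J4).
have [Is _ _ _] := spec_CS Iw Lw Ir Lr.
have Ichi : Lint (fun k => chi k * spec w r k).
  apply: (Lint_bound _ (Lint_abs Is)).
    by apply: measurable_funM => //; exact: Lint_meas.
  move=> k; have /andP[h0 h1] := chi01 k.
  by rewrite normrM (ger0_norm h0) ler_piMl.
have B k : `|chi k * spec w r k| <=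
    (`|tailtr true K w k * Ctr r k| + `|tailtr false K w k * Str r k|) +
    e * (`|Ctr w k * Ctr r k| + `|Str w k * Str r k|).
  have /andP[h0 h1] := chi01 k; rewrite normrM (ger0_norm h0) /tailtr /spec.
  have := ler_normD (Ctr w k * Ctr r k) (Str w k * Str r k).
  have [kK|kK] := leP `|k| K.
    have := chie k kK => h2 h3.
    apply: (le_trans (ler_wpM2l h0 h3)); apply: ler_wpDl; first exact: addr_ge0.
    by apply: ler_wpM2r => //; exact: addr_ge0.
  rewrite indicE mem_set//= !mulr1 => h3.
  apply: ler_wpDr; first by apply: mulr_ge0 => //; exact: addr_ge0.
  by apply: (le_trans _ h3); rewrite ler_piMl.
apply: (le_trans (rint_abs_le Ichi (LintD J12 J34) B)).
rewrite (rintD J12 J34) (rintD J1 J2) (rintZ _ (LintD J3 J4)) (rintD J3 J4).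
have B1 := le_trans (rint_absM_le LT1 LCr) (ler_wpM2l (L2norm_ge0 _) C2).
have B2 := le_trans (rint_absM_le LT2 LSr) (ler_wpM2l (L2norm_ge0 _) S2).
have B3 := le_trans (rint_absM_le LC LCr) (ler_pM (L2norm_ge0 _) (L2norm_ge0 _) C1 C2).
have B4 := le_trans (rint_absM_le LS LSr) (ler_pM (L2norm_ge0 _) (L2norm_ge0 _) S1 S2).
apply: lerD.
  apply: (le_trans (lerD B1 B2)); apply: ler_eqW.
  by move: (L2norm _) (L2norm _) (L2norm _) (Num.sqrt _) => a1 a2 a3 a4; ring.
apply: ler_wpM2l => //; apply: (le_trans (lerD B3 B4)).
apply: ler_eqW.
have p0 : 0 <= 2 * pi :> R by rewrite mulr_ge0// pi_ge0.
have := sqr_sqrtr p0.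
move: (L2norm _) (L2norm _) (Num.sqrt _) => a1 a2 s s2.
have -> : 4 * pi = 2 * (2 * pi) :> R by ring.
by rewrite -s2; ring.
Qed.

(** The share, at frequency [k], of the normalised Gaussian windows whose centres lie outside
    $[-2K,2K]$: what the average over the other centres misses. *)
Definition gtail c K k :=
  c / Num.sqrt pi * rint setT (fun k0 => expR (- (c ^+ 2 * (k - k0) ^+ 2)) * \1_(outside (2 * K)) k0).

Let gauss_sym c k : (fun k0 => expR (- (c ^+ 2 * (k - k0) ^+ 2))) = (fun k0 => expR (- (c ^+ 2 * (k0 - k) ^+ 2))).
Proof. by apply/funext => x; rewrite -[X in - (_ * X)]sqrrN opprB. Qed.

Lemma gtail01 c K k : 0 < c -> 0 <= gtail c K k <= 1.
Proof.
move=> c0; have sp : 0 < Num.sqrt (pi : R) by rewrite sqrtr_gt0 pi_gt0.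
have [I E] := rint_gauss_shift k c0; rewrite -gauss_sym in I E.
have i01 x := indic01 (outside (2 * K)) x.
have cs := divr_gt0 c0 sp.
apply/andP; split.
  apply: mulr_ge0; first exact: ltW.
  by apply: rint_ge0 => x _; rewrite mulr_ge0 ?expR_ge0//; case/andP: (i01 x).
have -> : 1 = c / Num.sqrt pi * (Num.sqrt pi / c) :> R by field; rewrite !gt_eqF.
rewrite ler_pM2l// -E; apply: rint_le => //.
  by apply: Lint_indic => //; exact: measurable_outside.
by move=> x; rewrite ler_piMr ?expR_ge0//; case/andP: (i01 x).
Qed.

(** For a centre $x>2K$ one has $x\ge k+K$, hence $(x-k)^2\ge K^2+(x-k-K)^2$, and likewise on the
    left. Each side then costs $e^{-c^2K^2}$ times one full Gaussian. *)
Lemma gtail_inside c K k : 0 < c -> 0 <= K -> `|k| <= K ->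
  gtail c K k <= 2 * expR (- (c ^+ 2 * K ^+ 2)).
Proof.
move=> c0 K0; rewrite ler_norml => /andP[k1 k2].
have sp : 0 < Num.sqrt (pi : R) by rewrite sqrtr_gt0 pi_gt0.
have [I1 E1] := rint_gauss_shift (k + K) c0.
have [I2 E2] := rint_gauss_shift (k - K) c0.
have [I _] := rint_gauss_shift k c0; rewrite -gauss_sym in I.
have cs := divr_gt0 c0 sp.
have -> : 2 * expR (- (c ^+ 2 * K ^+ 2)) = c / Num.sqrt pi * (expR (- (c ^+ 2 * K ^+ 2)) *
    (rint setT (fun k0 => expR (- (c ^+ 2 * (k0 - (k + K)) ^+ 2))) +
     rint setT (fun k0 => expR (- (c ^+ 2 * (k0 - (k - K)) ^+ 2))))).
  by rewrite E1 E2; field; rewrite !gt_eqF.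
rewrite ler_pM2l// -rintD// -rintZ; last exact: LintD.
apply: rint_le; [by apply: Lint_indic => //; exact: measurable_outside|exact/LintZ/LintD|].
move=> x; rewrite indicTE; case: asboolP => /= xK; last first.
  by rewrite mulr0 mulr_ge0 ?expR_ge0// addr_ge0 ?expR_ge0.
rewrite mulr1 mulrDr -!expRD.
have c2 : 0 <= c ^+ 2 := sqr_ge0 c.
move: xK; rewrite /outside/= ltNge ler_norml negb_and -!ltNge => /orP[xK|xK].
  apply: ler_wpDl; first exact: expR_ge0.
  rewrite ler_expR -opprD lerN2 -mulrDr ler_wpM2l//.
  rewrite -subr_ge0 (_ : _ - _ = 2 * K * (k - K - x)); last by ring.
  by rewrite mulr_ge0//; lra.
apply: ler_wpDr; first exact: expR_ge0.
rewrite ler_expR -opprD lerN2 -mulrDr ler_wpM2l//.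
rewrite -subr_ge0 (_ : _ - _ = 2 * K * (x - k - K)); last by ring.
by rewrite mulr_ge0//; lra.
Qed.

Let meas2_gauss c : meas2 (fun k k0 => expR (- (c ^+ 2 * (k - k0) ^+ 2))).
Proof.
apply: (@meas2_comp R (fun t => expR (- (c ^+ 2 * t ^+ 2))) (fun k k0 => k - k0)); last by apply: meas2B; [exact: meas2_id_fst|exact: meas2_id_snd].
apply: (@der_cont_all _ _ (fun t => expR (- (c ^+ 2 * t ^+ 2)) * - (c ^+ 2 * (2 * t)))) => t.
by der_solve ltac:(ring).
Qed.

Let in_out K k : \1_(`[- (2 * K), 2 * K]%classic) k = 1 - \1_(outside (2 * K)) k :> R.
Proof.
have := truncB (fun=> 1) (2 * K) k; rewrite /trunc !mul1r.
by move=> <-; ring.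
Qed.

Let inside K := (\1_(`[- (2 * K), 2 * K]%classic) : R -> R).

Let inside01 K k : 0 <= inside K k <= 1. Proof. exact: indic01. Qed.

Let Lint_inside K : Lint (inside K).
Proof. exact: (integrable_indic_itv (- (2 * K)) (2 * K) true false). Qed.

Let gauss_le1 c k k0 : expR (- (c ^+ 2 * (k - k0) ^+ 2)) <= 1.
Proof. by rewrite -expR0 ler_expR oppr_le0 mulr_ge0 ?sqr_ge0. Qed.

Let gauss_inside c K k k0 := expR (- (c ^+ 2 * (k - k0) ^+ 2)) * inside K k0.

Let gauss_inside_ge0 c K k k0 : 0 <= gauss_inside c K k k0.
Proof. by rewrite mulr_ge0 ?expR_ge0//; case/andP: (inside01 K k0). Qed.

Let gauss_inside_le c K k k0 : gauss_inside c K k k0 <= inside K k0.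
Proof. by rewrite ler_piMl//; case/andP: (inside01 K k0). Qed.

Let gauss_inside_norm c K k k0 : `|gauss_inside c K k k0| <= inside K k0.
Proof. by rewrite ger0_norm. Qed.

Let meas2_gauss_inside c K : meas2 (gauss_inside c K).
Proof. by apply: (meas2M (meas2_gauss c)); apply: meas2_snd; exact: Lint_meas (Lint_inside K). Qed.

Let Lint_gauss_inside c K k : Lint (gauss_inside c K k).
Proof.
exact: (Lint_bound (meas2_section k (meas2_gauss_inside c K)) (Lint_inside K)).
Qed.

Lemma gtail_compl c K k : 0 < c ->
  c / Num.sqrt pi * rint setT (gauss_inside c K k) = 1 - gtail c K k.
Proof.
move=> c0; have sp : 0 < Num.sqrt (pi : R) by rewrite sqrtr_gt0 pi_gt0.
have [J E] := rint_gauss_shift k c0; rewrite -gauss_sym in J E.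
have e1 : 1 = c / Num.sqrt pi * rint setT (fun k0 => expR (- (c ^+ 2 * (k - k0) ^+ 2))).
  by rewrite E; field; rewrite !gt_eqF.
rewrite [X in X - _]e1 /gtail -mulrBr -(rintB J (Lint_indic (measurable_outside _) J)).
by congr (_ * _); apply: eq_rint => x _; rewrite /gauss_inside /inside in_out; ring.
Qed.

Lemma meas_gtail c K : 0 < c -> measurable_fun setT (gtail c K).
Proof.
move=> c0; have m1 := meas_rint (meas2_gauss_inside c K) (Lint_inside K) (gauss_inside_norm c K).
have -> : gtail c K = (fun k => 1 - c / Num.sqrt pi * rint setT (gauss_inside c K k)).
  by apply/funext => k; rewrite gtail_compl//; ring.
by apply: measurable_funB => //; apply: measurable_funM.
Qed.

(** The average of the windows centred in $[-2K,2K]$ and [gtail] add up to 1. Fubini turns the first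
    part into windowed integrals, averaged over an interval of centres of length $4K$. *)
Lemma gauss_average c K rho B : 0 < c -> 0 <= K -> Lint rho ->
  (forall k0, `|k0| <= 2 * K ->
     `|rint setT (fun k => expR (- (c ^+ 2 * (k - k0) ^+ 2)) * rho k)| <= B) ->
  `|rint setT rho| <= `|rint setT (fun k => gtail c K k * rho k)| + c / Num.sqrt pi * (4 * K * B).
Proof.
move=> c0 K0 Ir HB.
have cs : 0 < c / Num.sqrt pi by rewrite divr_gt0// sqrtr_gt0 pi_gt0.
have Bd k0 : `|rint setT (fun k => gauss_inside c K k k0 * rho k)| <= B * inside K k0.
  rewrite /gauss_inside /inside indicTE; case: asboolP => [|_].
    rewrite /= in_itv/= -ler_norml => k0K; rewrite mulr1.
    by under eq_fun do rewrite mulr1; exact: HB.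
  rewrite mulr0 normr_le0; apply/eqP; rewrite -[RHS](rint0 R).
  by apply: eq_rint => k _; rewrite mulr0 mul0r.
clear HB.
have EI : rint setT (inside K) = 4 * K by rewrite rint_indic_itv; [ring|lra].
have mF : meas2 (fun k k0 => gauss_inside c K k k0 * rho k).
  by apply: (meas2M (meas2_gauss_inside c K)); apply: meas2_fst; exact: Lint_meas.
have bF k k0 : `|gauss_inside c K k k0 * rho k| <= `|rho k| * inside K k0.
  by rewrite normrM mulrC ler_wpM2l.
have [F1 I1 _] := fubini_rint mF (Lint_abs Ir) (Lint_inside K) bF.
have Ig : Lint (fun k => gtail c K k * rho k).
  apply: (Lint_bound _ (Lint_abs Ir)) => [|k].
    by apply: measurable_funM; [exact: meas_gtail|exact: Lint_meas].
  by have /andP[h0 h1] := gtail01 K k c0; rewrite normrM (ger0_norm h0) ler_piMl.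
have E : rint setT rho = rint setT (fun k => gtail c K k * rho k) +
    c / Num.sqrt pi * rint setT (fun k0 => rint setT (fun k => gauss_inside c K k k0 * rho k)).
  rewrite -F1 -(rintZ _ I1) -(rintD Ig (LintZ _ I1)); apply: eq_rint => k _.
  rewrite (_ : rint setT (fun k0 => _) = rho k * rint setT (gauss_inside c K k)).
    by rewrite mulrCA gtail_compl//; ring.
  by rewrite -rintZ//; apply: eq_rint => x _; rewrite mulrC.
rewrite E; apply: (le_trans (ler_normD _ _)).
rewrite lerD2l normrM (ger0_norm (ltW cs)) ler_pM2l// mulrC -EI -(rintZ _ (Lint_inside K)).
have mG : measurable_fun setT (fun k0 => rint setT (fun k => gauss_inside c K k k0 * rho k)).
  apply: (meas_rint (meas2_swap mF) (Lint_abs Ir)) => k0 k.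
  by apply: (le_trans (bF k k0)); rewrite ler_piMr//; case/andP: (inside01 K k0).
have IB := LintZ B (Lint_inside K).
exact: rint_abs_le (Lint_bound mG IB Bd) IB Bd.
Qed.

End high_frequency.

(** * The residual of a truncation and the $L^2$ projection error *)

Section projection_error.
Variable R : realType.
Implicit Types (w v r : R -> R) (b c k x y K X : R).

Lemma rint_abs_trunc_le w X : L2 w -> 0 <= X ->
  Lint (fun x => `|trunc w X x|) /\
  rint setT (fun x => `|trunc w X x|) <= Num.sqrt (2 * X) * L2norm w.
Proof.
move=> Lw X0; split; first exact/Lint_abs/Lint_trunc.
have LI : L2 (\1_(`[- X, X]%classic) : R -> R) by exact: (@L2_indic_itv _ _ (- X) X).
apply: (le_trans (rint_absM_le Lw LI)); rewrite mulrC.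
rewrite (_ : L2norm (\1_(`[- X, X]%classic) : R -> R) = Num.sqrt (2 * X))//.
congr Num.sqrt; rewrite -[RHS](_ : X - - X = 2 * X); last by ring.
rewrite -rint_indic_itv; last by lra.
by apply: eq_rint => x _; rewrite indicTE; case: ifP; rewrite ?expr1n ?expr0n.
Qed.

Section residual.
Variables (b X K : R) (M : nat) (w r : R -> R).
Hypotheses (b0 : 0 < b) (X0 : 0 <= X) (K0 : 0 <= K) (Lw : L2 w).
Hypotheses (Ir : Lint r) (Lr : L2 r).
Hypothesis r_orth : forall p : {poly R}, (size p <= M)%N -> L2inner r (hatP b p) = 0.

(** With this width $e^{-t^2/(4c^2)}=e^{-b^2t^2/2}$: the kernel of the window is a coherent state of
    scale [b]. *)
Let c := (Num.sqrt 2 * b)^-1.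

Let s20 : 0 < Num.sqrt 2 :> R. Proof. by rewrite sqrtr_gt0. Qed.
Let c0 : 0 < c. Proof. by rewrite invr_gt0 mulr_gt0. Qed.
Let bn0 : b != 0. Proof. by rewrite gt_eqF. Qed.
Let c2 : c ^+ 2 = (2 * b ^+ 2)^-1.
Proof. by rewrite exprVn exprMn sqr_sqrtr. Qed.

(** The bound of [coherent_proj_error] at the extreme phase-space point $(X,2K)$. *)
Let dlt := Num.sqrt pi / b * (2 ^- M * expR (((b * X) ^+ 2 + (2 * K / b) ^+ 2) / 2)).

Let dlt0 : 0 <= dlt.
Proof. by rewrite !mulr_ge0 ?sqrtr_ge0 ?expR_ge0 ?invr_ge0 ?exprn_ge0// ltW. Qed.

Lemma residual_coherent k x : `|x| <= X -> `|k| <= 2 * K ->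
  `|L2inner r (coherent b x k 0)| <= Num.sqrt dlt * L2norm r.
Proof.
move=> xX kK; set f := coherent b x k 0.
have Lf : L2 f by exact: L2_coherent.
have LP : L2 (hatP b (hproj b M f)) by exact: L2_hatP.
have -> : L2inner r f = L2inner r (fun x => f x - hatP b (hproj b M f) x).
  by rewrite ipBr// r_orth ?subr0// size_hproj.
apply: (le_trans (ip_CS Lr (L2B Lf LP))); rewrite mulrC ler_wpM2r ?L2norm_ge0//.
apply: ler_sqr_pos; rewrite ?sqrtr_ge0// ?L2norm_ge0// (sqr_sqrtr dlt0).
apply: (le_trans (coherent_proj_error x k 0 M b0)).
apply: ler_wpM2l; first by rewrite divr_ge0 ?sqrtr_ge0// ltW.
apply: ler_wpM2l; first by rewrite invr_ge0 exprn_ge0.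
rewrite ler_expR ler_pM2r ?invr_gt0//; apply: lerD.
  rewrite !exprMn ler_wpM2l ?sqr_ge0// -(real_normK (num_real x)).
  by rewrite lerXn2r ?nnegrE// (le_trans _ xX).
rewrite !exprMn ler_wpM2r ?sqr_ge0// -(real_normK (num_real k)) -exprMn.
by rewrite lerXn2r ?nnegrE// (le_trans _ kK).
Qed.

(* By [gauss_spec_kernel] the windowed spectrum of the pair is an integral of pairings of r with
   coherent states, to which r is almost orthogonal. *)
Lemma residual_average k0 : `|k0| <= 2 * K ->
  `|rint setT (fun k => expR (- (c ^+ 2 * (k - k0) ^+ 2)) * spec (trunc w X) r k)|
  <= Num.sqrt pi / c * (Num.sqrt dlt * L2norm r) * (Num.sqrt (2 * X) * L2norm w).
Proof.
move=> kK; have It := Lint_trunc X Lw.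
have [Ia Ea] := rint_abs_trunc_le Lw X0.
have sc0 : 0 < Num.sqrt pi / c by rewrite divr_gt0// sqrtr_gt0 pi_gt0.
rewrite gauss_spec_kernel//.
pose B := Num.sqrt pi / c * (Num.sqrt dlt * L2norm r).
have B0 : 0 <= B by rewrite !mulr_ge0 ?sqrtr_ge0 ?L2norm_ge0// invr_ge0 ltW.
pose q x := rint setT (fun y => r y * gker c k0 (x - y)).
have qE x : q x = Num.sqrt pi / c * L2inner r (coherent b x k0 0).
  rewrite /L2inner -rintZ; last by apply: L2M_Lint => //; exact: L2_coherent.
  apply: eq_rint => y _; rewrite /gker /coherent c2 addr0.
  rewrite (_ : y - x = - (x - y)); last by rewrite opprB.
  rewrite sqrrN mulrN cosN.
  rewrite (_ : - ((x - y) ^+ 2 / (4 * (2 * b ^+ 2)^-1)) = - (b ^+ 2 * (x - y) ^+ 2) / 2); last by field.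
  by ring.
have Bq x : `|trunc w X x * q x| <= B * `|trunc w X x|.
  have [xX|xX] := leP `|x| X; last by rewrite trunc_out// mul0r normr0 mulr0.
  rewrite normrM mulrC ler_wpM2r// qE normrM (ger0_norm (ltW sc0)) /B ler_pM2l//.
  exact: residual_coherent.
have mq : measurable_fun setT q.
  apply: (meas_rint (g := fun y => Num.sqrt pi / c * `|r y|)) => [||x y].
  - apply: meas2M; first by apply: meas2_snd; exact: Lint_meas.
    apply: (@meas2_comp R (gker c k0) (fun x y => x - y)); first exact: cont_gker.
    by apply: meas2B; [exact: meas2_id_fst|exact: meas2_id_snd].
  - exact/LintZ/Lint_abs.
  - by rewrite normrM mulrC ler_wpM2r// gker_bound.
have Iq : Lint (fun x => trunc w X x * q x).
  apply: (Lint_bound _ (LintZ B Ia) Bq).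
  by apply: measurable_funM => //; exact: Lint_meas.
apply: (le_trans (rint_abs_le Iq (LintZ B Ia) Bq)).
by rewrite rintZ// ler_wpM2l.
Qed.

(** The three terms come from the frequency tails of [w], from the leakage of the omitted windows
    below [K], and from the pairings with coherent states. *)
Lemma residual_ip_bound :
  2 * pi * `|L2inner (trunc w X) r| <=
  Num.sqrt (2 * pi) * L2norm r * (L2norm (tailtr true K (trunc w X)) + L2norm (tailtr false K (trunc w X)))
  + 2 * expR (- (K ^+ 2 / (2 * b ^+ 2))) * (4 * pi * (L2norm w * L2norm r))
  + 4 * K * (Num.sqrt dlt * L2norm r) * (Num.sqrt (2 * X) * L2norm w).
Proof.
have It := Lint_trunc X Lw; have Lt := L2_trunc X Lw.
have [Is _ _ _] := spec_CS It Lt Ir Lr.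
have mg := meas_gtail K c0; have := gauss_average c0 K0 Is residual_average.
rewrite (plancherel It Lt Ir Lr) normrM (ger0_norm (x := 2 * pi)); last by rewrite mulr_ge0// pi_ge0.
move=> /le_trans; apply.
apply: lerD; last first.
  apply: ler_eqW.
  have sp : 0 < Num.sqrt (pi : R) by rewrite sqrtr_gt0 pi_gt0.
  move: sp c0; move: (Num.sqrt pi) (Num.sqrt dlt) (L2norm r) (Num.sqrt (2 * X)) (L2norm w) c.
  by move=> s a1 a2 a3 a4 c' s0 c'0; field; rewrite !gt_eqF.
have e0 : 0 <= 2 * expR (- (K ^+ 2 / (2 * b ^+ 2))) by rewrite mulr_ge0 ?expR_ge0.
have ec : c ^+ 2 * K ^+ 2 = K ^+ 2 / (2 * b ^+ 2) by rewrite c2 mulrC.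
apply: (le_trans (@weighted_spec_bound _ _ _ K _ _ It Lt Ir Lr mg (fun k => gtail01 K k c0) e0 _)).
  by move=> k kK; rewrite -ec; exact: gtail_inside.
rewrite lerD2l; apply: ler_wpM2l => //.
apply: ler_wpM2l; first by rewrite mulr_ge0// pi_ge0.
apply: ler_wpM2r; first exact: L2norm_ge0.
apply: L2norm_le => // x; rewrite /trunc normrM.
have /andP[i0 i1] := indic01 `[- X, X]%classic x.
by rewrite (ger0_norm i0) ler_piMr.
Qed.

End residual.

(** From $2^{-N}\le e^{-N/2}$ the exponent is at most $-\frac3{16}N$. Two sixteenths give the square
    on the right, and the third absorbs $N^{3/2}\le N^2\le512e^{N/16}$. *)
Lemma frame_constant (N : nat) : (1 <= N)%N ->
  N%:R * Num.sqrt N%:R * 2 ^- N * expR (5 * N%:R / 16) <= 512 * expR (- (N%:R / 16)) ^+ 2 :> R.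
Proof.
move=> N1; have n1 : 1 <= N%:R :> R by rewrite ler1n.
have h1 : N%:R * Num.sqrt N%:R <= 512 * expR (N%:R / 16) :> R.
  apply: (@le_trans _ _ (N%:R ^+ 2)).
    rewrite expr2 ler_pM2l; last by lra.
    apply: ler_sqr_pos; rewrite ?sqrtr_ge0// sqr_sqrtr//.
    by rewrite expr2 ler_peMr.
  have := @expR_ge1Dxn R (N%:R / 16) 1 ltac:(by rewrite divr_ge0).
  by rewrite (_ : 2`!%:R = 2 :> R)// exprMn => h; lra.
have h2 : 2 ^- N <= expR (- (N%:R / 2)) :> R.
  rewrite (_ : - (N%:R / 2) = N%:R * (- 2^-1)); last by ring.
  rewrite mulrC expRM_natr -exprVn lerXn2r ?nnegrE ?expR_ge0 ?invr_ge0//.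
  by have := @expR_ge1Dx R (- 2^-1); lra.
have h3 := ler_pM (mulr_ge0 (ler0n R N) (sqrtr_ge0 _)) _ h1 h2.
have E : 512 * expR (- (N%:R / 16)) ^+ 2 = 512 * expR (N%:R / 16) * expR (- (N%:R / 2)) * expR (5 * N%:R / 16) :> R.
  by rewrite expr2 -!expRD -!mulrA -!expRD; congr (_ * expR _); field.
by rewrite E ler_wpM2r ?expR_ge0// h3// invr_ge0 exprn_ge0.
Qed.

Lemma sqrt_pi_le2 : Num.sqrt pi <= 2 :> R.
Proof.
apply: ler_sqr_pos => //; rewrite (sqr_sqrtr (pi_ge0 R)).
by have := pihalf_lt2 R; lra.
Qed.

Lemma residual_constant (N : nat) b c : (1 <= N)%N -> 0 < b -> 0 < c -> c <= 1 -> c ^+ 2 = 8^-1 ->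
  4 * (c * Num.sqrt N%:R * b) * Num.sqrt (Num.sqrt pi / b * (2 ^- N.-1 * expR (5 * N%:R / 16)))
  * Num.sqrt (2 * (c * Num.sqrt N%:R / b)) <= 100 * expR (- (N%:R / 16)).
Proof.
move=> N1 b0 c0 c1 c2; set d := Num.sqrt pi / b * _; set X := _ / b; set K := _ * b.
set e := expR (- _).
have sN2 : Num.sqrt N%:R ^+ 2 = N%:R :> R by rewrite sqr_sqrtr.
have X0 : 0 <= X by rewrite divr_ge0 ?(ltW b0)// mulr_ge0 ?sqrtr_ge0// ltW.
apply: ler_sqr_pos.
  by rewrite mulr_ge0 ?expR_ge0.
have d0 : 0 <= d by rewrite !mulr_ge0 ?sqrtr_ge0 ?expR_ge0 ?invr_ge0 ?exprn_ge0// ltW.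
have E : (4 * K * Num.sqrt d * Num.sqrt (2 * X)) ^+ 2 =
    8 * c * Num.sqrt pi * (N%:R * Num.sqrt N%:R * 2 ^- N * expR (5 * N%:R / 16)).
  have X20 : 0 <= 2 * X by rewrite mulr_ge0.
  rewrite !exprMn (sqr_sqrtr d0) (sqr_sqrtr X20).
  rewrite c2 sN2 /d /X.
  have -> : 2 ^- N.-1 = 2 * 2 ^- N :> R.
    by case: (N) N1 => // m _; rewrite exprS invfM mulrA mulfV ?mul1r ?pnatr_eq0.
  by move: (expR _) (2 ^- N) => e' t; field; rewrite gt_eqF.
rewrite [leLHS]E exprMn.
have h := frame_constant N1; rewrite -/e in h.
have sp2 : Num.sqrt pi <= 2 :> R := sqrt_pi_le2.
have h1 : 8 * c * Num.sqrt pi <= 16 :> R.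
  by rewrite -mulrA (_ : 16 = 8 * (1 * 2)); [rewrite ler_pM2l// ler_pM// ltW|ring].
have q0 : 0 <= e ^+ 2 := sqr_ge0 e.
apply: (le_trans (ler_pM _ _ h1 h)).
- by rewrite !mulr_ge0 ?sqrtr_ge0// ltW.
- by rewrite !mulr_ge0 ?sqrtr_ge0 ?expR_ge0 ?invr_ge0 ?exprn_ge0.
- by move: (e ^+ 2) q0 => q q0; lra.
Qed.

(** Here [n] is the norm of the residual, [W] that of $w$, and [F], [T] are its frequency and space
    tails. Every term on the right of the quadratic inequality has a factor [n], which divides
    out. *)
Lemma residual_arith (S e n W F T t1 t2 G d X1 : R) :
  S ^+ 2 = 2 * pi -> 0 < e -> 0 <= S -> 0 <= n -> 0 <= W -> 0 <= T -> 0 <= F ->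
  t1 <= S * (F + T) -> t2 <= S * (F + T) -> G * d * X1 <= 100 * e ->
  2 * pi * n ^+ 2 <= S * n * (t1 + t2) + 2 * e * (4 * pi * (W * n)) + G * (d * n) * (X1 * W) ->
  n <= 2 * (F + T) + 29 * (W * e).
Proof.
move=> S2 e0 S0 + W0 T0 F0 T1 T2 G0 H.
have pi2 : 2 <= pi :> R := pi_ge2 R.
have We := mulr_ge0 W0 (ltW e0).
rewrite le_eqVlt => /predU1P[<-|n0].
  by lra.
have H1 : S * n * (t1 + t2) <= n * (4 * pi * (F + T)).
  have := ler_wpM2l (mulr_ge0 S0 (ltW n0)) (lerD T1 T2); move=> /le_trans; apply.
  have -> : 4 * pi = 2 * S ^+ 2 :> R by rewrite S2; ring.
  by apply: ler_eqW; ring.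
have H2 : G * (d * n) * (X1 * W) <= n * (100 * e * W).
  rewrite (_ : G * (d * n) * (X1 * W) = n * (G * d * X1 * W)); last by ring.
  by rewrite ler_pM2l// ler_wpM2r.
have H3 : n * (2 * pi * n) <= n * (4 * pi * (F + T) + 8 * pi * (W * e) + 100 * (W * e)).
  by have := lerD H1 H2; lra.
rewrite ler_pM2l// in H3.
have H4 : 100 * (W * e) <= 50 * pi * (W * e) by rewrite ler_wpM2r//; lra.
have pi0 : 0 < 2 * pi :> R by lra.
rewrite -(ler_pM2l pi0); lra.
Qed.

(** By [hproj_best] the projection of the truncated function may replace that of [w]; this costs the
    space tail once more. There are $N-1$ modes here because two of the $N+1$ are lost in
    [hproj_deriv_error]. *)
Lemma hproj_error w (N : nat) b : L2 w -> (1 <= N)%N -> 0 < b ->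
  L2norm (fun x => w x - hatP b (hproj b N.-1 w) x) <= 29 * E_err N b w.
Proof.
move=> Lw N1 b0; rewrite /E_err Defs_indicE.
set c := (2 * Num.sqrt 2)^-1; set X := c * Num.sqrt N%:R / b; set K := c * Num.sqrt N%:R * b.
set e := expR (- (N%:R / 16)).
have s20 : 0 < Num.sqrt 2 :> R by rewrite sqrtr_gt0.
have c0 : 0 < c by rewrite invr_gt0 mulr_gt0.
have c2 : c ^+ 2 = 8^-1 by rewrite exprVn exprMn sqr_sqrtr//; congr (_^-1); ring.
have c1 : c <= 1 by rewrite -(@ler_pXn2r _ 2) ?nnegrE ?(ltW c0)// c2; lra.
have N0 : 0 <= N%:R :> R by [].
have sN0 : 0 < Num.sqrt N%:R :> R by rewrite sqrtr_gt0 ltr0n.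
have sN2 : Num.sqrt N%:R ^+ 2 = N%:R :> R by rewrite sqr_sqrtr.
have X0 : 0 <= X by rewrite divr_ge0 ?(ltW b0)// mulr_ge0 ?(ltW c0)// ltW.
have K0 : 0 <= K by rewrite mulr_ge0 ?(ltW b0)// mulr_ge0 ?(ltW c0)// ltW.
pose w0 := trunc w X; pose P := hatP b (hproj b N.-1 w0); pose r x := w0 x - P x.
have [I0 L0] := (Lint_trunc X Lw : Lint w0, L2_trunc X Lw : L2 w0).
have LP : L2 P by exact: L2_hatP. have IP : Lint P by exact: Lint_hatP.
have Ir : Lint r by exact: LintB. have Lr : L2 r by exact: L2B.
have orth (p : {poly R}) : (size p <= N.-1)%N -> L2inner r (hatP b p) = 0 by exact: hres_orth.
have rr : L2norm r ^+ 2 = L2inner w0 r.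
  rewrite sqr_L2norm {1}/r ipBl// [L2inner P r]ipC orth ?subr0// size_hproj//.
have := @residual_ip_bound b X K N.-1 w r b0 X0 K0 Lw Ir Lr orth.
rewrite -/w0 -rr ger0_norm ?sqr_ge0//.
(* With $K^2=Nb^2/8$ the window leakage becomes the $e^{-N/16}$ of [E_err]. *)
have -> : K ^+ 2 / (2 * b ^+ 2) = N%:R / 16.
  by rewrite /K !exprMn c2 sN2; field; rewrite gt_eqF.
rewrite -/e.
(* The Poisson mean at the extreme point: half of $N/8+4\cdot N/8$. *)
have -> : ((b * X) ^+ 2 + (2 * K / b) ^+ 2) / 2 = 5 * N%:R / 16.
  have -> : b * X = c * Num.sqrt N%:R by rewrite /X; field; rewrite gt_eqF.
  have -> : 2 * K / b = 2 * (c * Num.sqrt N%:R) by rewrite /K; field; rewrite gt_eqF.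
  by rewrite !exprMn c2 sN2; field.
set d := Num.sqrt pi / b * _; set S := Num.sqrt (2 * pi).
have T1 := tailtr_le_tail_norm true K X Lw; have T2 := tailtr_le_tail_norm false K X Lw.
have best := hproj_best b0 Lw (size_hproj b0 N.-1 w0).
have tri : L2norm (fun x => w x - P x) <= L2norm (fun x => w x * \1_(outside X) x) + L2norm r.
  have Lo : L2 (fun x => w x * \1_(outside X) x) by apply: L2_indic => //; exact: measurable_outside.
  by apply: (L2norm_triangle Lo Lr) => x; rewrite -truncB /r /w0; ring.
have bd := le_trans best tri.
have S2 : S ^+ 2 = 2 * pi by rewrite sqr_sqrtr// mulr_ge0// pi_ge0.
have pi2 : 2 <= pi :> R := pi_ge2 R.
have G0 : 4 * K * Num.sqrt d * Num.sqrt (2 * X) <= 100 * e.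
  exact: residual_constant.
have S0 : 0 <= S by exact: sqrtr_ge0.
have e0 : 0 < e by exact: expR_gt0.
have F0 : 0 <= fourier_tail_norm w K by exact: sqrtr_ge0.
move: T1 T2 bd (L2norm_ge0 r) (L2norm_ge0 w) (L2norm_ge0 (fun x => w x * \1_(outside X) x)) F0 G0.
rewrite -/w0.
move: (Num.sqrt d) (Num.sqrt (2 * X)) => d1 X1.
move: (L2norm (tailtr true K w0)) (L2norm (tailtr false K w0)) (fourier_tail_norm w K) => t1 t2 F.
move: (L2norm w) (L2norm r) => W n.
clear -S2 pi2 e0 S0; rewrite /E_err; move: (L2norm _) (L2norm _) => n' T T1 T2 bd n0 W0 T0 F0 G0 H.
rewrite -/S in T1 T2.
apply: (le_trans bd).
suff : n <= 2 * (F + T) + 29 * (W * e).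
  by have := mulr_ge0 W0 (ltW e0); lra.
exact: residual_arith G0 H.
Qed.

End projection_error.

(** * Derivative of the projection *)

Section sobolev.
Variable R : realType.
Local Notation mu := (@lebesgue_measure R).
Local Notation H := (@hermite R).
Implicit Types (w v : R -> R) (b x : R) (p q : {poly R}).

(** The sampling bound for the single node [x] and $d=1$. *)
Lemma H1_bounded w w' : H1 w w' -> exists M, forall x, `|w x| <= M.
Proof.
move=> Hw; exists (Num.sqrt (2 * L2norm w ^+ 2 + 2 * L2norm w' ^+ 2)) => x.
have h1 y z : y \in [:: x] -> z \in [:: x] -> y < z -> 1 <= z - y.
  by rewrite !inE => /eqP -> /eqP ->; rewrite ltxx.
have := H1_sample_bound Hw (isT : uniq [:: x]) ltr01 h1.
rewrite big_seq1 divr1 mulr1 => K.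
have B0 := le_trans (sqr_ge0 _) K.
by apply: ler_sqr_pos; [exact: sqrtr_ge0|rewrite real_normK ?num_real// (sqr_sqrtr B0)].
Qed.

(** Indicator of $t\le s$, written through the difference so that joint measurability is
    immediate. *)
Let above (t s : R) : R := \1_(`[0, +oo[%classic) (s - t).

Let aboveE t s : above t s = if t <= s then 1 else 0.
Proof.
rewrite /above indicE; case: ifP => ts; [rewrite mem_set//|rewrite memNset//]; rewrite /= in_itv/= andbT subr_ge0 ts//.
Qed.

(* Fubini for w'(t) v'(s) on the triangle t <= s. *)
Lemma H1_parts_itv w w' v v' (n : R) : 0 <= n -> H1 w w' -> H1 v v' ->
  rint `[- n, n] (fun x => w' x * v x) + rint `[- n, n] (fun x => w x * v' x)
  = w n * v n - w (- n) * v (- n).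
Proof.
move=> n0 [Lw [Lw' dw]] [Lv [Lv' dv]].
have nn : - n <= n by lra.
pose I := (\1_(`[- n, n]%classic) : R -> R).
have IE x : I x = if - n <= x <= n then 1 else 0.
  by rewrite /I indicTE; case: asboolP; rewrite /= in_itv/=; [move=> ->|move=> /negP/negbTE ->].
have Iw := L2_Lint_itv (- n) n Lw'; have Iv := L2_Lint_itv (- n) n Lv'.
have mabove : meas2 above.
  apply: (@measurableT_comp _ _ _ _ _ _ (\1_(`[0, +oo[%classic) : R -> R) _ (fun q : R * R => q.2 - q.1)).
    by apply: measurable_indic; exact: measurable_itv.
  have : meas2 (fun t s : R => s - t) by apply: meas2B; [exact: meas2_id_snd|exact: meas2_id_fst].
  by [].
have dwn : rint setT (fun t => w' t * I t) = w n - w (- n) by rewrite (dw _ _ nn) (rint_indic w' `[- n, n]%classic).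
have dvn : rint setT (fun t => v' t * I t) = v n - v (- n) by rewrite (dv _ _ nn) (rint_indic v' `[- n, n]%classic).
have L t : rint setT (fun s => (w' t * I t) * (v' s * I s) * above t s) = v n * (w' t * I t) - w' t * v t * I t.
  have [tn|tn] := boolP (- n <= t <= n); last first.
    rewrite IE (negbTE tn) !mulr0 subrr -[RHS](rint0 R); apply: eq_rint => s _.
    by rewrite !mul0r.
  have /andP[t1 t2] := tn; rewrite IE tn !mulr1.
  transitivity (w' t * rint `[t, n] v'); last by rewrite -(dv _ _ t2); ring.
  rewrite (rint_indic _ `[t, n]%classic) -rintZ; last exact: L2_Lint_itv.
  apply: eq_rint => s _; rewrite -!mulrA; congr (_ * (_ * _)).
  rewrite aboveE IE indicTE /= asboolb in_itv/=.
  by case: (leP t s) => ts; rewrite ?mulr0// ?mulr1 (le_trans t1 ts).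
have Rr s : rint setT (fun t => (w' t * I t) * (v' s * I s) * above t s) = w s * v' s * I s - w (- n) * (v' s * I s).
  have [sn|sn] := boolP (- n <= s <= n); last first.
    rewrite IE (negbTE sn) !mulr0 subrr -[RHS](rint0 R); apply: eq_rint => t _.
    by rewrite mulr0 mul0r.
  have /andP[s1 s2] := sn; rewrite IE sn !mulr1.
  transitivity (v' s * rint `[- n, s] w'); last by rewrite -(dw _ _ s1); ring.
  rewrite (rint_indic _ `[- n, s]%classic) -rintZ; last exact: L2_Lint_itv.
  apply: eq_rint => t _; rewrite mulrAC [RHS]mulrC; congr (_ * _); rewrite -mulrA; congr (_ * _).
  rewrite aboveE IE indicTE /= asboolb in_itv/=.
  by case: (leP t s) => ts; rewrite ?mulr0 ?andbF// ?mulr1 (le_trans ts s2).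
have mI : measurable (`[- n, n]%classic : set R) by exact: measurable_itv.
have J1 : Lint (fun t => w' t * v t * I t) by apply: Lint_indic => //; exact: L2M_Lint.
have J2 : Lint (fun t => w t * v' t * I t) by apply: Lint_indic => //; exact: L2M_Lint.
have [||F1 _ _] := @fubini_rint R (fun t s => (w' t * I t) * (v' s * I s) * above t s)
   (fun t => `|w' t * I t|) (fun s => `|v' s * I s|) _ (Lint_abs Iw) (Lint_abs Iv).
- apply: (meas2M _ mabove); apply: meas2M; [apply: meas2_fst|apply: meas2_snd]; exact: Lint_meas.
- move=> t s; rewrite normrM -[leRHS]mulr1 normrM ler_wpM2l//.
  by rewrite aboveE; case: ifP; rewrite ?normr1 ?normr0.
have e1 := eq_rint (A := setT) (fun t _ => L t); have e2 := eq_rint (A := setT) (fun s _ => Rr s).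
rewrite e1 e2 (rintB (LintZ (v n) Iw) J1) (rintB J2 (LintZ (w (- n)) Iv)) in F1.
rewrite (rintZ _ Iw) (rintZ _ Iv) dwn dvn in F1.
rewrite (rint_indic (fun x => w' x * v x) `[- n, n]%classic) (rint_indic (fun x => w x * v' x) `[- n, n]%classic).
rewrite -/I; move: F1; clear; move: (rint _ _) (rint _ _) => A B.
by move: (w n) (v n) (w (- n)) (v (- n)) => ? ? ? ?; lra.
Qed.

(** The boundary terms vanish because [w] is bounded and the test function has Gaussian decay. *)
Lemma H1_parts_hatP w w' b p : 0 < b -> H1 w w' ->
  L2inner w' (hatP b p) = - L2inner w (hatP b (p^`() - b ^+ 2 *: 'X * p)).
Proof.
move=> b0 Hw; have [M wM] := H1_bounded Hw; have Hp := H1_hatP p b0.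
have [Lw [Lw' _]] := Hw; have [Lp [Lp' _]] := Hp.
set p' := p^`() - b ^+ 2 *: 'X * p in Hp Lp' *.
apply/eqP; rewrite -addr_eq0; apply/eqP.
have c1 := rint_itv_cvg (L2M_Lint Lw' Lp); have c2 := rint_itv_cvg (L2M_Lint Lw Lp').
apply: (cvg_unique (@Rhausdorff R) (cvgD c1 c2)).
have -> : (fun n : nat => rint `[- n%:R, n%:R] (fun x => w' x * hatP b p x)) +
    (fun n : nat => rint `[- n%:R, n%:R] (fun x => w x * hatP b p' x)) =
    (fun n : nat => hatP b p n%:R * w n%:R - hatP b p (- n%:R) * w (- n%:R)).
  by apply/funext => n; rewrite [LHS]H1_parts_itv// ![_ * w _]mulrC.
have g := gdom_bounded (gdom_hatP p b0) wM.
rewrite -(subr0 0); apply: cvgB.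
  by apply: (gdom_cvg0 (u := fun n => n%:R) g) => n; rewrite normr_nat.
by apply: (gdom_cvg0 (u := fun n => - n%:R) g) => n; rewrite normrN normr_nat.
Qed.

Lemma ip_ae f g h : L2 f -> L2 g -> L2 h -> {ae mu, forall x, f x = g x} ->
  L2inner f h = L2inner g h.
Proof.
move=> Lf Lg Lh fg; rewrite /L2inner /rint; congr fine; apply: ae_eq_integral => //.
- by apply/measurable_EFinP; exact: Lint_meas (L2M_Lint Lf Lh).
- by apply/measurable_EFinP; exact: Lint_meas (L2M_Lint Lg Lh).
- by apply: ae_imply fg _ => x fgx _ /=; rewrite fgx.
Qed.

(** The polynomial for which [hatP b (dpoly b p)] is the derivative of [hatP b p]. *)
Definition dpoly b p : {poly R} := p^`() - b ^+ 2 *: 'X * p.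

Lemma size_dpoly b p n : (size p <= n)%N -> (size (dpoly b p) <= n.+1)%N.
Proof.
move=> pn; rewrite (leq_trans (size_polyD _ _))// geq_max size_polyN; apply/andP; split.
  have [->|p0] := eqVneq p 0; first by rewrite derivC size_poly0.
  exact: leq_trans (ltnW (leq_trans (lt_size_deriv p0) pn)) (leqnSn n).
rewrite -scalerAl (leq_trans (size_scale_leq _ _))// mulrC.
by rewrite (leq_trans (size_polyMleq _ _))// size_polyX addn2.
Qed.

Lemma dpolyD b p q : dpoly b (p + q) = dpoly b p + dpoly b q.
Proof. by rewrite /dpoly derivD mulrDr; ring. Qed.

Lemma dpolyZ b (a : R) p : dpoly b (a *: p) = a *: dpoly b p.
Proof. by rewrite /dpoly derivZ -scalerAr scalerBr. Qed.

(** Ladder relation: the derivative of a mode is a multiple of the preceding mode minus a multiple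
    of the following one. *)
Lemma dpoly_hpoly b n :
  dpoly b (hpoly b n) = (b / 2) *: (((H n)^`() \Po (b *: 'X)) - hpoly b n.+1).
Proof.
rewrite /dpoly /hpoly deriv_comp derivZ derivX hermiteS.
rewrite comp_polyB comp_polyM; set q := H n \Po _; set q' := (H n)^`() \Po _.
have -> : (2 * 'X : {poly R}) \Po (b *: 'X) = (2 * b) *: 'X.
  by rewrite mulr_natl -scaler_nat comp_polyZ comp_polyX scalerA.
rewrite -scalerAr mulr1 -!scalerAl opprB !scalerDr !scalerN !scalerA.
by rewrite addrA -scalerDl; congr (_ *: _ - _ *: _); field.
Qed.

Lemma hnorm2S b n : hnorm2 b n.+1 = (2 * n.+1)%:R * hnorm2 b n.
Proof. by rewrite /hnorm2 hsqS; ring. Qed.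

(** The unnormalised modes satisfy $\|h_{i+1}\|^2=2(i+1)\|h_i\|^2$, which is where $\sqrt N$ comes
    from. *)
Lemma hcoef_hfunS_bound b w m i N : 0 < b -> L2 w -> (m <= i)%N -> (i.+1 <= 2 * N)%N ->
  L2norm (fun x => hcoef b w i * hfun b i.+1 x) <=
  2 * Num.sqrt N%:R * L2norm (fun x => w x - hatP b (hproj b m w) x).
Proof.
move=> b0 Lw mi iN; have Li := L2_hfun b0 i; have Li1 := L2_hfun b0 i.+1.
rewrite (L2normZ _ Li1).
have := hcoef_bound b0 Lw mi; rewrite /hcoef normrM.
have h0 := hnorm2_gt0 b0 i.
rewrite normfV (gtr0_norm h0).
have n1 : L2norm (hfun b i) ^+ 2 = hnorm2 b i by rewrite sqr_L2norm hfun_sqr.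
have n2 : L2norm (hfun b i.+1) <= 2 * Num.sqrt N%:R * L2norm (hfun b i).
  apply: ler_sqr_pos; first by rewrite mulr_ge0 ?L2norm_ge0// mulr_ge0 ?sqrtr_ge0.
  rewrite exprMn n1 sqr_L2norm hfun_sqr// hnorm2S exprMn (sqr_sqrtr (ler0n R N)).
  rewrite ler_pM2r// natrM (_ : 2 ^+ 2 * N%:R = 2 * (2 * N%:R)); last by ring.
  by rewrite ler_pM2l// -natrM ler_nat.
have g0 := L2norm_ge0 (hfun b i).
move: (L2norm_ge0 (hfun b i.+1)) (L2norm_ge0 (fun x => w x - hatP b (hproj b m w) x)) n1 n2 g0 h0.
move: (L2norm (hfun b i)) (L2norm (hfun b i.+1)) (L2norm (fun x => w x - hatP b (hproj b m w) x)).
move: (`|_|) (hnorm2 b i) => z h g g1 r g10 r0 <- n2 g0 h0 zr.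
have gp : 0 < g by rewrite lt_neqAle g0 andbT eq_sym; apply: contraTneq h0 => ->; rewrite expr0n ltxx.
have e : g ^+ 2 != 0 by rewrite gt_eqF.
rewrite -(ler_pM2r h0) (_ : z / g ^+ 2 * g1 * g ^+ 2 = z * g1); last by field; rewrite gt_eqF.
apply: (le_trans (ler_wpM2r g10 zr)).
rewrite (_ : _ * r * g ^+ 2 = r * g * (2 * Num.sqrt N%:R * g)); last by ring.
by rewrite ler_wpM2l// mulr_ge0.
Qed.

(* Integration by parts makes w' - (Pi w)' orthogonal to the first N modes; only two boundary
   modes of (Pi w)' survive, with coefficients bounded by the projection error of w. *)
Lemma hproj_deriv_error w w' b (N : nat) : H1 w w' -> (1 <= N)%N -> 0 < b ->
  L2norm (fun x => w' x - hatP b (dpoly b (hproj b N.+1 w)) x) <=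
  58 * (E_err N b w' + b * Num.sqrt N%:R * E_err N b w).
Proof.
move=> Hw N1 b0; have [Lw [Lw' _]] := Hw.
set P := hproj b N.+1 w; set v := fun x => _.
have HP := H1_hatP P b0; rewrite -/(dpoly b P) in HP.
have Hv := H1B Hw HP; have [Le [Lv _]] := Hv; rewrite -/v in Hv Lv.
have orth p : (size p <= N)%N -> L2inner v (hatP b p) = 0.
  move=> pN; rewrite (H1_parts_hatP p b0 Hv) -/(dpoly b p).
  by rewrite hres_orth ?oppr0//; exact: size_dpoly.
have [m Nm] : exists m, N = m.+1 by exists N.-1; rewrite prednK.
(* With $m=N-1$, the derivatives of the last two modes $N-1$ and $N$ reach modes $N$ and $N+1$: this
   part is [S], and all the rest, [Q], stays in the first $N$ modes. *)
pose S := hcoef b w m *: hpoly b m.+1 + hcoef b w m.+1 *: hpoly b m.+2.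
pose Q := dpoly b (hproj b m w) + (b / 2) *: (hcoef b w m *: ((H m)^`() \Po (b *: 'X))
   + hcoef b w m.+1 *: ((H m.+1)^`() \Po (b *: 'X))).
have bn0 : b != 0 by rewrite gt_eqF.
have sQ : (size Q <= N)%N.
  rewrite Nm (leq_trans (size_polyD _ _))// geq_max; apply/andP; split.
    by apply: size_dpoly; exact: size_hproj.
  rewrite (leq_trans (size_scale_leq _ _))// (leq_trans (size_polyD _ _))// geq_max.
  have h j : (size (H j)^`() <= j)%N.
    by have := lt_size_deriv (hermite_neq0 R j); rewrite size_hermite ltnS.
  rewrite !(leq_trans (size_scale_leq _ _))// size_comp_scale//.
  by rewrite (leq_trans (h m)).
have EP : dpoly b P = Q - (b / 2) *: S.
  rewrite /P Nm /hproj big_ord_recr big_ord_recr /= -/(hproj b m w) !dpolyD !dpolyZ !dpoly_hpoly.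
  rewrite /Q /S !scalerDr !scalerN !scalerA ![hcoef b w _ * (b / 2)]mulrC.
  by ring.
have Lq := L2_hatP (hproj b N w') b0; have LS := L2_hatP S b0.
have LQ := L2_hatP (Q - hproj b N w') b0.
have vE x : v x = (w' x - hatP b (hproj b N w') x) - hatP b (Q - hproj b N w') x + b / 2 * hatP b S x.
  by rewrite /v EP !hatPB hatPZ; ring.
have Lr := L2B Lw' Lq.
have Lrr := L2B Lr LQ; have LSZ := L2Z (b / 2) LS.
have nS : L2norm (hatP b S) <= 4 * Num.sqrt N%:R * L2norm (fun x => w x - hatP b (hproj b m w) x).
  have L1 := L2Z (hcoef b w m) (L2_hfun b0 m.+1).
  have L2' := L2Z (hcoef b w m.+1) (L2_hfun b0 m.+2).
  have SE x : hatP b S x = hcoef b w m * hfun b m.+1 x + hcoef b w m.+1 * hfun b m.+2 x.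
    by rewrite /S hatPD !hatPZ.
  rewrite (eq_L2norm SE); apply: (le_trans (L2normD L1 L2')).
  have B1 := @hcoef_hfunS_bound b w m m N b0 Lw (leqnn m) ltac:(by rewrite Nm mul2n -addnn addSn ltnS leq_addr).
  have B2 := @hcoef_hfunS_bound b w m m.+1 N b0 Lw (leqnSn m) ltac:(by rewrite Nm mul2n -addnn addSn addnS ltnS ltnS leq_addr).
  apply: (le_trans (lerD B1 B2)); apply: ler_eqW.
  by move: (L2norm _) (Num.sqrt _) => r s; ring.
(* Expand one factor of $\|v\|^2$: the part in the first $N$ modes is orthogonal to [v], so only the
   projection error of $w'$ and [S] remain. *)
have key : L2norm v <= L2norm (fun x => w' x - hatP b (hproj b N w') x) + b / 2 * L2norm (hatP b S).
  have vv : L2norm v ^+ 2 = L2inner v (fun x => w' x - hatP b (hproj b N w') x) + b / 2 * L2inner v (hatP b S).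
    rewrite sqr_L2norm (eq_ip (fun x => erefl (v x)) vE) (ipDr Lrr LSZ Lv) (ipBr Lr LQ Lv) (ipZr _ LS Lv).
    by rewrite orth ?subr0// (leq_trans (size_polyD _ _))// geq_max sQ size_polyN size_hproj.
  have c1 := le_trans (ler_norm _) (ip_CS Lv Lr).
  have c2 := le_trans (ler_norm _) (ip_CS Lv LS).
  move: vv c1 c2 (L2norm_ge0 v) (L2norm_ge0 (hatP b S)) (L2norm_ge0 (fun x => w' x - hatP b (hproj b N w') x)).
  move: (L2norm v) (L2norm _) (L2norm _) (L2inner _ _) (L2inner _ _) => n s r i j vv c1 c2 n0 s0 r0.
  have b2 : 0 <= b / 2 by rewrite divr_ge0// ltW.
  move: n0; rewrite le_eqVlt => /predU1P[<-|n0]; first by rewrite addr_ge0// mulr_ge0.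
  rewrite -(ler_pM2l n0) -expr2 vv mulrDr mulrCA lerD//.
  by rewrite ler_wpM2l.
apply: (le_trans key).
have E1 := hproj_error Lw' N1 b0; have E2 := hproj_error Lw N1 b0.
have Best : L2norm (fun x => w' x - hatP b (hproj b N w') x) <= L2norm (fun x => w' x - hatP b (hproj b N.-1 w') x).
  by apply: hproj_best => //; rewrite (leq_trans (size_hproj b0 _ _))// leq_pred.
have mN : m = N.-1 by rewrite Nm.
rewrite -mN in E1 E2 Best.
have s0 : 0 <= Num.sqrt N%:R :> R by exact: sqrtr_ge0.
move: nS E1 E2 Best s0 (L2norm_ge0 (fun x => w' x - hatP b (hproj b m w') x)) b0; clear.
move: (L2norm _) (L2norm _) (L2norm _) (L2norm _) (E_err _ _ _) (E_err _ _ _) (Num.sqrt _) => nS r rm' rm e' e s h1 h2 h3 h4 s0 r0 b0.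
have b2 : 0 <= b / 2 by rewrite divr_ge0// ltW.
have := ler_wpM2l b2 (le_trans h1 (ler_wpM2l (mulr_ge0 (ler0n R 4) s0) h3)).
lra.
Qed.

End sobolev.

(** * Galerkin error *)

Section galerkin.
Variable R : realType.
Local Notation mu := (@lebesgue_measure R).
Implicit Types (w v f u : R -> R) (b k x : R) (p q : {poly R}).

Lemma E_err_ge0 N b w : 0 <= E_err N b w.
Proof. by rewrite /E_err !addr_ge0 ?mulr_ge0 ?expR_ge0 ?sqrtr_ge0. Qed.

(** 29 is the constant of [hproj_error], 87 adds the 58 of [hproj_deriv_error], and the root is
    taken of the stability constant. *)
Definition interp_cst : R := 29 + 87 * Num.sqrt (200 * expR 3 * Num.sqrt pi).

Lemma interp_cst_ge0 : 0 <= interp_cst.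
Proof. by rewrite addr_ge0 ?mulr_ge0 ?sqrtr_ge0. Qed.

(** Read [a], [c] as the norms of $f-p$ and its derivative, [h] as that of the interpolant minus
    [p]. Since $s=\sqrt N=k^3$, the term $b^{-1}k^{-2}\cdot bse$ equals $ke$ and merges with the
    first. *)
Let interp_arith (A a c e e' h k b s n : R) : 0 <= A -> 0 < b -> 0 < k -> 1 <= k -> 0 <= a -> 0 <= c ->
  0 <= e -> 0 <= e' -> s = k ^+ 3 ->
  a <= 29 * e -> c <= 58 * (e' + b * s * e) ->
  h ^+ 2 <= A * (k ^+ 2 * a ^+ 2 + b ^- 2 * k ^- 4 * c ^+ 2) -> n <= a + h ->
  n <= (29 + 87 * Num.sqrt A) * (k * e + b^-1 * k ^- 2 * e').
Proof.
move=> A0 b0 k0 k1 a0 c0 e0 e'0 -> ha hc hh hn.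
have bk0 : 0 < b^-1 * k ^- 2 by rewrite mulr_gt0 ?invr_gt0 ?exprn_gt0.
have hk : h <= Num.sqrt A * (k * a + b^-1 * k ^- 2 * c).
  apply: ler_sqr_pos.
    apply: mulr_ge0; [exact: sqrtr_ge0|apply: addr_ge0; apply: mulr_ge0 => //; exact: ltW].
  apply: (le_trans hh); rewrite exprMn (sqr_sqrtr A0) ler_wpM2l//.
  rewrite (_ : b ^- 2 * k ^- 4 * c ^+ 2 = (b^-1 * k ^- 2 * c) ^+ 2); last first.
    by field; rewrite !gt_eqF.
  rewrite -exprMn sqrrD lerD2r lerDl mulrn_wge0// mulr_ge0// mulr_ge0//; exact: ltW.
have c2 : b^-1 * k ^- 2 * c <= 58 * (b^-1 * k ^- 2 * e' + k * e).
  apply: (le_trans (ler_wpM2l (ltW bk0) hc)).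
  by apply: ler_eqW; field; rewrite !gt_eqF.
have a2 : k * a <= 29 * (k * e) by rewrite mulrCA ler_pM2l.
have ke : e <= k * e by rewrite ler_peMl.
have be : 0 <= b^-1 * k ^- 2 * e' by rewrite mulr_ge0// ltW.
have sA : 0 <= Num.sqrt A := sqrtr_ge0 A.
have := ler_wpM2l sA (lerD a2 c2).
have := mulr_ge0 sA be.
move: (Num.sqrt A) (k * a) (k * e) (b^-1 * k ^- 2 * c) (b^-1 * k ^- 2 * e') sA hk a2 c2 ke be => S ka ke X Y S0 hk a2 c2 he Y0 SY SS.
lra.
Qed.

Lemma interp_error f f' If b (N : nat) k : H1 f f' -> (1 <= N)%N -> 0 < b -> 0 < k -> k ^+ 6 = N%:R ->
  is_hermite_interp N b f If ->
  L2norm (fun x => f x - If x) <= interp_cst * (k * E_err N b f + b^-1 * k ^- 2 * E_err N b f').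
Proof.
move=> Hf N1 b0 k0 k6 HI; have [Lf _] := Hf.
have [[chi _ IfE] _] := HI.
have LI : L2 If by rewrite IfE; exact: L2_hatP.
set p := hproj b N.+1 f.
have Lp := L2_hatP p b0.
have Hg := H1B Hf (H1_hatP p b0).
have := hermite_interp_stable N1 b0 k0 k6 HI (size_hproj b0 N.+1 f) Hg.
rewrite -/p -/(dpoly b p) => K.
have E1 : L2norm (fun x => f x - hatP b p x) <= 29 * E_err N b f.
  apply: le_trans (hproj_error Lf N1 b0); apply: hproj_best => //.
  by rewrite (leq_trans (size_hproj b0 _ _))// (leq_trans (leq_pred _)).
have E2 := hproj_deriv_error Hf N1 b0; rewrite -/p in E2.
have tri : L2norm (fun x => f x - If x) <=
    L2norm (fun x => f x - hatP b p x) + L2norm (fun x => If x - hatP b p x).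
  apply: le_trans (L2normB (L2B Lf Lp) (L2B LI Lp)).
  by apply: ler_eqW; apply: eq_L2norm => x; ring.
have k1 : 1 <= k by rewrite -(@ler_pXn2r _ 6) ?nnegrE ?(ltW k0)// expr1n k6 ler1n.
have sN : Num.sqrt N%:R = k ^+ 3.
  by rewrite -k6 (exprM k 3 2) sqrtr_sqr ger0_norm// exprn_ge0// ltW.
rewrite /interp_cst; apply: (interp_arith _ b0 k0 k1 _ _ _ _ sN E1 E2 K tri); rewrite ?L2norm_ge0 ?E_err_ge0//.
Qed.

Lemma weak_form g f u u' u'' b p : 0 < b -> H1 u u' -> H1 u' u'' -> L2 f ->
  {ae mu, forall x, - u'' x + g * u x = f x} ->
  L2inner u' (hatP b (dpoly b p)) + g * L2inner u (hatP b p) = L2inner f (hatP b p).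
Proof.
move=> b0 [Lu _] Hu' Lf ae; have [_ [Lu'' _]] := Hu'.
have Lp := L2_hatP p b0.
have Lm := L2Z (-1) Lu''; have Lg := L2Z g Lu.
have <- : L2inner (fun x => -1 * u'' x + g * u x) (hatP b p) = L2inner f (hatP b p).
  apply: ip_ae => //; first exact: L2D.
  by apply: ae_imply ae _ => x <-; rewrite mulN1r.
by rewrite (ipDl Lm Lg Lp) (ipZl _ Lu'' Lp) (ipZl _ Lu Lp) (H1_parts_hatP p b0 Hu') mulN1r opprK.
Qed.

(** [s0], [s1] are the norms of the discrete error and its derivative, [d] the consistency error,
    [a0], [a1] the approximation errors; $m=\min(1,\gamma)$ is the coercivity constant. *)
Let cea_arith (g m s0 s1 d a0 a1 : R) : 0 < m -> m <= 1 -> m <= g ->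
  0 <= s0 -> 0 <= s1 -> 0 <= d -> 0 <= a0 -> 0 <= a1 ->
  s1 ^+ 2 + g * s0 ^+ 2 <= d * s0 + a1 * s1 + g * (a0 * s0) ->
  s0 + s1 <= 2 / m * (d + a1 + g * a0).
Proof.
move=> m0 m1 mg s00 s10 d0 a00 a10 H.
have g0 : 0 < g by exact: lt_le_trans mg.
set T := d + a1 + g * a0.
have ga : 0 <= g * a0 by rewrite mulr_ge0// ltW.
have T0 : 0 <= T by rewrite /T !addr_ge0.
have [s|s] := leP (s0 + s1) 0.
  by apply: (le_trans s); rewrite mulr_ge0// divr_ge0// ltW.
have h1 : m * (s0 + s1) ^+ 2 <= 2 * (s1 ^+ 2 + g * s0 ^+ 2).
  have q1 : m * s1 ^+ 2 <= s1 ^+ 2 by rewrite ler_piMl ?sqr_ge0.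
  have q0 : m * s0 ^+ 2 <= g * s0 ^+ 2 by rewrite ler_wpM2r ?sqr_ge0.
  have q2 : 0 <= m * (s0 - s1) ^+ 2 by rewrite mulr_ge0 ?sqr_ge0// ltW.
  by lra.
have h2 : d * s0 + a1 * s1 + g * (a0 * s0) <= T * (s0 + s1).
  rewrite mulrA /T; have := mulr_ge0 d0 s10; have := mulr_ge0 a10 s00; have := mulr_ge0 ga s10.
  by move: (g * a0) => y; lra.
have h3 : (s0 + s1) * (m * (s0 + s1)) <= (s0 + s1) * (2 * T).
  by have := le_trans h1 (ler_wpM2l (ler0n R 2) (le_trans H h2)); lra.
rewrite (ler_pM2l s) in h3.
by rewrite mulrAC ler_pdivlMr// mulrC.
Qed.

Let cs_arith (g i1 i2 i3 d s0 s1 a0 a1 : R) : 0 < g ->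
  `|i1| <= d * s0 -> `|i2| <= a1 * s1 -> `|i3| <= a0 * s0 ->
  i1 - i2 - g * i3 <= d * s0 + a1 * s1 + g * (a0 * s0).
Proof.
move=> g0; rewrite !ler_norml => /andP[_ h1] /andP[h2 _] /andP[h3 _].
by have := ler_wpM2l (ltW g0) h3; lra.
Qed.

(** The weak and the discrete equations are both tested with $q=p-\psi$, an element of the space.
    Their difference expresses the energy of $q$ through $f-$ [If] and the errors of [p]. *)
Lemma galerkin_error g f f' u u' u'' b (N : nat) (psi : {poly R}) If : 0 < g ->
  H1 f f' -> H1 u u' -> H1 u' u'' -> {ae mu, forall x, - u'' x + g * u x = f x} ->
  0 < b -> is_hermite_interp N b f If -> (size psi <= N.+1)%N ->
  (forall phi : {poly R}, (size phi <= N.+1)%N ->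
     L2inner (derive1 (hatP b psi)) (derive1 (hatP b phi))
     + g * L2inner (hatP b psi) (hatP b phi) = L2inner If (hatP b phi)) ->
  forall p, (size p <= N.+1)%N ->
  H1norm (fun x => u x - hatP b psi x) (fun x => u' x - derive1 (hatP b psi) x) <=
  L2norm (fun x => u x - hatP b p x) + L2norm (fun x => u' x - hatP b (dpoly b p) x)
  + 2 / Num.min 1 g * (L2norm (fun x => f x - If x)
    + L2norm (fun x => u' x - hatP b (dpoly b p) x) + g * L2norm (fun x => u x - hatP b p x)).
Proof.
move=> g0 Hf Hu Hu' ae b0 [[chi _ IfE] _] psiN gal p pN.
set a0 := L2norm (fun x => u x - hatP b p x); set a1 := L2norm (fun x => u' x - hatP b (dpoly b p) x).
have [Lf _] := Hf; have [Lu [Lu' _]] := Hu.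
have LI : L2 If by rewrite IfE; exact: L2_hatP.
pose q := p - psi.
have qN : (size q <= N.+1)%N by rewrite (leq_trans (size_polyD _ _))// geq_max pN size_polyN.
have D r : derive1 (hatP b r) = hatP b (dpoly b r) by exact: derive1_hatP.
have G := gal q qN; have W := weak_form q b0 Hu Hu' Lf ae.
rewrite !D in G *.
have [Lp Lp'] := (L2_hatP p b0, L2_hatP (dpoly b p) b0).
have [Ls Ls'] := (L2_hatP psi b0, L2_hatP (dpoly b psi) b0).
have [Lq Lq'] := (L2_hatP q b0, L2_hatP (dpoly b q) b0).
have qE x : hatP b q x = hatP b p x - hatP b psi x by rewrite /q hatPB.
have q'E x : hatP b (dpoly b q) x = hatP b (dpoly b p) x - hatP b (dpoly b psi) x.
  by rewrite /q /dpoly derivB mulrBr -hatPB; congr hatP; ring.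
have I : L2inner (hatP b (dpoly b q)) (hatP b (dpoly b q)) + g * L2inner (hatP b q) (hatP b q) =
    L2inner (fun x => f x - If x) (hatP b q) - L2inner (fun x => u' x - hatP b (dpoly b p) x) (hatP b (dpoly b q))
    - g * L2inner (fun x => u x - hatP b p x) (hatP b q).
  rewrite {1}(funext q'E) {1}(funext qE).
  rewrite (ipBl Lp' Ls' Lq') (ipBl Lp Ls Lq) (ipBl Lf LI Lq) (ipBl Lu' Lp' Lq') (ipBl Lu Lp Lq).
  rewrite -G -W; ring.
have c1 := ip_CS (L2B Lf LI) Lq; have c2 := ip_CS (L2B Lu' Lp') Lq'; have c3 := ip_CS (L2B Lu Lp) Lq.
have m0 : 0 < Num.min 1 g by rewrite lt_min ltr01.
have m1 : Num.min 1 g <= 1 by rewrite ge_min lexx.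
have mg : Num.min 1 g <= g by rewrite ge_min lexx orbT.
have S : L2norm (hatP b q) + L2norm (hatP b (dpoly b q)) <=
    2 / Num.min 1 g * (L2norm (fun x => f x - If x) + a1 + g * a0).
  apply: cea_arith m0 m1 mg _ _ _ _ _ _; rewrite ?L2norm_ge0// -?/a0 -?/a1.
  rewrite [X in X + _]sqr_L2norm [X in _ + _ * X]sqr_L2norm I.
  exact: cs_arith.
have T0 : L2norm (fun x => u x - hatP b psi x) <= a0 + L2norm (hatP b q).
  by apply: (L2norm_triangle (L2B Lu Lp) Lq) => x; rewrite qE; ring.
have T1 : L2norm (fun x => u' x - hatP b (dpoly b psi) x) <= a1 + L2norm (hatP b (dpoly b q)).
  by apply: (L2norm_triangle (L2B Lu' Lp') Lq') => x; rewrite q'E; ring.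
have N0 : H1norm (fun x => u x - hatP b psi x) (fun x => u' x - hatP b (dpoly b psi) x) <=
    L2norm (fun x => u x - hatP b psi x) + L2norm (fun x => u' x - hatP b (dpoly b psi) x).
  rewrite /H1norm; have := L2norm_ge0 (fun x => u x - hatP b psi x).
  have := L2norm_ge0 (fun x => u' x - hatP b (dpoly b psi) x).
  move: (L2norm _) (L2norm _) => y x y0 x0.
  apply: ler_sqr_pos; first exact: addr_ge0.
  rewrite sqr_sqrtr ?addr_ge0 ?sqr_ge0// sqrrD addrAC lerDl mulrn_wge0// mulr_ge0//.
apply: (le_trans N0); apply: (le_trans (lerD T0 T1)).
by rewrite addrACA lerD2l.
Qed.

(** [x] and [y] stand for $N^{1/6}$ and $\beta^{-1}N^{-1/3}$, [t] for $\beta\sqrt N$ and [c] for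
    $2/\min(1,\gamma)$. *)
Lemma error_budget (c g K a0 a1 d e e' ef ef' t x y : R) :
  0 <= c -> 0 <= g -> 0 <= K -> 0 <= e -> 0 <= e' -> 0 <= t -> 0 <= x * ef -> 0 <= y * ef' ->
  a0 <= 29 * e -> a1 <= 58 * (e' + t * e) -> d <= K * (x * ef + y * ef') ->
  a0 + a1 + c * (d + a1 + g * a0) <=
  (87 + c * (K + 58 + 29 * g)) * (e' + (1 + t) * e + y * ef' + x * ef).
Proof.
move=> c0 g0 K0 e0 e'0 t0; move: (x * ef) (y * ef') => X Y X0 Y0 A0 A1 D.
have te := mulr_ge0 t0 e0; set T := e' + (1 + t) * e + Y + X.
have h0 : a0 <= 29 * T by rewrite /T; lra.
have h1 : a1 <= 58 * T by rewrite /T; lra.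
have hd : d <= K * T by apply: (le_trans D); rewrite ler_wpM2l// /T; lra.
have hg : g * a0 <= 29 * g * T by have := ler_wpM2l g0 h0; lra.
have := ler_wpM2l c0 (lerD (lerD hd h1) hg); move: T h0 h1 {hd hg} => T h0 h1; lra.
Qed.

End galerkin.

Theorem theorem4p1 (R : realType) (gamma : R) (hgamma : 0 < gamma) :
  exists C : R, forall (f f' u u' u'' : R -> R) (N : nat) (beta : R)
    (psiN : {poly R}) (If : R -> R),
    H1 f f' -> H1 u u' -> H1 u' u'' ->
    {ae (@lebesgue_measure R), forall x, - u'' x + gamma * u x = f x} ->
    u x @[x --> +oo] --> 0 -> u x @[x --> -oo] --> 0 ->
    (1 <= N)%N -> 0 < beta ->
    is_hermite_interp N beta f If ->
    (size psiN <= N.+1)%N ->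
    (forall phi : {poly R}, (size phi <= N.+1)%N ->
       L2inner (derive1 (hatP beta psiN)) (derive1 (hatP beta phi))
       + gamma * L2inner (hatP beta psiN) (hatP beta phi)
       = L2inner If (hatP beta phi)) ->
    H1norm (fun x => u x - hatP beta psiN x)
           (fun x => u' x - derive1 (hatP beta psiN) x)
    <= C * (E_err N beta u'
            + (1 + beta * Num.sqrt N%:R) * E_err N beta u
            + beta^-1 * N%:R `^ (- 3^-1) * E_err N beta f'
            + N%:R `^ (6^-1) * E_err N beta f).
Proof.
pose K1 : R := interp_cst R; have K10 : 0 <= K1 := interp_cst_ge0 R.
exists (87 + 2 / Num.min 1 gamma * (K1 + 58 + 29 * gamma)).
move=> f f' u u' u'' N beta psiN If Hf Hu Hu' ae _ _ N1 b0 HI sN gal.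
have [Lu _] := Hu.
have N0 : 0 < N%:R :> R by rewrite ltr0n.
(* The Airy scale is $k=N^{1/6}$; its inverse square is the factor $N^{-1/3}$ of the derivative
   term. *)
have k0 : 0 < (N%:R : R) `^ 6^-1 by rewrite powR_gt0.
have k6 : (N%:R `^ 6^-1) ^+ 6 = N%:R :> R.
  by rewrite -powR_mulrn ?(ltW k0)// -powRrM mulVf// powRr1// ltW.
have k2 : (N%:R `^ 6^-1) ^- 2 = N%:R `^ (- 3^-1) :> R.
  rewrite -powR_mulrn ?(ltW k0)// -powRrM powRN; congr (_ `^ _)^-1; by field.
have B0 := interp_error Hf N1 b0 k0 k6 HI; rewrite k2 in B0.
have := galerkin_error hgamma Hf Hu Hu' ae b0 HI sN gal (size_hproj b0 N.+1 u).
have A1 := hproj_deriv_error Hu N1 b0.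
(* Best approximation passes from the $N-1$ modes of [hproj_error] to the $N+1$ modes used here. *)
have A0 : L2norm (fun x => u x - hatP beta (hproj beta N.+1 u) x) <= 29 * E_err N beta u.
  apply: le_trans (hproj_error Lu N1 b0); apply: hproj_best => //.
  by rewrite (leq_trans (size_hproj b0 _ _))// (leq_trans (leq_pred _)).
move=> /le_trans; apply.
apply: error_budget A0 A1 B0; rewrite ?E_err_ge0 ?(ltW hgamma)//.
- by rewrite divr_ge0// le_min ler01 ltW.
- by rewrite mulr_ge0 ?sqrtr_ge0// ltW.
- by rewrite mulr_ge0 ?powR_ge0 ?E_err_ge0.
- by rewrite mulr_ge0 ?mulr_ge0 ?powR_ge0 ?E_err_ge0// invr_ge0 ltW.
Qed.
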